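(* Let $(Y_i(0),\beta_{is},w_{is},U_i,\mathcal{X}_s,\mathcal{Z}_s)_{1\le i\le N,\,1\le s\le S}$ be a triangular array as in the context (indexed by $S$, with $N=N_S$), let $X_i=\sum_{s=1}^S w_{is}\mathcal{X}_s$, $n_s=\sum_{i=1}^N w_{is}$, and let $\mathcal{F}_0$ be the $\sigma$-field generated by $(\mathcal{Z}_s,U_i,Y_i(0),\beta_{is},w_{is})_{i,s}$. Suppose: (1) the observed outcome is $Y_i=Y_i(0)+\sum_{s=1}^S w_{is}\mathcal{X}_s\beta_{is}$ and the observed control vector is $Z_i=\sum_{s=1}^S w_{is}\mathcal{Z}_s+U_i\in\mathbb{R}^K$, for all $i$; (2) for every $s$, $E[\mathcal{X}_s\mid\mathcal{F}_0]=E[\mathcal{X}_s\mid\mathcal{Z}_s]=\mathcal{Z}_s'\gamma$, for some $\gamma\in\mathbb{R}^K$; (3) for every $k$ with $\gamma_k\ne 0$, $N^{-1}\sum_{i=1}^N E[U_{ik}^2]\to 0$; (4) conditional on $\mathcal{F}_0$, $\mathcal{X}_1,\dots,\mathcal{X}_S$ are independent; (5) $\max_s n_s/\sum_{t=1}^S n_t\to 0$; (6) the support of $\beta_{is}$ is bounded (uniformly in $i,s,S$); (7) $\frac1N\sum_{i=1}^N\sum_{s=1}^S \mathrm{var}(\mathcal{X}_s\mid\mathcal{F}_0)\,w_{is}^2$ converges in probability to a strictly positive non-random limit; (8) for some $\nu>0$, $E[|\mathcal{X}_s|^{2+\nu}\mid\mathcal{F}_0]$ exists and is uniformly bounded, and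 conditional on $W$ the second moments of $Y_i(0)$, $U_i$ and $\mathcal{Z}_s$ exist and are bounded uniformly over $i$ and $s$; (9) $Z'Z/N$ converges in probability to a positive definite non-random limit. Let $\ddot X=X-Z(Z'Z)^{-1}Z'X$ and $\hat\beta=\ddot X'Y/\ddot X'\ddot X$. Then, with $\pi_{is}=w_{is}^2\,\mathrm{var}(\mathcal{X}_s\mid\mathcal{F}_0)$ and $$\beta=\frac{\sum_{i=1}^N\sum_{s=1}^S\pi_{is}\beta_{is}}{\sum_{i=1}^N\sum_{s=1}^S\pi_{is}},$$ we have $\hat\beta=\beta+o_p(1)$.
   Context: All limits are as $S\to\infty$, with the number of regions $N=N_S$ depending on $S$; $K$ and $\gamma$ are fixed. For each $S$ there are, on some probability space, random variables $Y_i(0),\beta_{is},\mathcal{X}_s\in\mathbb{R}$, $U_i,\mathcal{Z}_s\in\mathbb{R}^K$, and shares $w_{is}\ge 0$ with $\sum_{s=1}^S w_{is}\le 1$ for every $i$ ($i=1,\dots,N$, $s=1,\dots,S$); their joint distribution may change with $S$ (the index $S$ is suppressed). $W=(w_{is})$ is the $N\times S$ share matrix; $X,Y$ are the $N$-vectors with entries $X_i,Y_i$; $Z$ is the $N\times K$ matrix with rows $Z_i'$. Thus $\hat\beta$ is the OLS coefficient on $X_i$ in the regression of $Y_i$ on $X_i$ and $Z_i$. ''Uniformly bounded'' means bounded (almost surely) by a non-random constant not depending on $S$. Limit conditions on functions of $W$ alone are understood to hold almost surely. Ratios are understood where denominators are non-zero. *)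

(* Defs.v *)
From HB Require Import structures.
From mathcomp Require Import all_boot all_order all_algebra.
From mathcomp Require Import all_classical all_reals all_analysis.

Set Implicit Arguments.
Unset Strict Implicit.
Unset Printing Implicit Defensive.

Import Order.TTheory GRing.Theory Num.Theory.
Import numFieldNormedType.Exports.

Local Open Scope classical_set_scope.
Local Open Scope ring_scope.

Section Probability.
Context {d : measure_display} {Omega : measurableType d} {R : realType}.
Variable P : probability Omega R.

Definition sigma_generated (H : set (Omega -> R)) : set (set Omega) :=
  <<s \bigcup_(f in H) preimage_set_system setT f measurable >>.

(* [g] is a version of E[f | G], for a sub-sigma-algebra [G]. An equation
   E[f | G] = g between random variables always means that [g] is a version. *)
Definition is_cond_expectation (G : set (set Omega)) (f g : Omega -> R) : Prop :=
  [/\ P.-integrable setT (EFin \o f),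
      forall B : set R, measurable B -> G (g @^-1` B),
      P.-integrable setT (EFin \o g) &
      forall A, G A ->
        (\int[P]_(x in A) (f x)%:E = \int[P]_(x in A) (g x)%:E)%E].

(* [v] is a version of var(f | G) = E[(f - E[f | G])^2 | G]. *)
Definition is_cond_variance (G : set (set Omega)) (f v : Omega -> R) : Prop :=
  exists2 m : Omega -> R, is_cond_expectation G f m &
    is_cond_expectation G (fun x => (f x - m x) ^+ 2) v.

(* Mutual independence given [G]: almost surely,
   P(X_s \in B_s for all s | G) = \prod_s P(X_s \in B_s | G).
   Taking B_s = setT for some s covers the subfamilies. *)
Definition cond_independent (G : set (set Omega)) (S : nat)
    (X : 'I_S -> Omega -> R) : Prop :=
  forall B : 'I_S -> set R, (forall s, measurable (B s)) ->
  exists2 p : 'I_S -> Omega -> R,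
    forall s, is_cond_expectation G (\1_(X s @^-1` B s)) (p s) &
    is_cond_expectation G (\1_(\bigcap_(s in [set: 'I_S]) X s @^-1` B s))
      (fun x => \prod_(s < S) p s x).

(* E[f | G] exists and is almost surely at most the constant [C]. *)
Definition cond_expectation_le (G : set (set Omega)) (f : Omega -> R) (C : R) :
    Prop :=
  exists2 m : Omega -> R, is_cond_expectation G f m &
    {ae P, forall x, m x <= C}.

Definition cvg_in_probability {V : normedModType R} (X : nat -> Omega -> V)
    (l : V) : Prop :=
  forall e : R, 0 < e -> P [set x | e <= `|X n x - l|] @[n --> \oo] --> 0%E.

End Probability.

Definition positive_definite {R : realType} {K : nat} (Q : 'M[R]_K) : Prop :=
  Q^T = Q /\ forall v : 'cV[R]_K, v != 0 -> 0 < (v^T *m Q *m v) ord0 ord0.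

(* When Z'Z is singular or the denominator vanishes, the values below are the
   library's junk values; they carry no meaning. *)
Section OLS.
Context {R : realType} {n K : nat}.

Definition ols_residual (Z : 'M[R]_(n, K)) (X : 'cV[R]_n) : 'cV[R]_n :=
  X - Z *m (invmx (Z^T *m Z) *m (Z^T *m X)).

Definition ols_coefficient (Z : 'M[R]_(n, K)) (X Y : 'cV[R]_n) : R :=
  let Xdd := ols_residual Z X in
  (Xdd^T *m Y) ord0 ord0 / (Xdd^T *m Xdd) ord0 ord0.

End OLS.

(* One row of the triangular array: [N] regions, [S] sectors, [K] controls. All
   rows live on one probability space, as required for an almost sure limit as
   S grows; nothing relates the joint distributions of different rows. *)
Section Row.
Context {d : measure_display} {Omega : measurableType d} {R : realType}.
Context {P : probability Omega R} {N S K : nat}.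

Definition sigmaW (w : 'I_N -> 'I_S -> {RV P >-> R}) : set (set Omega) :=
  sigma_generated [set f : Omega -> R | exists i s, f = w i s].

Definition sigmaZ (Zs : 'I_S -> 'I_K -> {RV P >-> R}) (s : 'I_S) :
    set (set Omega) :=
  sigma_generated [set f : Omega -> R | exists k, f = Zs s k].

Definition sigmaF0 (Zs : 'I_S -> 'I_K -> {RV P >-> R})
    (U : 'I_N -> 'I_K -> {RV P >-> R}) (Y0 : 'I_N -> {RV P >-> R})
    (beta w : 'I_N -> 'I_S -> {RV P >-> R}) : set (set Omega) :=
  sigma_generated
    ([set f : Omega -> R | exists s k, f = Zs s k] `|`
     [set f : Omega -> R | exists i k, f = U i k] `|`
     [set f : Omega -> R | exists i, f = Y0 i] `|`
     [set f : Omega -> R | exists i s, f = beta i s] `|`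
     [set f : Omega -> R | exists i s, f = w i s]).

Definition sector_size (w : 'I_N -> 'I_S -> {RV P >-> R}) (s : 'I_S)
    (x : Omega) : R :=
  \sum_(i < N) w i s x.

(* The weights pi_is, with [v s] a version of var(X_s | F_0). *)
Definition estimand_weight (w : 'I_N -> 'I_S -> {RV P >-> R})
    (v : 'I_S -> Omega -> R) (i : 'I_N) (s : 'I_S) (x : Omega) : R :=
  w i s x ^+ 2 * v s x.

Definition estimand (w beta : 'I_N -> 'I_S -> {RV P >-> R})
    (v : 'I_S -> Omega -> R) (x : Omega) : R :=
  (\sum_(i < N) \sum_(s < S) estimand_weight w v i s x * beta i s x) /
  (\sum_(i < N) \sum_(s < S) estimand_weight w v i s x).

End Row.

(* Main.v *)
(* Conditionally on F_0 the residuals e_s = X_s - Z_s'gamma are independent and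
   centred. On the event that Z'Z is invertible, annihilating Z leaves
   X - Z(Z'Z)^-1 Z'X = a - Z(Z'Z)^-1 Z'a with a_i = sum_s w_is e_s - U_i'gamma,
   and the second term of a is negligible in mean square by (3). So everything
   reduces to forms in the e_s. Linear forms sum_i h_i sum_s w_is e_s / N, with h
   F_0-measurable, have conditional variance at most a constant times
   (max_s n_s / N) sum_i h_i^2 / N, which vanishes; this removes the projection
   on Z and the part of Y that is F_0-measurable. The quadratic form
   sum_i (sum_s w_is e_s)(sum_s w_is beta_is e_s) / N is, after truncation of the
   X_s, a sum of orthogonal increments around sum_is w_is^2 var(X_s | F_0) beta_is / N,
   with variance O(max_s n_s / N). Taking beta = 1 and Y(0) = 0 gives the
   denominator, which by (7) stays away from 0. *)
Require Import Defs.
From HB Require Import structures.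
From mathcomp Require Import all_boot all_order all_algebra.
From mathcomp Require Import all_classical all_reals all_analysis.
From mathcomp Require Import perm measurable_realfun ring lra.

Set Implicit Arguments.
Unset Strict Implicit.
Unset Printing Implicit Defensive.

Import Order.TTheory GRing.Theory Num.Theory.
Import numFieldNormedType.Exports.

Local Open Scope classical_set_scope.
Local Open Scope ring_scope.

(** Two obstacles shape the proof. The variance of a quadratic form calls for fourth moments of the
    shocks, while (8) grants order [2 + nu]; and conditional independence is given for indicators of
    events only, each choice of sets with its own versions. One device meets both: a shock is
    replaced by a step function of itself, which is bounded and a finite combination of indicators,
    with a conditional mean square error that the moment of order [2 + nu] makes small uniformly in
    [s] and [S]. No conditional law is formed: a conditional identity is used as a family of
    equalities of expectations against bounded test functions, which may also involve the other
    shocks. As an almost sure bound does not make a function bounded, versions and [beta] are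
    clipped so as to be bounded everywhere. The truncation level is fixed before [S] grows: forms in
    truncated shocks vanish in probability, and the remainder is small in mean. Condition (5) is
    only asymptotic, so coefficients are multiplied by the indicator of an event of F_0 on which the
    size bound holds, which keeps them F_0-measurable. *)

Definition bounded_mfun {d} {T : measurableType d} {R : realType}
    (f : T -> R) : Prop :=
  measurable_fun setT f /\ exists M : R, forall x, `|f x| <= M.

(** * The algebra of bounded measurable test functions *)

Section BoundedMeasurable.
Context {d} {T : measurableType d} {R : realType}.
Implicit Types f g : T -> R.

Lemma bounded_mfun_cst (c : R) : bounded_mfun (fun _ : T => c).
Proof. by split; [exact: measurable_cst | exists `|c|]. Qed.

Lemma bounded_mfunD f g :
  bounded_mfun f -> bounded_mfun g -> bounded_mfun (fun x => f x + g x).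
Proof.
move=> [mf [M fM]] [mg [L gL]]; split; first exact: measurable_funD.
by exists (M + L) => x; rewrite (le_trans (ler_normD _ _))// lerD.
Qed.

Lemma bounded_mfunM f g :
  bounded_mfun f -> bounded_mfun g -> bounded_mfun (fun x => f x * g x).
Proof.
move=> [mf [M fM]] [mg [L gL]]; split; first exact: measurable_funM.
by exists (M * L) => x; rewrite normrM ler_pM.
Qed.

Lemma bounded_mfunN f : bounded_mfun f -> bounded_mfun (fun x => - f x).
Proof.
move=> bf; have := bounded_mfunM (bounded_mfun_cst (-1)) bf.
by under eq_fun do rewrite mulN1r.
Qed.

Lemma bounded_mfunB f g :
  bounded_mfun f -> bounded_mfun g -> bounded_mfun (fun x => f x - g x).
Proof. by move=> bf bg; apply: bounded_mfunD => //; exact: bounded_mfunN. Qed.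

Lemma bounded_mfunX f n : bounded_mfun f -> bounded_mfun (fun x => f x ^+ n).
Proof.
move=> bf; elim: n => [|n IH].
  by under eq_fun do rewrite expr0; exact: bounded_mfun_cst.
by under eq_fun do rewrite exprS; exact: bounded_mfunM.
Qed.

Lemma bounded_mfun_sum I (r : seq I) (p : pred I) (F : I -> T -> R) :
  (forall i, bounded_mfun (F i)) ->
  bounded_mfun (fun x => \sum_(i <- r | p i) F i x).
Proof.
move=> bF; elim: r => [|i r IH].
  by under eq_fun do rewrite big_nil; exact: bounded_mfun_cst.
case pi : (p i); last by under eq_fun do rewrite big_cons pi.
by under eq_fun do rewrite big_cons pi; exact: bounded_mfunD.
Qed.

Lemma bounded_mfun_indic (A : set T) :
  measurable A -> bounded_mfun (\1_A : T -> R).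
Proof.
move=> mA; split; first exact: measurable_indic.
by exists 1 => x; rewrite indicE; case: (_ \in _); rewrite ?normr1 ?normr0.
Qed.

Lemma bounded_mfun_norm f : bounded_mfun f -> bounded_mfun (fun x => `|f x|).
Proof.
move=> [mf [M fM]]; split; first exact: measurableT_comp.
by exists M => x; rewrite normr_id.
Qed.

Lemma measurable_set_le f g : measurable_fun setT f -> measurable_fun setT g ->
  measurable [set x | f x <= g x].
Proof.
move=> mf mg; rewrite -[X in measurable X]setTI.
have := measurable_fun_ler mf mg => /(_ measurableT [set true]).
by apply.
Qed.

End BoundedMeasurable.

(** * Real-valued expectations on a probability space *)

Section Expectation.
Context {d} {T : measurableType d} {R : realType} (P : probability T R).
Local Notation "''E' f" := (Rintegral P setT f) (at level 10, f at level 9).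
Local Notation L1 f := (P.-integrable setT (EFin \o f)).
Implicit Types f g h : T -> R.

Lemma bounded_integrable f : bounded_mfun f -> L1 f.
Proof.
move=> [mf [M fM]]; apply: measurable_bounded_integrable => //.
  by rewrite (le_lt_trans (probability_le1 _ _))// ltry.
exists M; split=> [|x Mx y _ /=]; first exact: num_real.
exact/ltW/(le_lt_trans (fM y)).
Qed.

Lemma integrable_measurable f : L1 f -> measurable_fun setT f.
Proof. by move=> /measurable_int/measurable_EFinP. Qed.

Lemma le_integrableR f g : measurable_fun setT f ->
  (forall x, `|f x| <= g x) -> L1 g -> L1 f.
Proof.
move=> mf fg; apply: le_integrable => //; first exact/measurable_EFinP.
by move=> x _ /=; rewrite lee_fin (le_trans (fg x))// ler_norm.
Qed.

Lemma integrableDR f g : L1 f -> L1 g -> L1 (fun x => f x + g x).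
Proof.
move=> lf lg.
exact: (@integrableD _ _ _ P _ measurableT (EFin \o f) (EFin \o g)).
Qed.

Lemma integrableZR (c : R) f : L1 f -> L1 (fun x => c * f x).
Proof.
move=> lf; exact: (@integrableZl _ _ _ P _ measurableT c (EFin \o f)).
Qed.

Lemma integrableNR f : L1 f -> L1 (fun x => - f x).
Proof.
by move=> /(integrableZR (-1)); under eq_fun do rewrite /= mulN1r.
Qed.

Lemma integrableBR f g : L1 f -> L1 g -> L1 (fun x => f x - g x).
Proof. by move=> *; apply: integrableDR => //; exact: integrableNR. Qed.

Lemma integrable_normR f : L1 f -> L1 (fun x => `|f x|).
Proof. by move=> /integrable_abse. Qed.

Lemma integrableMR f h : L1 f -> bounded_mfun h -> L1 (fun x => f x * h x).
Proof.
move=> lf [mh [M hM]].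
apply: (@le_integrableR _ (fun x => M * `|f x|)).
- by apply: measurable_funM => //; exact: integrable_measurable.
- by move=> x; rewrite normrM mulrC ler_wpM2r.
- exact/integrableZR/integrable_normR.
Qed.

Lemma integrable_sumR I (r : seq I) (p : pred I) (F : I -> T -> R) :
  (forall i, p i -> L1 (F i)) -> L1 (fun x => \sum_(i <- r | p i) F i x).
Proof.
move=> LF; have := integrable_sum (measurableT : measurable [set: T]) r LF.
by under eq_fun do rewrite sumEFin.
Qed.

Lemma expectationDR f g : L1 f -> L1 g ->
  'E (fun x => f x + g x) = 'E f + 'E g.
Proof. by move=> *; exact: RintegralD. Qed.

Lemma expectationBR f g : L1 f -> L1 g ->
  'E (fun x => f x - g x) = 'E f - 'E g.
Proof. by move=> *; exact: RintegralB. Qed.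

Lemma expectationZR (c : R) f : L1 f -> 'E (fun x => c * f x) = c * 'E f.
Proof. by move=> *; exact: RintegralZl. Qed.

Lemma expectation_cstR (c : R) : 'E (fun=> c) = c.
Proof.
rewrite Rintegral_cst//; transitivity (c * fine 1%E); last by rewrite mulr1.
by congr (_ * fine _); exact: probability_setT.
Qed.

Lemma expectation_sumR I (r : seq I) (p : pred I) (F : I -> T -> R) :
  (forall i, p i -> L1 (F i)) ->
  'E (fun x => \sum_(i <- r | p i) F i x) = \sum_(i <- r | p i) 'E (F i).
Proof.
move=> LF; elim: r => [|i r IH].
  by under [X in 'E X]eq_fun do rewrite big_nil; rewrite big_nil expectation_cstR.
rewrite big_cons; case pi : (p i); last first.
  by rewrite -IH; under [X in 'E X]eq_fun do rewrite big_cons pi.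
under [X in 'E X]eq_fun do rewrite big_cons pi.
by rewrite expectationDR ?IH//; [exact: LF|exact: integrable_sumR].
Qed.

Lemma le_expectationR f g : L1 f -> L1 g -> (forall x, f x <= g x) ->
  'E f <= 'E g.
Proof. by move=> lf lg fg; apply: le_Rintegral. Qed.

Lemma expectation_ge0R f : (forall x, 0 <= f x) -> 0 <= 'E f.
Proof. by move=> f0; exact: Rintegral_ge0. Qed.

Lemma norm_expectation_le f : L1 f -> `|'E f| <= 'E (fun x => `|f x|).
Proof. by move=> lf; apply: le_normr_Rintegral. Qed.

Lemma EFin_expectationR f : L1 f -> (\int[P]_x (f x)%:E)%E = ('E f)%:E.
Proof. by move=> lf; rewrite /Rintegral fineK//; exact: integrable_fin_num. Qed.

Lemma ae_expectationR f g : measurable_fun setT f -> measurable_fun setT g ->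
  {ae P, forall x, f x = g x} -> 'E f = 'E g.
Proof.
move=> mf mg fg; rewrite /Rintegral; congr fine.
apply: ae_eq_integral => //; [exact/measurable_EFinP|exact/measurable_EFinP|].
by apply: filterS fg => x fgx _; rewrite /= fgx.
Qed.

Lemma ae_integrableR f g : L1 f -> measurable_fun setT g ->
  {ae P, forall x, f x = g x} -> L1 g.
Proof.
move=> lf mg fg; apply/integrableP; split; first exact/measurable_EFinP.
rewrite (ae_eq_integral (fun x => `|(EFin \o f) x|)%E)//.
- by case/integrableP: lf.
- by apply: measurableT_comp => //; exact/measurable_EFinP.
- by apply: measurableT_comp => //; exact: measurable_int lf.
- by apply: filterS fg => x fgx _; rewrite /= fgx.
Qed.

Lemma ae_eq0_expectation f : L1 f -> (forall x, 0 <= f x) -> 'E f <= 0 ->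
  {ae P, forall x, f x = 0}.
Proof.
move=> lf f0 Ef; have /ae_eq_integral_abs : measurable_fun setT (EFin \o f).
  exact/measurable_EFinP/integrable_measurable.
move=> /(_ P measurableT)[+ _]; rewrite (_ : \int[P]_x _ = 0)%E.
  by move=> /(_ erefl); apply: filterS => x /(_ I) [].
transitivity (\int[P]_x (f x)%:E)%E.
  by apply: eq_integral => x _ /=; rewrite ger0_norm.
rewrite EFin_expectationR//; congr EFin; apply/eqP.
by rewrite eq_le Ef expectation_ge0R.
Qed.

Lemma markovR f (e : R) : 0 < e -> L1 f -> (forall x, 0 <= f x) ->
  (P [set x | (e <= f x)%R] <= ('E f / e)%:E)%E.
Proof.
move=> e0 lf f0; have mA : measurable [set x | e <= f x].
  by apply: measurable_set_le => //; exact: integrable_measurable.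
have lA := bounded_integrable (@bounded_mfun_indic _ _ R _ mA).
have -> : P [set x | e <= f x] = ('E (\1_[set x | e <= f x]))%:E.
  by rewrite -EFin_expectationR// integral_indic// setIT.
rewrite lee_fin ler_pdivlMr// mulrC -expectationZR//.
apply: le_expectationR => //; first exact: integrableZR.
move=> x; rewrite indicE; case: (boolP (x \in _)) => [|_] /=.
  by rewrite mulr1 inE.
by rewrite mulr0.
Qed.

End Expectation.

(** * Uniform approximation of a real number by a step function *)

Section ClipFloor.
Context {R : realType}.
Implicit Types r u : R.

(** The indicators [k.+1%:R <= u] decrease in [k], so a new one can be 1 only while all earlier ones
    are. The first case is saturation; in the second the count is the integer part of [u]. *)
Lemma count_le_floor (m : nat) u : 0 <= u ->
  let c := \sum_(k < m) (k.+1%:R <= u)%R%:R in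
  (c = m%:R /\ m%:R <= u) \/ [/\ c <= u, u < c + 1 & c <= m%:R :> R].
Proof.
move=> u0; elim: m => [|m IH]; first by left; rewrite /= big_ord0.
rewrite /= big_ord_recr /=; case: IH => [[-> mu]|[cu uc cm]].
  have [Smu|uSm] := leP m.+1%:R u; first by left; rewrite -natr1.
  by right; rewrite addr0 natr1; split => //; rewrite ler_nat.
have -> : (m.+1%:R <= u) = false.
  by apply/negbTE; rewrite -ltNge (lt_le_trans uc)// -natr1 lerD2r.
by right; rewrite addr0; split => //; rewrite (le_trans cm)// ler_nat.
Qed.

(* [r] clipped to [-n, n] and rounded down to a multiple of [1/n], as an
   explicit combination of indicators of half-lines. *)
Definition clip_floor (n : nat) r : R :=
  \sum_(k < (n * n).*2) n%:R^-1 * (- n%:R + k.+1%:R / n%:R <= r)%R%:R - n%:R.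

Lemma clip_floorE n r : (0 < n)%N ->
  clip_floor n r =
  n%:R^-1 * (\sum_(k < (n * n).*2) (k.+1%:R <= (r + n%:R) * n%:R)%R%:R) - n%:R.
Proof.
move=> n0; rewrite /clip_floor mulr_sumr; congr (_ - _).
apply: eq_bigr => k _; congr (_ * (nat_of_bool _)%:R).
by rewrite addrC lerBlDr ler_pdivrMr// ltr0n.
Qed.

Lemma clip_floor_bound n r : (0 < n)%N -> `|clip_floor n r| <= n%:R.
Proof.
move=> n0; rewrite clip_floorE//.
set c := \sum_(k < _) _.
have c0 : 0 <= c by apply: sumr_ge0 => k _; rewrite ler0n.
have cm : c <= (n * n).*2%:R.
  rewrite -[X in _ <= X%:R]card_ord -sum1_card natr_sum; apply: ler_sum => k _.
  by rewrite lern1 leq_b1.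
have nR : 0 < n%:R :> R by rewrite ltr0n.
have : n%:R^-1 * c <= n%:R * 2.
  by rewrite mulrC ler_pdivrMr// (le_trans cm)// -muln2 !natrM mulrAC.
have : 0 <= n%:R^-1 * c by rewrite mulr_ge0// invr_ge0 ltW.
by rewrite ler_norml => *; apply/andP; split; lra.
Qed.

Lemma clip_floor_near n r : (0 < n)%N -> `|r| <= n%:R ->
  `|r - clip_floor n r| <= n%:R^-1.
Proof.
move=> n0; rewrite clip_floorE// ler_norml => /andP[nr rn].
have nR : 0 < n%:R :> R by rewrite ltr0n.
have u0 : 0 <= (r + n%:R) * n%:R by apply: mulr_ge0; [lra|exact: ltW].
(* The thresholds, [2 * n ^ 2] of them at distance [1 / n], cover [[-n, n]]; hence saturation of the
   count forces the rescaled point to be the last threshold, and the rounding error stays below one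
   step. *)
have um : (r + n%:R) * n%:R <= (n * n).*2%:R.
  by rewrite -muln2 !natrM mulrAC; apply: ler_wpM2r; [exact: ltW|lra].
have := count_le_floor (n * n).*2 u0 => /=; set c := \sum_(k < _) _ => cP.
have [cu uc] : c <= (r + n%:R) * n%:R /\ (r + n%:R) * n%:R <= c + 1.
  case: cP => [[-> mu]|[cu /ltW uc _]//].
  by split => //; rewrite (le_trans um)// lerDl.
have -> : r - (n%:R^-1 * c - n%:R) = n%:R^-1 * ((r + n%:R) * n%:R - c).
  by rewrite mulrBr mulrCA mulVf ?gt_eqF// mulr1; ring.
have i0 : 0 <= n%:R^-1 :> R by rewrite invr_ge0 ltW.
by rewrite ger0_norm ?mulr_ge0 ?subr_ge0// -[leRHS]mulr1 ler_wpM2l//; lra.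
Qed.

Lemma sqr_le_powR (nu r : R) : 0 < nu -> r ^+ 2 <= 1 + `|r| `^ (2 + nu).
Proof.
move=> nu0; have [r1|r1] := leP `|r| 1.
  rewrite -normr_id -real_normK ?num_real// normr_id.
  by rewrite (@le_trans _ _ 1)// ?lerDl ?powR_ge0// exprn_ile1.
rewrite -real_normK ?num_real// -powR_mulrn//.
rewrite (@le_trans _ _ (`|r| `^ (2 + nu)))//; last by rewrite lerDr.
by rewrite ler_powR ?(ltW r1)// lerDl ltW.
Qed.

(** Within [[-n, n]] the rounding error is at most [1 / n]; beyond, the error is at most [2 * |r|],
    and its square is absorbed by the excess power [nu]. Since [n] is chosen before [r], the bound
    integrates to one common to all shocks. *)
Lemma clip_floor_approx (nu e : R) : 0 < nu -> 0 < e ->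
  exists2 n, (0 < n)%N &
    forall r, (r - clip_floor n r) ^+ 2 <= e * (1 + `|r| `^ (2 + nu)).
Proof.
move=> nu0 e0.
(* In turn: [n >= 1]; the rounding error satisfies [1 / n <= e]; and [n] to the power [nu] is at
   least [4 / e], with 4 the square of the factor in the bound [2 * |r|] outside [[-n, n]]. *)
pose a := Num.max 1 (Num.max e^-1 ((4 / e) `^ nu^-1)).
pose n := (Num.truncn a).+1.
have an : a <= n%:R by rewrite ltW// truncnS_gt.
have [n1 ne nn] : [/\ 1 <= n%:R :> R, e^-1 <= n%:R & 4 / e <= n%:R `^ nu].
  move: an; rewrite !ge_max => /and3P[n1 ne nn]; split => //.
  have -> : 4 / e = ((4 / e) `^ nu^-1) `^ nu.
    by rewrite -powRrM mulVf ?gt_eqF// powRr1// divr_ge0 ?ltW.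
  by rewrite ge0_ler_powR ?nnegrE ?powR_ge0// ltW.
exists n => // r; have [rn|nr] := leP `|r| n%:R.
  rewrite -real_normK ?num_real//.
  have := clip_floor_near (isT : (0 < n)%N) rn; set t : R := `|_| => tn.
  have t0 : 0 <= t by exact: normr_ge0.
  have n0 : 0 < n%:R^-1 :> R by rewrite invr_gt0 (lt_le_trans ltr01).
  have ni : n%:R^-1 <= e.
    by rewrite -[leRHS]invrK lef_pV2 ?posrE ?invr_gt0// (lt_le_trans ltr01).
  have n1' : n%:R^-1 <= 1 :> R by rewrite invf_le1// (lt_le_trans ltr01).
  rewrite (@le_trans _ _ (e * 1))//; last by rewrite ler_pM2l// lerDl powR_ge0.
  by rewrite expr2; nra.
have r1 : 1 < `|r| by exact: le_lt_trans nr.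
have r0 : 0 < `|r| by exact: lt_trans r1.
have : `|r - clip_floor n r| <= 2 * `|r|.
  rewrite (le_trans (ler_normB _ _))//.
  by have := clip_floor_bound r (isT : (0 < n)%N); lra.
rewrite -(@real_normK _ (r - _)) ?num_real//; set t : R := `|_ - _| => tr.
have t0 : 0 <= t by exact: normr_ge0.
rewrite powRD ?(gt_eqF r0) ?implybT// powR_mulrn ?normr_ge0//.
have : 4 / e <= `|r| `^ nu.
  by rewrite (le_trans nn)// ge0_ler_powR ?nnegrE ?ltW// ltr0n.
rewrite ler_pdivrMr// => re.
rewrite (@le_trans _ _ (4 * `|r| ^+ 2))//; first by nra.
rewrite (@le_trans _ _ (`|r| ^+ 2 * (`|r| `^ nu * e)))//.
  by rewrite mulrC ler_wpM2l ?sqr_ge0.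
by rewrite mulrA [leLHS]mulrC ler_pM2l// lerDr.
Qed.

Lemma bounded_clip_floor {d} {T : measurableType d} (n : nat) (X : T -> R) :
  measurable_fun setT X -> bounded_mfun (fun x => clip_floor n (X x)).
Proof.
move=> mX; apply: bounded_mfunB; last exact: bounded_mfun_cst.
apply: bounded_mfun_sum => k; apply: bounded_mfunM; first exact: bounded_mfun_cst.
have := @bounded_mfun_indic _ T R [set x | - n%:R + k.+1%:R / n%:R <= X x].
move=> /(_ (@measurable_set_le _ _ _ (fun=> _) _ (measurable_cst _) mX)).
rewrite (_ : \1__ = fun x => (- n%:R + k.+1%:R / n%:R <= X x)%R%:R)//.
by apply/funext => x; rewrite indicE; congr (nat_of_bool _)%:R; apply/idP/idP; rewrite inE.
Qed.

End ClipFloor.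

(** * Conditional expectation *)

Section SubSigma.
Context {d} {T : measurableType d} {R : realType} (P : probability T R).
Local Notation "''E' f" := (Rintegral P setT f) (at level 10, f at level 9).
Local Notation L1 f := (P.-integrable setT (EFin \o f)).
Variable C : set (set T).
Hypothesis Cmeasurable : C `<=` measurable.
Local Notation smeasurable f :=
  (measurable_fun (T:=g_sigma_algebraType C) setT f).
Local Notation sbounded f := (@bounded_mfun _ (g_sigma_algebraType C) _ f).
Implicit Types f g h : T -> R.

Lemma sub_sigma_measurable : <<s C >> `<=` measurable.
Proof. by apply: smallest_sub => //; exact: sigma_algebra_measurable. Qed.

Lemma smeasurable_measurable f : smeasurable f -> measurable_fun setT f.
Proof. by move=> mf _ B mB; apply: sub_sigma_measurable; exact: mf. Qed.

(** The sub-sigma-algebra is a second measurable structure on the same points, so the closure lemmas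
    for [bounded_mfun] serve both structures; this inclusion passes from the coarse one to the fine
    one, where integrals live. *)
Lemma sbounded_bounded h : sbounded h -> bounded_mfun h.
Proof. by move=> [mh hM]; split => //; exact: smeasurable_measurable. Qed.

Lemma smeasurableP f :
  smeasurable f <-> (forall B, measurable B -> <<s C >> (f @^-1` B)).
Proof.
split=> [mf B mB|mf _ B mB]; last by rewrite setTI; exact: mf.
by have := mf measurableT _ mB; rewrite setTI.
Qed.

Lemma cond_expectation_smeasurable f g :
  is_cond_expectation P <<s C >> f g -> smeasurable g.
Proof. by move=> [_ mg _ _]; exact/smeasurableP. Qed.

Lemma cond_expectation_indic f g A : is_cond_expectation P <<s C >> f g ->
  <<s C >> A -> 'E (fun x => f x * \1_A x) = 'E (fun x => g x * \1_A x).
Proof.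
move=> [lf mg lg fg] sA; rewrite /Rintegral; congr fine.
have := fg A sA; rewrite !(integral_mkcond A) => fgA.
transitivity (\int[P]_x ((fun x => (f x)%:E) \_ A) x)%E; last rewrite fgA.
  apply: eq_integral => x _; rewrite patchE indicE.
  by case: ifP; rewrite ?mulr1 ?mulr0.
apply: eq_integral => x _; rewrite patchE indicE.
by case: ifP; rewrite ?mulr1 ?mulr0.
Qed.

Lemma cond_expectation_mean f g :
  is_cond_expectation P <<s C >> f g -> 'E f = 'E g.
Proof.
move=> fg; have := cond_expectation_indic fg (@measurableT _ (g_sigma_algebraType C)).
by under eq_fun do rewrite indicT mulr1; under [X in _ = 'E X]eq_fun do rewrite indicT mulr1.
Qed.

(** The definition gives the identity for indicators. It extends by linearity to the step function
    [clip_floor n (h x)], which is uniformly within [1 / n] of [h] once [n] exceeds the bound of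
    [h]. *)
Lemma cond_expectation_pull f g h : is_cond_expectation P <<s C >> f g ->
  sbounded h -> 'E (fun x => f x * h x) = 'E (fun x => g x * h x).
Proof.
move=> fg bh; have [lf _ lg _] := fg; have bh' := sbounded_bounded bh.
have [mh [M hM]] := bh.
have step n : (0 < n)%N -> 'E (fun x => f x * clip_floor n (h x)) =
                           'E (fun x => g x * clip_floor n (h x)).
  move=> n0; rewrite /clip_floor.
  pose A k := [set x | - n%:R + k.+1%:R / n%:R <= h x].
  have sA k : <<s C >> (A k).
    by apply: (@measurable_set_le _ (g_sigma_algebraType C)) => //; exact: measurable_cst.
  have key f' : L1 f' -> 'E (fun x => f' x * (\sum_(k < (n * n).*2) n%:R^-1 *
        (- n%:R + k.+1%:R / n%:R <= h x)%R%:R - n%:R)) =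
      \sum_(k < (n * n).*2) n%:R^-1 * 'E (fun x => f' x * \1_(A k) x)
        - n%:R * 'E f'.
    move=> lf'.
    have lA k : L1 (fun x => f' x * \1_(A k) x).
      apply: integrableMR => //; apply: bounded_mfun_indic.
      exact: sub_sigma_measurable.
    rewrite -expectationZR//.
    under eq_bigr do rewrite -expectationZR//.
    rewrite -expectation_sumR; last by move=> *; exact: integrableZR.
    rewrite -expectationBR; last 2 first.
      by apply: integrable_sumR => *; exact: integrableZR.
      exact: integrableZR.
    congr Rintegral; apply/funext => x; rewrite mulrBr mulr_sumr mulrC [n%:R * _]mulrC.
    rewrite [(f' x) * n%:R]mulrC; congr (_ - _); apply: eq_bigr => k _.
    rewrite mulrCA indicE; congr (_ * (_ * _)); congr (nat_of_bool _)%:R.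
    by apply/idP/idP; rewrite inE.
  rewrite !key// (cond_expectation_mean fg); congr (_ - _).
  by apply: eq_bigr => k _; rewrite (cond_expectation_indic fg (sA k)).
have near f' n : L1 f' -> (0 < n)%N -> M <= n%:R ->
    `|'E (fun x => f' x * h x) - 'E (fun x => f' x * clip_floor n (h x))| <=
    n%:R^-1 * 'E (fun x => `|f' x|).
  move=> lf' n0 Mn; have bc := bounded_clip_floor n bh'.1.
  have lD : L1 (fun x => f' x * h x - f' x * clip_floor n (h x)).
    by apply: integrableBR; exact: integrableMR.
  rewrite -expectationBR; [|exact: integrableMR|exact: integrableMR].
  rewrite (le_trans (norm_expectation_le lD))// -expectationZR; last exact: integrable_normR.
  apply: le_expectationR; first exact: integrable_normR.
    exact/integrableZR/integrable_normR.
  move=> x; rewrite -mulrBr normrM mulrC ler_wpM2r//.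
  by apply: clip_floor_near => //; exact: le_trans (hM x) Mn.
apply/eqP; rewrite -subr_eq0 -normr_le0; apply/ler_addgt0Pl => e e0; rewrite addr0.
set a := 'E (fun x => `|f x|); set b := 'E (fun x => `|g x|).
have a0 : 0 <= a by exact: expectation_ge0R.
have b0 : 0 <= b by exact: expectation_ge0R.
(* [n >= M] makes the clipping inactive, and [n >= (a + b) / e] makes the two approximation errors
   [a / n] and [b / n] add up to at most [e]. *)
pose n := (Num.truncn (Num.max M ((a + b) / e))).+1.
have : Num.max M ((a + b) / e) <= n%:R by rewrite ltW// truncnS_gt.
rewrite ge_max => /andP[Mn abn].
have nf := near f n lf isT Mn; have ng := near g n lg isT Mn.
rewrite (step n isT) -/a in nf; rewrite -/b in ng.
have nR : 0 < n%:R :> R by rewrite ltr0n.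
have : n%:R^-1 * (a + b) <= e by rewrite mulrC ler_pdivrMr// mulrC -ler_pdivrMr.
move: nf ng; rewrite !ler_norml => /andP[? ?] /andP[? ?] ?; apply/andP; split; lra.
Qed.

(** Tested on the event [M < g x] itself, the hypothesis says that the nonnegative function [g - M]
    times the indicator of that event has nonpositive mean, so it vanishes almost surely. *)
Lemma ae_le_cst g (M : R) : L1 g -> smeasurable g ->
  (forall A, <<s C >> A -> 'E (fun x => g x * \1_A x) <= M * 'E (\1_A)) ->
  {ae P, forall x, g x <= M}.
Proof.
move=> lg mg gM; pose A := [set x | M < g x].
have sA : <<s C >> A.
  have := sigma_algebraC (@measurable_set_le _ (g_sigma_algebraType C) R
    g (fun=> M) mg (measurable_cst _)).
  by congr (<<s C >> _); apply/seteqP; split => x /=; rewrite /A/= ltNge => /negP.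
have bA : bounded_mfun (\1_A : T -> R).
  by apply: bounded_mfun_indic; exact: sub_sigma_measurable.
have lA := bounded_integrable P bA.
have lh : L1 (fun x => g x * \1_A x - M * \1_A x).
  by apply: integrableBR; [exact: integrableMR|exact: integrableZR].
have : {ae P, forall x, g x * \1_A x - M * \1_A x = 0}.
  apply: ae_eq0_expectation => //.
    move=> x; rewrite -mulrBl indicE; case: (boolP (x \in A)); rewrite ?mulr0//.
    by rewrite inE /A /= mulr1 subr_ge0 => /ltW.
  rewrite expectationBR; [|exact: integrableMR|exact: integrableZR].
  by rewrite expectationZR// subr_le0; exact: gM.
apply: filterS => x; rewrite -mulrBl indicE; case: (boolP (x \in A)).
  by rewrite inE /A /= mulr1 => + /eqP; rewrite subr_eq0 => /[swap] /eqP ->.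
by move=> /negP; rewrite inE /A /= => /negP; rewrite -leNgt.
Qed.

Lemma cond_expectation_ae_eq f g g' : is_cond_expectation P <<s C >> f g ->
  is_cond_expectation P <<s C >> f g' -> {ae P, forall x, g x = g' x}.
Proof.
move=> fg fg'.
have le0 h h' : is_cond_expectation P <<s C >> f h ->
    is_cond_expectation P <<s C >> f h' -> {ae P, forall x, h x - h' x <= 0}.
  move=> fh fh'; have [_ _ lh _] := fh; have [_ _ lh' _] := fh'.
  apply: ae_le_cst; first exact: integrableBR.
    apply: (@measurable_funB _ (g_sigma_algebraType C)).
      exact: cond_expectation_smeasurable fh.
    exact: cond_expectation_smeasurable fh'.
  move=> A sA; rewrite mul0r.
  have bA : bounded_mfun (\1_A : T -> R).
    by apply: bounded_mfun_indic; exact: sub_sigma_measurable.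
  under [X in 'E X]eq_fun do rewrite mulrBl.
  rewrite expectationBR; [|exact: integrableMR|exact: integrableMR].
  by rewrite -(cond_expectation_indic fh sA) -(cond_expectation_indic fh' sA) subrr.
apply: filterS2 (le0 _ _ fg fg') (le0 _ _ fg' fg) => x.
by rewrite !subr_le0 => gg' g'g; apply/eqP; rewrite eq_le gg'.
Qed.

End SubSigma.

Section CondExpectation.
Context {d} {T : measurableType d} {R : realType} (P : probability T R).
Local Notation "''E' f" := (Rintegral P setT f) (at level 10, f at level 9).
Local Notation L1 f := (P.-integrable setT (EFin \o f)).
Variable C : set (set T).
Hypothesis Cmeasurable : C `<=` measurable.
Local Notation smeasurable f :=
  (measurable_fun (T:=g_sigma_algebraType C) setT f).
Local Notation sbounded f := (@bounded_mfun _ (g_sigma_algebraType C) _ f).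
Local Notation is_cexp f g := (is_cond_expectation P <<s C >> f g).
Implicit Types f g h : T -> R.

Lemma cond_expectation_le_pull f (M : R) c :
  cond_expectation_le P <<s C >> f M -> sbounded c -> (forall x, 0 <= c x) ->
  'E (fun x => f x * c x) <= M * 'E c.
Proof.
move=> [m fm mM] bc c0; rewrite (cond_expectation_pull Cmeasurable fm bc).
have [_ _ lm _] := fm; have bc' := sbounded_bounded Cmeasurable bc.
have mm := integrable_measurable lm.
(* [m <= M] holds only almost surely, whereas expectations are compared through pointwise
   inequalities; the minimum satisfies the bound everywhere and changes no integral. *)
have mmin : measurable_fun setT (fun x => Num.min (m x) M).
  exact: measurable_minr.
have mae : {ae P, forall x, m x = Num.min (m x) M}.
  by apply: filterS mM => x mx; rewrite min_l.
have lmin := ae_integrableR lm mmin mae.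
rewrite (@ae_expectationR _ _ _ _ _ (fun x => Num.min (m x) M * c x)).
- rewrite -expectationZR; last exact: bounded_integrable.
  apply: le_expectationR; first exact: integrableMR.
    exact/integrableZR/bounded_integrable.
  by move=> x; rewrite ler_wpM2r// ge_min lexx orbT.
- exact: measurable_funM bc'.1.
- exact: measurable_funM bc'.1.
- by apply: filterS mae => x <-.
Qed.

(** Turns an almost sure bound into an everywhere bound, as [bounded_mfun] requires, while the
    clipped function remains a version of the same conditional expectation. *)
Definition clip (M r : R) := Num.max (- M) (Num.min r M).

Lemma clip_bound M r : 0 <= M -> `|clip M r| <= M.
Proof.
move=> M0; rewrite /clip ler_norml le_max lexx/= ge_max ge_min lexx orbT andbT.
by rewrite (le_trans _ M0)// oppr_le0.
Qed.

Lemma clip_id M r : `|r| <= M -> clip M r = r.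
Proof. by rewrite ler_norml => /andP[? ?]; rewrite /clip min_l// max_r. Qed.

Lemma measurable_clip {d'} {T' : measurableType d'} (g : T' -> R) M :
  measurable_fun setT g -> measurable_fun setT (fun x => clip M (g x)).
Proof.
move=> mg; apply: measurable_maxr; first exact: measurable_cst.
exact: measurable_minr.
Qed.

Lemma bounded_clip {d'} {T' : measurableType d'} (g : T' -> R) M : 0 <= M ->
  measurable_fun setT g -> bounded_mfun (fun x => clip M (g x)).
Proof.
move=> M0 mg; split; first exact: measurable_clip.
by exists M => x; exact: clip_bound.
Qed.

Lemma cond_expectation_ae_bound f g (M : R) : is_cexp f g ->
  (forall c, sbounded c -> (forall x, 0 <= c x) ->
     'E (fun x => `|f x| * c x) <= M * 'E c) ->
  {ae P, forall x, `|g x| <= M}.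
Proof.
move=> fg fM; have [lf _ lg _] := fg; have mg := cond_expectation_smeasurable fg.
have bA A : <<s C >> A -> sbounded (\1_A : T -> R).
  by move=> sA; exact: (@bounded_mfun_indic _ (g_sigma_algebraType C)).
have bA' A : <<s C >> A -> bounded_mfun (\1_A : T -> R).
  by move=> sA; exact: sbounded_bounded (bA _ sA).
have A0 (A : set T) x : 0 <= \1_A x :> R by rewrite indicE ler0n.
have le1 : {ae P, forall x, g x <= M}.
  apply: (ae_le_cst Cmeasurable) => // A sA.
  rewrite -(cond_expectation_indic fg sA).
  rewrite (le_trans _ (fM _ (bA _ sA) (A0 A)))//.
  apply: le_expectationR.
  - exact: integrableMR (bA' _ sA).
  - exact: integrableMR (integrable_normR lf) (bA' _ sA).
  by move=> x; rewrite ler_wpM2r// ler_norm.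
have le2 : {ae P, forall x, - g x <= M}.
  apply: (ae_le_cst Cmeasurable (integrableNR lg)) => [|A sA].
    exact: (@measurable_funN _ (g_sigma_algebraType C)).
  rewrite (le_trans _ (fM _ (bA _ sA) (A0 A)))//.
  under [X in 'E X]eq_fun do rewrite mulNr -mulrN.
  have := cond_expectation_pull Cmeasurable fg (bounded_mfunN (bA _ sA)).
  move=> <-.
  apply: le_expectationR.
  - exact: integrableMR (bounded_mfunN (bA' _ sA)).
  - exact: integrableMR (integrable_normR lf) (bA' _ sA).
  - by move=> x; rewrite mulrN -mulNr ler_wpM2r// -normrN ler_norm.
by apply: filterS2 le1 le2 => x g1 g2; rewrite ler_norml g1 andbT lerNl.
Qed.

Lemma cond_expectation_ae f g g' : is_cexp f g -> smeasurable g' ->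
  {ae P, forall x, g x = g' x} -> is_cexp f g'.
Proof.
move=> [lf mg lg fg] mg' gg'.
have lg' : L1 g'.
  exact: (ae_integrableR lg (smeasurable_measurable Cmeasurable mg') gg').
split => //; first exact/smeasurableP.
move=> A sA; rewrite fg//; have mA := sub_sigma_measurable Cmeasurable sA.
apply: ae_eq_integral => //.
- apply: measurable_funTS; apply/measurable_EFinP.
  exact: integrable_measurable lg.
- apply: measurable_funTS; apply/measurable_EFinP.
  exact: integrable_measurable lg'.
- by apply: filterS gg' => x gx _ ; rewrite /= gx.
Qed.

Lemma cond_expectation_clip f g (M : R) : 0 <= M -> is_cexp f g ->
  {ae P, forall x, `|g x| <= M} ->
  is_cexp f (fun x => clip M (g x)) /\ {ae P, forall x, clip M (g x) = g x}.
Proof.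
move=> M0 fg gM.
have ae1 : {ae P, forall x, clip M (g x) = g x}.
  by apply: filterS gM => x gx; rewrite clip_id.
split => //; apply: (cond_expectation_ae fg).
  apply: (@measurable_clip _ (g_sigma_algebraType C)).
  exact: cond_expectation_smeasurable fg.
by apply: filterS ae1 => x ->.
Qed.

Lemma norm_bound_pull f (M : R) c : bounded_mfun f -> (forall x, `|f x| <= M) ->
  bounded_mfun c -> (forall x, 0 <= c x) -> 'E (fun x => `|f x| * c x) <= M * 'E c.
Proof.
move=> bf fM bc c0; rewrite -expectationZR; last exact: bounded_integrable.
apply: le_expectationR.
- by apply/bounded_integrable/bounded_mfunM => //; exact: bounded_mfun_norm.
- exact/integrableZR/bounded_integrable.
- by move=> x; rewrite ler_wpM2r.
Qed.

End CondExpectation.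

(** * Conditional independence *)

Section CondIndependence.
Context {d} {T : measurableType d} {R : realType} (P : probability T R).
Local Notation "''E' f" := (Rintegral P setT f) (at level 10, f at level 9).
Local Notation L1 f := (P.-integrable setT (EFin \o f)).
Variable C : set (set T).
Hypothesis Cmeasurable : C `<=` measurable.
Local Notation smeasurable f :=
  (measurable_fun (T:=g_sigma_algebraType C) setT f).
Local Notation sbounded f := (@bounded_mfun _ (g_sigma_algebraType C) _ f).
Local Notation is_cexp f g := (is_cond_expectation P <<s C >> f g).
Variables (S : nat) (X : 'I_S -> T -> R).
Hypothesis mX : forall s, measurable_fun setT (X s).
Hypothesis indep : cond_independent P <<s C >> X.
Implicit Types f g h : T -> R.

Local Notation cylinder B := (\bigcap_(s in [set: 'I_S]) X s @^-1` B s).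

Lemma cylinder_measurable (B : 'I_S -> set R) :
  (forall s, measurable (B s)) -> measurable (cylinder B).
Proof.
move=> mB; apply: fin_bigcap_measurable => [|s _]; first exact: finite_finset.
by rewrite -[X in measurable X]setTI; exact: mX.
Qed.

(** The product formula of [cond_independent] is used here and nowhere else: constraining the so far
    free shock [s] multiplies the product of conditional probabilities by the factor [p] of that
    shock. *)
Lemma cylinder_split (s : 'I_S) (B : 'I_S -> set R) (D : set R) p c :
  (forall t, measurable (B t)) -> B s = setT -> measurable D ->
  is_cexp (\1_(X s @^-1` D)) p -> sbounded p -> sbounded c ->
  'E (fun x => \1_(cylinder (fun t => if t == s then D else B t)) x * c x) =
  'E (fun x => \1_(cylinder B) x * (c x * p x)).
Proof.
move=> mB Bs mD pD bp bc.
pose BD t := if t == s then D else B t.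
have mBD t : measurable (BD t) by rewrite /BD; case: ifP.
have [q qP qE] := indep mBD; have [r rP rE] := indep mB.
rewrite (cond_expectation_pull Cmeasurable qE bc).
rewrite (cond_expectation_pull Cmeasurable rE (bounded_mfunM bc bp)).
have [_ _ lq _] := qE; have [_ _ lr _] := rE.
apply: ae_expectationR.
- apply/(integrable_measurable (P := P))/integrableMR => //.
  exact: (sbounded_bounded Cmeasurable).
- apply/(integrable_measurable (P := P))/integrableMR => //.
  exact/(sbounded_bounded Cmeasurable)/bounded_mfunM.
(* The versions obtained for [BD] and for [B] are unrelated; uniqueness identifies them almost
   surely, factor by factor, and gives 1 at [s], where [B s] is the whole line. *)
have r1 : {ae P, forall x, r s x = 1}.
  apply: (cond_expectation_ae_eq Cmeasurable) (rP s) _; rewrite Bs preimage_setT.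
  have b1 : bounded_mfun (\1_[set: T] : T -> R) by exact: bounded_mfun_indic.
  rewrite indicT; split => //.
  - exact/bounded_integrable/bounded_mfun_cst.
  - apply/smeasurableP; exact: (@measurable_cst _ _ (g_sigma_algebraType C)).
  - exact/bounded_integrable/bounded_mfun_cst.
have qs : {ae P, forall x, q s x = p x}.
  by apply: (cond_expectation_ae_eq Cmeasurable) pD; have := qP s; rewrite /BD eqxx.
have qr : {ae P, forall x, forall t, t != s -> q t x = r t x}.
  apply: filter_forall => t; have [->|ts] := eqVneq t s.
    exact: aeW.
  have := cond_expectation_ae_eq Cmeasurable (qP t).
  by rewrite /BD (negbTE ts) => /(_ _ (rP t)); apply: filterS => x ->.
apply: filterS3 r1 qs qr => x r1 qs qr.
rewrite (bigD1 s)//= [in RHS](bigD1 s)//= r1 qs mul1r.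
under eq_bigr do rewrite qr//.
by rewrite mulrAC [LHS]mulrC [p x * c x]mulrC.
Qed.

(* Bounded functions of the conditioning variables and of the [X t], [t \in J],
   of the special form for which conditional independence applies directly. *)
Inductive cyl_fun (J : pred 'I_S) : (T -> R) -> Prop :=
| cyl_fun_base c B : sbounded c -> (forall t, measurable (B t)) ->
    (forall t, ~~ J t -> B t = setT) ->
    cyl_fun J (fun x => \1_(cylinder B) x * c x)
| cyl_funD f g : cyl_fun J f -> cyl_fun J g -> cyl_fun J (fun x => f x + g x).

Lemma cyl_fun_bounded J f : cyl_fun J f -> bounded_mfun f.
Proof.
elim=> [c B bc mB _|{}f g _ bf _ bg]; last exact: bounded_mfunD.
apply: bounded_mfunM; last exact: (sbounded_bounded Cmeasurable).
exact/bounded_mfun_indic/cylinder_measurable.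
Qed.

Lemma cyl_fun_sbounded J c : sbounded c -> cyl_fun J c.
Proof.
move=> bc; have := @cyl_fun_base J c (fun=> setT) bc (fun=> measurableT) (fun _ _ => erefl).
rewrite (_ : cylinder (fun=> setT) = setT); last by apply/seteqP; split.
by under eq_fun do rewrite indicT mul1r.
Qed.

Lemma cyl_fun_sub (J J' : pred 'I_S) f : (forall t, J t -> J' t) ->
  cyl_fun J f -> cyl_fun J' f.
Proof.
move=> JJ; elim=> [c B bc mB BJ|{}f g _ bf _ bg]; last exact: cyl_funD.
by apply: cyl_fun_base => // t /(contra (@JJ t)); exact: BJ.
Qed.

Lemma cyl_funM J f g : cyl_fun J f -> cyl_fun J g ->
  cyl_fun J (fun x => f x * g x).
Proof.
move=> + Jg; elim=> [c B bc mB BJ|f1 f2 _ bf1 _ bf2]; last first.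
  by under eq_fun do rewrite mulrDl; exact: cyl_funD.
elim: Jg => [c' B' bc' mB' BJ'|g1 g2 _ bg1 _ bg2]; last first.
  by under eq_fun do rewrite mulrDr; exact: cyl_funD.
have := @cyl_fun_base J (fun x => c x * c' x) (fun t => B t `&` B' t)
  (bounded_mfunM bc bc') (fun t => measurableI _ _ (mB t) (mB' t)).
have -> : cylinder (fun t => B t `&` B' t) = cylinder B `&` cylinder B'.
  by rewrite -bigcapI.
rewrite indicI; under eq_fun do rewrite /= mulrACA; apply.
by move=> t Jt; rewrite BJ// BJ'// setIT.
Qed.

Lemma cyl_funZ J (a : R) f : cyl_fun J f -> cyl_fun J (fun x => a * f x).
Proof. by move=> Jf; apply: cyl_funM => //; exact/cyl_fun_sbounded/bounded_mfun_cst. Qed.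

Lemma cyl_funB J f g : cyl_fun J f -> cyl_fun J g ->
  cyl_fun J (fun x => f x - g x).
Proof.
by move=> Jf Jg; under eq_fun do rewrite -mulN1r; exact/cyl_funD/cyl_funZ.
Qed.

Lemma cyl_fun_sum J I (r : seq I) (p : pred I) (F : I -> T -> R) :
  (forall i, p i -> cyl_fun J (F i)) ->
  cyl_fun J (fun x => \sum_(i <- r | p i) F i x).
Proof.
move=> JF; elim: r => [|i r IH].
  by under eq_fun do rewrite big_nil; exact/cyl_fun_sbounded/bounded_mfun_cst.
case pi : (p i); last by under eq_fun do rewrite big_cons pi.
by under eq_fun do rewrite big_cons pi; apply: cyl_funD => //; exact: JF.
Qed.

(** This is why truncation is by a step function and not by plain clipping: each indicator
    [a <= X s x] is that of a cylinder whose only constraint is a half-line at [s]. *)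
Lemma cyl_fun_clip_floor (s : 'I_S) n :
  cyl_fun (pred1 s) (fun x => clip_floor n (X s x)).
Proof.
apply: cyl_funB; last exact/cyl_fun_sbounded/bounded_mfun_cst.
apply: cyl_fun_sum => k _; apply: cyl_funZ.
set a := - n%:R + _; pose D : set R := `[a, +oo[%classic.
have := @cyl_fun_base (pred1 s) (fun=> 1) (fun t => if t == s then D else setT)
  (bounded_mfun_cst _).
have -> : cylinder (fun t => if t == s then D else setT) = [set x | a <= X s x].
  apply/seteqP; split => x /=.
    by move=> /(_ s I); rewrite /= eqxx /D /= in_itv /= andbT.
  move=> ax t _ /=; case: eqP => [->|//]; by rewrite /D /= in_itv /= andbT.
rewrite (_ : (fun x => \1__ x * 1) = fun x => (a <= X s x)%R%:R); last first.
  apply/funext => x; rewrite mulr1 indicE; congr (nat_of_bool _)%:R.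
  by apply/idP/idP; rewrite inE.
apply; first by move=> t; case: ifP => // _; exact: measurable_itv.
by move=> t /= /negbTE ->.
Qed.

(** Conditioning on the other shocks in addition to [C] does not change the conditional mean of a
    function of [X s]: a single [C]-measurable [g] serves against every [h] built from [C] and the
    other shocks. Two inductions over sums reduce this to single cylinders, where [cylinder_split]
    applies. *)
Lemma cyl_fun_expectation (s : 'I_S) f : cyl_fun (pred1 s) f ->
  exists2 g, sbounded g & forall h, cyl_fun (predC1 s) h ->
    'E (fun x => f x * h x) = 'E (fun x => g x * h x).
Proof.
elim=> [c B bc mB BJ|f1 f2 J1 [g1 b1 E1] J2 [g2 b2 E2]]; last first.
  exists (fun x => g1 x + g2 x); first exact: bounded_mfunD.
  move=> h Jh; have bh := cyl_fun_bounded Jh.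
  under [X in 'E X]eq_fun do rewrite mulrDl.
  under [X in _ = 'E X]eq_fun do rewrite mulrDl.
  have b1' := sbounded_bounded Cmeasurable b1.
  have b2' := sbounded_bounded Cmeasurable b2.
  have f1' := cyl_fun_bounded J1; have f2' := cyl_fun_bounded J2.
  by rewrite !expectationDR ?E1 ?E2//; exact/bounded_integrable/bounded_mfunM.
have [q /(_ s) qs _] := indep mB.
have mBs : measurable (X s @^-1` B s).
  by rewrite -[X in measurable X]setTI; exact: mX.
(* A version of a conditional probability is at most 1 only almost surely; clipping makes it an
   admissible test function. *)
have qc : is_cexp (\1_(X s @^-1` B s)) (fun x => clip 1 (q s x)).
  apply: (cond_expectation_clip Cmeasurable ler01 qs _).1.
  apply: (cond_expectation_ae_bound Cmeasurable qs) => c' bc' c0'.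
  apply: norm_bound_pull => //; first exact: bounded_mfun_indic.
    by move=> x; rewrite indicE normr_nat lern1 leq_b1.
  exact: (sbounded_bounded Cmeasurable).
have bq : sbounded (fun x => clip 1 (q s x)).
  apply: (@bounded_clip _ _ (g_sigma_algebraType C)) => //.
  exact: cond_expectation_smeasurable qs.
have Bcyl : cylinder B = X s @^-1` B s.
  apply/seteqP; split => [x /(_ s I)//|x Bx t _].
  by have [->//|ts] := eqVneq t s; rewrite BJ.
exists (fun x => clip 1 (q s x) * c x); first exact: bounded_mfunM.
move=> h; elim=> [c' B' bc' mB' BJ'|h1 h2 J1 E1 J2 E2]; last first.
  under [X in 'E X]eq_fun do rewrite mulrDr.
  under [X in _ = 'E X]eq_fun do rewrite mulrDr.
  have b1 := cyl_fun_bounded J1; have b2 := cyl_fun_bounded J2.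
  have bl : bounded_mfun (fun x => \1_(cylinder B) x * c x).
    apply: bounded_mfunM; last exact: (sbounded_bounded Cmeasurable).
    by rewrite Bcyl; exact: bounded_mfun_indic.
  have br : bounded_mfun (fun x => clip 1 (q s x) * c x).
    exact/(sbounded_bounded Cmeasurable)/bounded_mfunM.
  by rewrite !expectationDR ?E1 ?E2//; exact/bounded_integrable/bounded_mfunM.
have B's : B' s = setT by apply: BJ'; rewrite /= eqxx.
have := cylinder_split mB' B's (mB s) qc bq (bounded_mfunM bc bc').
have -> : cylinder (fun t => if t == s then B s else B' t) = cylinder B `&` cylinder B'.
  rewrite Bcyl; apply/seteqP; split=> [x Bx|x [Bx B'x] t _].
    split; first by have := Bx s I; rewrite /= eqxx.
    by move=> t _; have := Bx t I; rewrite /=; case: eqP => // -> _; rewrite B's.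
  by rewrite /=; case: eqP => [->//|_]; exact: B'x.
rewrite indicI => E.
transitivity
  ('E (fun x => (\1_(cylinder B) \* \1_(cylinder B')) x * (c x * c' x))).
  by congr Rintegral; apply/funext => x /=; rewrite mulrACA.
rewrite E; congr Rintegral; apply/funext => x /=; ring.
Qed.

End CondIndependence.

(** * Forms in conditionally independent variables *)

Section Orthogonality.
Context {d} {T : measurableType d} {R : realType} (P : probability T R).
Local Notation "''E' f" := (Rintegral P setT f) (at level 10, f at level 9).
Local Notation L1 f := (P.-integrable setT (EFin \o f)).
Variable C : set (set T).
Hypothesis Cmeasurable : C `<=` measurable.
Local Notation sbounded f := (@bounded_mfun _ (g_sigma_algebraType C) _ f).
Variables (S : nat) (X : 'I_S -> T -> R).
Hypothesis mX : forall s, measurable_fun setT (X s).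
Local Notation cyl J f := (cyl_fun C X J f).

Lemma expectation_sqr_sum_orthogonal (p : pred 'I_S) (f : 'I_S -> T -> R) :
  (forall s, bounded_mfun (f s)) ->
  (forall s t : 'I_S, (t < s)%N -> 'E (fun x => f s x * f t x) = 0) ->
  'E (fun x => (\sum_(s < S | p s) f s x) ^+ 2) =
  \sum_(s < S | p s) 'E (fun x => f s x ^+ 2).
Proof.
move=> bf f0.
have lf s t : L1 (fun x => f s x * f t x).
  exact/bounded_integrable/bounded_mfunM.
under [X in 'E X]eq_fun do rewrite expr2 mulr_suml.
rewrite expectation_sumR; last first.
  by move=> s _; under eq_fun do rewrite mulr_sumr; exact: integrable_sumR.
apply: eq_bigr => s ps; under [X in 'E X]eq_fun do rewrite mulr_sumr.
rewrite expectation_sumR// (bigD1 s)//= big1 ?addr0; last first.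
  move=> t /andP[_ ts]; have [st|st|/val_inj st] := ltngtP s t; last first.
  - by rewrite st eqxx in ts.
  - exact: f0.
  - by under [X in 'E X]eq_fun do rewrite mulrC; exact: f0.
by congr Rintegral; apply/funext => x; rewrite expr2.
Qed.

Variables (e v : 'I_S -> T -> R) (M : R).
Hypothesis e_cyl : forall s, cyl (pred1 s) (e s).
Hypothesis e_bound : forall s x, `|e s x| <= M.
Hypothesis e_centered : forall s h, cyl (predC1 s) h -> 'E (fun x => e s x * h x) = 0.

Let e_bounded s : bounded_mfun (e s).
Proof. by apply: cyl_fun_bounded (e_cyl s). Qed.

Let e_cyl' (J : pred 'I_S) (s : 'I_S) : J s -> cyl J (e s).
Proof. by move=> Js; apply: cyl_fun_sub (e_cyl s) => t /eqP ->. Qed.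

(** A cross term is [e s] times a function of [C] and of some [e t] with [t] different from [s], so
    centring kills it; what remains are the squares. *)
Lemma linear_form_variance (p : pred 'I_S) (a : 'I_S -> T -> R) :
  (forall s, sbounded (a s)) ->
  'E (fun x => (\sum_(s < S | p s) a s x * e s x) ^+ 2) <=
  M ^+ 2 * 'E (fun x => \sum_(s < S | p s) a s x ^+ 2).
Proof.
move=> ba; have ba' s := sbounded_bounded Cmeasurable (ba s).
rewrite expectation_sqr_sum_orthogonal; last 2 first.
- by move=> s; exact: bounded_mfunM.
- move=> s t ts.
  rewrite -(e_centered (s := s) (h := fun x => a s x * a t x * e t x)).
    by congr Rintegral; apply/funext => x; ring.
  apply: cyl_funM => //; first exact/cyl_fun_sbounded/bounded_mfunM.
  by apply: e_cyl'; rewrite /= -val_eqE neq_ltn /= ts.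
rewrite expectation_sumR; last by move=> s _; exact/bounded_integrable/bounded_mfunX.
rewrite mulr_sumr; apply: ler_sum => s _.
rewrite -expectationZR; last exact/bounded_integrable/bounded_mfunX.
apply: le_expectationR.
- exact/bounded_integrable/bounded_mfunX/bounded_mfunM.
- exact/integrableZR/bounded_integrable/bounded_mfunX.
move=> x; rewrite exprMn mulrC ler_wpM2r ?sqr_ge0//.
by rewrite -real_normK ?num_real// lerXn2r ?nnegrE// (le_trans _ (e_bound s x)).
Qed.

(* Ordering the indices makes the summands martingale differences: the inner
   sum only involves [e t] with [t < s]. *)
Lemma lower_form_variance (k : 'I_S -> 'I_S -> T -> R) :
  (forall s t, sbounded (k s t)) ->
  'E (fun x => (\sum_(s < S) e s x * \sum_(t < S | (t < s)%N) k s t x * e t x) ^+ 2)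
  <= M ^+ 4 * 'E (fun x => \sum_(s < S) \sum_(t < S) k s t x ^+ 2).
Proof.
move=> bk; have bk' s t := sbounded_bounded Cmeasurable (bk s t).
pose g (s : 'I_S) x := \sum_(t < S | (t < s)%N) k s t x * e t x.
have bg s : bounded_mfun (g s) by apply: bounded_mfun_sum => t; exact: bounded_mfunM.
have gJ (J : pred 'I_S) (s : 'I_S) : (forall t : 'I_S, (t < s)%N -> J t) -> cyl J (g s).
  move=> Js; apply: cyl_fun_sum => t ts; apply: cyl_funM => //.
    exact: cyl_fun_sbounded.
  exact/e_cyl'/Js.
rewrite (expectation_sqr_sum_orthogonal _ (f := fun s x => e s x * g s x)); last 2 first.
- by move=> s; exact: bounded_mfunM.
- move=> s t ts.
  rewrite -(e_centered (s := s) (h := fun x => g s x * e t x * g t x)).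
    by congr Rintegral; apply/funext => x; rewrite /g; ring.
  have ltJ (u : 'I_S) : (u < s)%N -> predC1 s u.
    by move=> us; rewrite /= -val_eqE neq_ltn us.
  do 2?[apply: cyl_funM => //].
  - exact: gJ.
  - exact/e_cyl'/ltJ.
  - by apply: gJ => u ut; apply: ltJ; exact: ltn_trans ut ts.
rewrite expectation_sumR; last first.
  by move=> s _; apply/bounded_integrable/bounded_mfun_sum => t; exact: bounded_mfunX.
rewrite mulr_sumr; apply: ler_sum => s _.
apply: (@le_trans _ _ (M ^+ 2 * 'E (fun x => g s x ^+ 2))).
  rewrite -expectationZR; last exact/bounded_integrable/bounded_mfunX.
  apply: le_expectationR.
  - exact/bounded_integrable/bounded_mfunX/bounded_mfunM.
  - exact/integrableZR/bounded_integrable/bounded_mfunX.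
  move=> x; rewrite exprMn ler_wpM2r ?sqr_ge0//.
  by rewrite -real_normK ?num_real// lerXn2r ?nnegrE// (le_trans _ (e_bound s x)).
rewrite (exprD _ 2 2) -mulrA ler_wpM2l ?sqr_ge0//.
rewrite (le_trans (linear_form_variance (fun t => (t < s)%N) (bk s)))//.
rewrite ler_wpM2l ?sqr_ge0//; apply: le_expectationR.
- by apply/bounded_integrable/bounded_mfun_sum => t; exact: bounded_mfunX.
- by apply/bounded_integrable/bounded_mfun_sum => t; exact: bounded_mfunX.
move=> x; rewrite [leRHS](bigID (fun t : 'I_S => (t < s)%N))/= lerDl.
by apply: sumr_ge0 => *; exact: sqr_ge0.
Qed.

Hypothesis v_sbounded : forall s, sbounded (v s).
Hypothesis v_bound : forall s x, `|v s x| <= M ^+ 2.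
Hypothesis v_variance : forall s h, cyl (predC1 s) h ->
  'E (fun x => e s x ^+ 2 * h x) = 'E (fun x => v s x * h x).

(** The increments [e s ^+ 2 - v s] are at most [2 * M ^+ 2] in absolute value, whence the constant.
    They are orthogonal because [v_variance] admits tests that involve the other shocks. *)
Lemma diagonal_form_variance (a : 'I_S -> T -> R) :
  (forall s, sbounded (a s)) ->
  'E (fun x => (\sum_(s < S) a s x * (e s x ^+ 2 - v s x)) ^+ 2) <=
  4 * M ^+ 4 * 'E (fun x => \sum_(s < S) a s x ^+ 2).
Proof.
move=> ba; have ba' s := sbounded_bounded Cmeasurable (ba s).
have bv' s := sbounded_bounded Cmeasurable (v_sbounded s).
have bf s : bounded_mfun (fun x => e s x ^+ 2 - v s x).
  by apply: bounded_mfunB => //; exact: bounded_mfunX.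
rewrite expectation_sqr_sum_orthogonal; last 2 first.
- by move=> s; exact: bounded_mfunM.
- move=> s t ts.
  pose h x := a s x * a t x * (e t x ^+ 2 - v t x).
  have hc : cyl (predC1 s) h.
    apply: cyl_funM => //; first exact/cyl_fun_sbounded/bounded_mfunM.
    have et : cyl (predC1 s) (e t).
      by apply: e_cyl'; rewrite /= -val_eqE neq_ltn /= ts.
    apply: cyl_funB => //; last exact: cyl_fun_sbounded.
    by under eq_fun do rewrite expr2; exact: cyl_funM.
  have bh := cyl_fun_bounded Cmeasurable mX hc.
  transitivity ('E (fun x => e s x ^+ 2 * h x - v s x * h x)).
    by congr Rintegral; apply/funext => x; rewrite /h; ring.
  rewrite expectationBR ?v_variance ?subrr//.
    by apply/bounded_integrable/bounded_mfunM => //; exact: bounded_mfunX.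
  exact/bounded_integrable/bounded_mfunM.
rewrite expectation_sumR; last by move=> s _; exact/bounded_integrable/bounded_mfunX.
rewrite mulr_sumr; apply: ler_sum => s _.
rewrite -expectationZR; last exact/bounded_integrable/bounded_mfunX.
apply: le_expectationR.
- exact/bounded_integrable/bounded_mfunX/bounded_mfunM.
- exact/integrableZR/bounded_integrable/bounded_mfunX.
move=> x; rewrite exprMn mulrC ler_wpM2r ?sqr_ge0//.
have M0 : 0 <= M := le_trans (normr_ge0 _) (e_bound s x).
have -> : 4 * M ^+ 4 = (2 * M ^+ 2) ^+ 2 by ring.
rewrite -real_normK ?num_real// lerXn2r ?nnegrE ?mulr_ge0 ?sqr_ge0//.
rewrite (le_trans (ler_normB _ _))// mulr2n mulrDl mul1r lerD//.
by rewrite normrX lerXn2r ?nnegrE// (le_trans _ (e_bound s x)).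
Qed.

(** The upper triangle is the lower triangle of the transpose [kT], and the diagonal is centred by
    [v]. The constant is [3 * (1 + 1 + 4)]: the leading 3 bounds the square of a sum of three terms,
    and the others come from the two triangles and the diagonal. *)
Lemma quadratic_form_variance (k : 'I_S -> 'I_S -> T -> R) :
  (forall s t, sbounded (k s t)) ->
  'E (fun x => (\sum_(s < S) \sum_(t < S) k s t x * (e s x * e t x) -
                \sum_(s < S) k s s x * v s x) ^+ 2) <=
  18 * M ^+ 4 * 'E (fun x => \sum_(s < S) \sum_(t < S) k s t x ^+ 2).
Proof.
move=> bk; have bk' s t := sbounded_bounded Cmeasurable (bk s t).
have bv' s := sbounded_bounded Cmeasurable (v_sbounded s).
pose lo (k : 'I_S -> 'I_S -> T -> R) x :=
  \sum_(s < S) e s x * \sum_(t < S | (t < s)%N) k s t x * e t x.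
pose kT s t := k t s.
pose dg x := \sum_(s < S) k s s x * (e s x ^+ 2 - v s x).
have blo k' : (forall s t, bounded_mfun (k' s t)) -> bounded_mfun (lo k').
  move=> bk0; apply: bounded_mfun_sum => s; apply: bounded_mfunM => //.
  by apply: bounded_mfun_sum => t; exact: bounded_mfunM.
have bdg : bounded_mfun dg.
  apply: bounded_mfun_sum => s; apply: bounded_mfunM => //.
  by apply: bounded_mfunB => //; exact: bounded_mfunX.
have bkT s t : bounded_mfun (kT s t) by exact: bk'.
have split3 x : \sum_(s < S) \sum_(t < S) k s t x * (e s x * e t x) -
                \sum_(s < S) k s s x * v s x = lo k x + lo kT x + dg x.
  have -> : lo kT x = \sum_(s < S) \sum_(t < S | (s < t)%N) k s t x * (e s x * e t x).
    rewrite [RHS](exchange_big_dep xpredT)//=; apply: eq_bigr => s _.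
    by rewrite mulr_sumr; apply: eq_bigr => t _; rewrite /kT; ring.
  rewrite /lo /dg -!big_split/= -sumrB; apply: eq_bigr => s _.
  rewrite (bigD1 s)//= (bigID (fun t : 'I_S => (t < s)%N))/= mulr_sumr.
  rewrite (eq_bigl (fun t : 'I_S => (t < s)%N)); last first.
    by move=> t; rewrite -val_eqE /= andbC; case: ltngtP.
  rewrite [X in _ + (_ + X)](eq_bigl (fun t : 'I_S => (s < t)%N)); last first.
    by move=> t; rewrite -val_eqE /=; case: ltngtP.
  rewrite (eq_bigr (fun t => e s x * (k s t x * e t x))); last by move=> t _; ring.
  by ring.
under [X in 'E X]eq_fun do rewrite split3.
have K0 := lower_form_variance bk.
have KT := lower_form_variance (k := kT) (fun s t => bk t s).
have KD := diagonal_form_variance (fun s => bk s s).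
have KTE : 'E (fun x => \sum_(s < S) \sum_(t < S) kT s t x ^+ 2) =
           'E (fun x => \sum_(s < S) \sum_(t < S) k s t x ^+ 2).
  by congr Rintegral; apply/funext => x; rewrite exchange_big.
have KDE : 'E (fun x => \sum_(s < S) k s s x ^+ 2) <=
           'E (fun x => \sum_(s < S) \sum_(t < S) k s t x ^+ 2).
  apply: le_expectationR.
  - by apply/bounded_integrable/bounded_mfun_sum => s; exact: bounded_mfunX.
  - apply/bounded_integrable/bounded_mfun_sum => s.
    by apply/bounded_mfun_sum => t; exact: bounded_mfunX.
  move=> x; apply: ler_sum => s _; rewrite (bigD1 s)//= lerDl.
  by apply: sumr_ge0 => *; exact: sqr_ge0.
rewrite KTE in KT; move: K0 KT KD KDE; rewrite -/(lo k) -/(lo kT) -/dg.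
set Q := 'E (fun x => \sum_(s < S) \sum_(t < S) _) => K0 KT KD KDE.
have M4 : 0 <= M ^+ 4 by rewrite exprn_even_ge0.
have KD' : 'E (fun x => dg x ^+ 2) <= 4 * M ^+ 4 * Q.
  by rewrite (le_trans KD)// ler_wpM2l// mulr_ge0.
have l1 k' : (forall s t, bounded_mfun (k' s t)) -> L1 (fun x => lo k' x ^+ 2).
  by move=> bk0; apply/bounded_integrable/bounded_mfunX; exact: blo.
have l3 : L1 (fun x => dg x ^+ 2) by exact/bounded_integrable/bounded_mfunX.
apply: (@le_trans _ _ ('E (fun x => 3 * (lo k x ^+ 2 + lo kT x ^+ 2 + dg x ^+ 2)))).
  apply: le_expectationR.
  - apply/bounded_integrable/bounded_mfunX/bounded_mfunD => //.
    by apply: bounded_mfunD; exact: blo.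
  - by apply: integrableZR; apply: integrableDR => //; apply: integrableDR; exact: l1.
  move=> x; rewrite -subr_ge0.
  have -> : forall a b c : R, 3 * (a ^+ 2 + b ^+ 2 + c ^+ 2) - (a + b + c) ^+ 2 =
    (a - b) ^+ 2 + (a - c) ^+ 2 + (b - c) ^+ 2 by move=> *; ring.
  by rewrite !addr_ge0 ?sqr_ge0.
rewrite expectationZR; last by apply: integrableDR => //; apply: integrableDR; exact: l1.
rewrite expectationDR//; last by apply: integrableDR; exact: l1.
rewrite expectationDR; [|exact: l1|exact: l1].
by move: K0 KT KD' => /=; rewrite -/(lo k) -/(lo kT); lra.
Qed.

End Orthogonality.

(** * Truncation of the shocks *)

Section OneRow.
Context {d} {T : measurableType d} {R : realType} (P : probability T R).
Local Notation "''E' f" := (Rintegral P setT f) (at level 10, f at level 9).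
Local Notation L1 f := (P.-integrable setT (EFin \o f)).
Variable C : set (set T).
Hypothesis Cmeasurable : C `<=` measurable.
Local Notation smeasurable f :=
  (measurable_fun (T:=g_sigma_algebraType C) setT f).
Local Notation sbounded f := (@bounded_mfun _ (g_sigma_algebraType C) _ f).
Local Notation is_cexp f g := (is_cond_expectation P <<s C >> f g).
Implicit Types f g h : T -> R.

Lemma cond_expectationI f g : L1 f -> sbounded g ->
  (forall h, sbounded h -> 'E (fun x => f x * h x) = 'E (fun x => g x * h x)) ->
  is_cexp f g.
Proof.
move=> lf bg fg; have lg : L1 g.
  exact/bounded_integrable/(sbounded_bounded Cmeasurable).
split => //; first by apply/smeasurableP; exact: bg.1.
move=> A sA; have mA := sub_sigma_measurable Cmeasurable sA.
have bA : sbounded (\1_A : T -> R).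
  exact: (@bounded_mfun_indic _ (g_sigma_algebraType C)).
have key f' : L1 f' -> (\int[P]_(x in A) (f' x)%:E = ('E (fun x => (f' x * \1_A x)%R))%:E)%E.
  move=> lf'; rewrite -EFin_expectationR; last first.
    by apply: integrableMR => //; exact: (sbounded_bounded Cmeasurable).
  rewrite integral_mkcond; apply: eq_integral => x _; rewrite patchE indicE.
  by case: ifP; rewrite ?mulr1 ?mulr0.
by rewrite !key// fg.
Qed.

(** Conditional Jensen for the absolute value: the sign of [g], written [2 * \1_A x - 1], is
    measurable for the sub-sigma-algebra, so the mean of [|g|] is a test of [g] and can be moved to
    [f]. *)
Lemma cond_expectation_L1_le f g c : L1 f -> L1 g -> smeasurable g ->
  (forall h, sbounded h -> 'E (fun x => f x * h x) = 'E (fun x => g x * h x)) ->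
  sbounded c -> (forall x, 0 <= c x) ->
  'E (fun x => `|g x| * c x) <= 'E (fun x => `|f x| * c x).
Proof.
move=> lf lg mg fg bc c0; pose A := [set x | 0 <= g x].
have sA : <<s C >> A.
  exact: (@measurable_set_le _ (g_sigma_algebraType C) R (fun=> 0) g (measurable_cst _) mg).
have bs : sbounded (fun x => c x * (2 * \1_A x - 1)).
  apply: bounded_mfunM => //; apply: bounded_mfunB; last exact: bounded_mfun_cst.
  apply: bounded_mfunM; first exact: bounded_mfun_cst.
  exact: (@bounded_mfun_indic _ (g_sigma_algebraType C)).
have -> : 'E (fun x => `|g x| * c x) = 'E (fun x => g x * (c x * (2 * \1_A x - 1))).
  congr Rintegral; apply/funext => x; rewrite indicE; case: (boolP (x \in A)).
    by rewrite inE /A /= => g0; rewrite ger0_norm//; ring.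
  move=> /negP; rewrite inE /A /= => /negP; rewrite -ltNge => g0.
  by rewrite ltr0_norm//; ring.
rewrite -fg//; apply: le_expectationR.
- by apply: integrableMR => //; exact: (sbounded_bounded Cmeasurable).
- by apply: (integrableMR (integrable_normR lf)); exact: (sbounded_bounded Cmeasurable).
move=> x; rewrite mulrA mulrAC ler_wpM2r// indicE; case: (x \in A).
  by rewrite mulr1 (_ : 2 - 1 = 1) ?mulr1 ?ler_norm//; ring.
by rewrite mulr0 sub0r mulrN1 -normrN ler_norm.
Qed.

(** The right side exceeds the left by the mean of [g ^+ 2 * c], since [g * c] is itself an
    admissible test. It serves for the shock itself and for its truncation error. *)
Lemma centered_second_moment f g c : L1 f -> L1 (fun x => f x ^+ 2) ->
  sbounded g ->
  (forall h, sbounded h -> 'E (fun x => f x * h x) = 'E (fun x => g x * h x)) ->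
  sbounded c -> (forall x, 0 <= c x) ->
  'E (fun x => (f x - g x) ^+ 2 * c x) <= 'E (fun x => f x ^+ 2 * c x).
Proof.
move=> lf lf2 bg fg bc c0.
have bg' := sbounded_bounded Cmeasurable bg.
have bc' := sbounded_bounded Cmeasurable bc.
have lfg : L1 (fun x => f x * (g x * c x)) by apply/integrableMR/bounded_mfunM.
have lgg : L1 (fun x => g x * (g x * c x)).
  by apply/bounded_integrable/bounded_mfunM => //; exact: bounded_mfunM.
have -> : (fun x => (f x - g x) ^+ 2 * c x) =
  (fun x => (f x ^+ 2 * c x - 2 * (f x * (g x * c x))) + g x * (g x * c x)).
  by apply/funext => x; ring.
rewrite expectationDR//; last first.
  by apply: integrableBR; [exact: integrableMR|exact: integrableZR].
rewrite expectationBR; [|exact: integrableMR|exact: integrableZR].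
rewrite expectationZR// fg; last exact: bounded_mfunM.
have : 0 <= 'E (fun x => g x * (g x * c x)).
  by apply: expectation_ge0R => x; rewrite mulrA mulr_ge0// -expr2 sqr_ge0.
lra.
Qed.

Lemma centered_integrable_sqr f g : L1 f -> L1 (fun x => f x ^+ 2) ->
  bounded_mfun g -> L1 (fun x => (f x - g x) ^+ 2).
Proof.
move=> lf lf2 bg.
have -> : (fun x => (f x - g x) ^+ 2) =
  (fun x => (f x ^+ 2 - 2 * (f x * g x)) + g x * g x).
  by apply/funext => x; ring.
apply: integrableDR; last exact/bounded_integrable/bounded_mfunM.
by apply: integrableBR => //; exact/integrableZR/integrableMR.
Qed.

Variables (S : nat) (X : 'I_S -> T -> R).
Hypothesis lX : forall s, L1 (X s).
Hypothesis indep : cond_independent P <<s C >> X.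

Let mX s : measurable_fun setT (X s) := integrable_measurable (lX s).

Lemma cyl_fun_expectation_bounded (s : 'I_S) f (M : R) : 0 <= M ->
  cyl_fun C X (pred1 s) f -> (forall x, `|f x| <= M) ->
  exists g, [/\ sbounded g, forall x, `|g x| <= M &
   forall h, cyl_fun C X (predC1 s) h ->
    'E (fun x => f x * h x) = 'E (fun x => g x * h x)].
Proof.
move=> M0 Jf fM; have [g bg fg] := cyl_fun_expectation Cmeasurable mX indep Jf.
have bf := cyl_fun_bounded Cmeasurable mX Jf.
have cg : is_cexp f g.
  apply: cond_expectationI => //; first exact: bounded_integrable.
  by move=> h bh; apply: fg; exact: cyl_fun_sbounded.
have gM : {ae P, forall x, `|g x| <= M}.
  apply: (cond_expectation_ae_bound Cmeasurable cg) => c bc c0.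
  by apply: norm_bound_pull => //; exact: (sbounded_bounded Cmeasurable).
have [_ aeg] := cond_expectation_clip Cmeasurable M0 cg gM.
exists (fun x => clip M (g x)); split.
- exact: (@bounded_clip _ _ (g_sigma_algebraType C) _ _ M0 bg.1).
- by move=> x; exact: clip_bound.
move=> h Jh; rewrite fg//.
have mh := (cyl_fun_bounded Cmeasurable mX Jh).1.
have mg := smeasurable_measurable Cmeasurable bg.1.
apply: ae_expectationR.
- exact: measurable_funM.
- by apply: measurable_funM => //; exact: measurable_clip.
- by apply: filterS aeg => x ->.
Qed.

Variables (m v : 'I_S -> T -> R) (nu K : R).
Hypothesis nu0 : 0 < nu.
Hypothesis m_bounded : forall s, sbounded (m s).
Hypothesis m_mean : forall s, is_cexp (X s) (m s).
Hypothesis v_variance : forall s, is_cexp (fun x => (X s x - m s x) ^+ 2) (v s).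
Hypothesis X_moment : forall s,
  cond_expectation_le P <<s C >> (fun x => `|X s x| `^ (2 + nu)) K.

Let lXp s : L1 (fun x => `|X s x| `^ (2 + nu)).
Proof. by have [? [? _ _ _] _] := X_moment s. Qed.

Let l1Xp s : L1 (fun x => 1 + `|X s x| `^ (2 + nu)).
Proof. by apply: integrableDR => //; exact/bounded_integrable/bounded_mfun_cst. Qed.

Let dom_moment s f (e : R) c : 0 <= e -> L1 f -> sbounded c -> (forall x, 0 <= c x) ->
  (forall x, f x <= e * (1 + `|X s x| `^ (2 + nu))) ->
  'E (fun x => f x * c x) <= e * (1 + K) * 'E c.
Proof.
move=> e0 lf bc c0 fe; have bc' := sbounded_bounded Cmeasurable bc.
apply: (@le_trans _ _ ('E (fun x => e * (c x + `|X s x| `^ (2 + nu) * c x)))).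
  apply: le_expectationR; first exact: integrableMR.
    apply/integrableZR/integrableDR; first exact: bounded_integrable.
    exact: integrableMR.
  by move=> x; rewrite -[X in _ * (X + _)]mul1r -mulrDl mulrA ler_wpM2r.
have lc : L1 c by exact: bounded_integrable.
have lXc : L1 (fun x => `|X s x| `^ (2 + nu) * c x) by exact: integrableMR.
rewrite expectationZR; last exact: integrableDR.
rewrite expectationDR// -mulrA ler_wpM2l// mulrDl mul1r lerD2l.
exact: (cond_expectation_le_pull Cmeasurable (X_moment s)).
Qed.

Lemma shock_integrable_sqr s : L1 (fun x => X s x ^+ 2).
Proof.
apply: (le_integrableR _ _ (l1Xp s)); first exact: measurable_funX.
by move=> x; rewrite ger0_norm ?sqr_ge0// sqr_le_powR.
Qed.

Lemma shock_second_moment s c : sbounded c -> (forall x, 0 <= c x) ->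
  'E (fun x => X s x ^+ 2 * c x) <= (1 + K) * 'E c.
Proof.
move=> bc c0; rewrite -[1 + K]mul1r; apply: (@dom_moment s) => //.
  exact: shock_integrable_sqr.
by move=> x; rewrite mul1r sqr_le_powR.
Qed.

Let m_pull s h : sbounded h -> 'E (fun x => X s x * h x) = 'E (fun x => m s x * h x).
Proof. exact: (cond_expectation_pull Cmeasurable (m_mean s)). Qed.

Lemma residual_integrable_sqr s : L1 (fun x => (X s x - m s x) ^+ 2).
Proof.
apply: centered_integrable_sqr => //; first exact: shock_integrable_sqr.
exact: (sbounded_bounded Cmeasurable).
Qed.

Lemma residual_second_moment s c : sbounded c -> (forall x, 0 <= c x) ->
  'E (fun x => (X s x - m s x) ^+ 2 * c x) <= (1 + K) * 'E c.
Proof.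
move=> bc c0; apply: le_trans (shock_second_moment s bc c0).
by apply: centered_second_moment => //; [exact: shock_integrable_sqr|exact: m_pull].
Qed.

Lemma variance_first_moment s c : sbounded c -> (forall x, 0 <= c x) ->
  'E (fun x => `|v s x| * c x) <= (1 + K) * 'E c.
Proof.
move=> bc c0; have [lf _ lv _] := v_variance s.
apply: le_trans (residual_second_moment s bc c0).
have -> : 'E (fun x => (X s x - m s x) ^+ 2 * c x) =
          'E (fun x => `|(X s x - m s x) ^+ 2| * c x).
  by congr Rintegral; apply/funext => x; rewrite ger0_norm ?sqr_ge0.
apply: cond_expectation_L1_le => //.
  exact: cond_expectation_smeasurable (v_variance s).
by move=> h bh; exact: (cond_expectation_pull Cmeasurable (v_variance s)).
Qed.

(** [mu] is the conditional mean of the truncated shock and [u] its conditional variance, both valid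
    against tests in the other shocks. After recentring, the error in the residual is the truncation
    error minus its own conditional mean, so its second moment does not exceed that of the
    truncation error. *)
Lemma truncation (n : nat) (e : R) : (0 < n)%N -> 0 < e ->
  (forall r : R, (r - clip_floor n r) ^+ 2 <= e * (1 + `|r| `^ (2 + nu))) ->
  exists mu u : 'I_S -> T -> R,
  let eT s x := clip_floor n (X s x) - mu s x in
  [/\ forall s, sbounded (mu s),
      forall s, cyl_fun C X (pred1 s) (eT s),
      forall s x, `|eT s x| <= 2 * n%:R,
      forall s h, cyl_fun C X (predC1 s) h -> 'E (fun x => eT s x * h x) = 0 &
      [/\ forall s, sbounded (u s),
      forall s x, `|u s x| <= (2 * n%:R) ^+ 2,
      forall s h, cyl_fun C X (predC1 s) h ->
        'E (fun x => eT s x ^+ 2 * h x) = 'E (fun x => u s x * h x),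
      forall s, L1 (fun x => (X s x - m s x - eT s x) ^+ 2) &
      forall s c, sbounded c -> (forall x, 0 <= c x) ->
        'E (fun x => (X s x - m s x - eT s x) ^+ 2 * c x) <= e * (1 + K) * 'E c]].
Proof.
move=> n0 e0 ne.
have cyl_phi s := cyl_fun_clip_floor C X s n.
have bphi s : bounded_mfun (fun x => clip_floor n (X s x)).
  exact: bounded_clip_floor.
have phin s x : `|clip_floor n (X s x)| <= n%:R by exact: clip_floor_bound.
have /choice[mu muP] s := cyl_fun_expectation_bounded (ler0n R n) (cyl_phi s) (phin s).
pose eT s x := clip_floor n (X s x) - mu s x.
have eTcyl s : cyl_fun C X (pred1 s) (eT s).
  by apply: cyl_funB => //; apply: cyl_fun_sbounded; have [] := muP s.
have eTn s x : `|eT s x| <= 2 * n%:R.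
  have [_ mun _] := muP s.
  by rewrite (le_trans (ler_normB _ _))// mulrDl mul1r lerD.
have n2 : 0 <= (2 * n%:R) ^+ 2 :> R by exact: sqr_ge0.
have eT2cyl s : cyl_fun C X (pred1 s) (fun x => eT s x ^+ 2).
  by under eq_fun do rewrite expr2; exact: cyl_funM.
have eT2n s x : `|eT s x ^+ 2| <= (2 * n%:R) ^+ 2.
  by rewrite normrX lerXn2r ?nnegrE.
have /choice[u uP] s := cyl_fun_expectation_bounded n2 (eT2cyl s) (eT2n s).
have bmu s : sbounded (mu s) by have [] := muP s.
have bmu' s := sbounded_bounded Cmeasurable (bmu s).
have bm' s := sbounded_bounded Cmeasurable (m_bounded s).
exists mu, u => /=; split => //.
- move=> s h Jh; have [_ _ muE] := muP s.
  have bh := cyl_fun_bounded Cmeasurable mX Jh.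
  under [X in 'E X]eq_fun do rewrite mulrBl.
  by rewrite expectationBR ?muE ?subrr//; exact/bounded_integrable/bounded_mfunM.
have lD s : L1 (fun x => X s x - clip_floor n (X s x)).
  by apply: integrableBR => //; exact: bounded_integrable.
have lD2 s : L1 (fun x => (X s x - clip_floor n (X s x)) ^+ 2).
  apply: (le_integrableR _ _ (integrableZR e (l1Xp s))).
    exact/measurable_funX/integrable_measurable/lD.
  by move=> x; rewrite ger0_norm ?sqr_ge0.
have rhoE s x : X s x - m s x - (clip_floor n (X s x) - mu s x) =
    X s x - clip_floor n (X s x) - (m s x - mu s x) by ring.
split => //.
- by move=> s; have [] := uP s.
- by move=> s x; have [] := uP s.
- by move=> s h Jh; have [_ _ ->] := uP s.
- move=> s; under eq_fun do rewrite rhoE.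
  by apply: centered_integrable_sqr => //; exact: bounded_mfunB.
move=> s c bc c0; under [X in 'E X]eq_fun do rewrite rhoE.
apply: (@le_trans _ _ ('E (fun x => (X s x - clip_floor n (X s x)) ^+ 2 * c x))).
  apply: centered_second_moment => //; first exact: bounded_mfunB.
  move=> h bh; have bh' := sbounded_bounded Cmeasurable bh.
  under [X in 'E X]eq_fun do rewrite mulrBl.
  under [X in _ = 'E X]eq_fun do rewrite mulrBl.
  rewrite !expectationBR.
  - rewrite m_pull//; congr (_ - _); have [_ _ ->//] := muP s.
    exact: cyl_fun_sbounded.
  - exact/bounded_integrable/bounded_mfunM.
  - exact/bounded_integrable/bounded_mfunM.
  - exact: integrableMR.
  - exact/bounded_integrable/bounded_mfunM.
apply: dom_moment => //; exact: ltW.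
Qed.

(** With [a] the residual and [b] its surrogate, [a ^ 2 - b ^ 2] is the product of [a - b] and
    [2 * a - (a - b)]; the cross term [2 * |a| * |a - b|] is at most
    [(a - b) ^ 2 / eta + eta * a ^ 2]. The weight [eta] stays free, to be balanced against [e]
    later. *)
Lemma truncated_variance_gap (s : 'I_S) (eT u c : T -> R) (e eta : R) :
  0 < eta -> bounded_mfun eT -> sbounded u ->
  (forall h, sbounded h -> 'E (fun x => eT x ^+ 2 * h x) = 'E (fun x => u x * h x)) ->
  L1 (fun x => (X s x - m s x - eT x) ^+ 2) ->
  sbounded c -> (forall x, 0 <= c x) ->
  'E (fun x => (X s x - m s x - eT x) ^+ 2 * c x) <= e * 'E c ->
  'E (fun x => `|v s x - u x| * c x) <= (e + e / eta + eta * (1 + K)) * 'E c.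
Proof.
move=> eta0 beT bu uE lrho bc c0 rhoe.
have bc' := sbounded_bounded Cmeasurable bc.
have bu' := sbounded_bounded Cmeasurable bu.
have [lf _ lv _] := v_variance s.
have leT : L1 (fun x => eT x ^+ 2) by exact/bounded_integrable/bounded_mfunX.
apply: (@le_trans _ _ ('E (fun x => `|(X s x - m s x) ^+ 2 - eT x ^+ 2| * c x))).
  apply: cond_expectation_L1_le => //.
  - exact: integrableBR.
  - by apply: integrableBR => //; exact: bounded_integrable.
  - apply: (@measurable_funB _ (g_sigma_algebraType C)); last exact: bu.1.
    exact: cond_expectation_smeasurable (v_variance s).
  move=> h bh; have bh' := sbounded_bounded Cmeasurable bh.
  under [X in 'E X]eq_fun do rewrite mulrBl.
  under [X in _ = 'E X]eq_fun do rewrite mulrBl.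
  rewrite !expectationBR.
  - by rewrite (cond_expectation_pull Cmeasurable (v_variance s))// uE.
  - exact: integrableMR.
  - exact/bounded_integrable/bounded_mfunM.
  - exact: integrableMR.
  - exact: integrableMR.
pose D x := (1 + eta^-1) * ((X s x - m s x - eT x) ^+ 2 * c x) +
            eta * ((X s x - m s x) ^+ 2 * c x).
have l1 : L1 (fun x => (X s x - m s x - eT x) ^+ 2 * c x) by exact: integrableMR.
have l2 : L1 (fun x => (X s x - m s x) ^+ 2 * c x) by exact: integrableMR.
apply: (@le_trans _ _ ('E D)).
  apply: le_expectationR.
  - by apply: integrableMR => //; apply: integrable_normR; exact: integrableBR.
  - by apply: integrableDR; exact: integrableZR.
  move=> x; rewrite /D mulrA mulrA -mulrDl ler_wpM2r//.
  set a := X s x - m s x; set b := eT x.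
  have key : 2 * `|a| * `|a - b| <= eta^-1 * (a - b) ^+ 2 + eta * a ^+ 2.
    rewrite -[(a - b) ^+ 2]real_normK ?num_real// -[a ^+ 2]real_normK ?num_real//.
    have : 0 <= eta^-1 * (`|a - b| - eta * `|a|) ^+ 2.
      by rewrite mulr_ge0 ?sqr_ge0// invr_ge0 ltW.
    have -> : eta^-1 * (`|a - b| - eta * `|a|) ^+ 2 =
      eta^-1 * `|a - b| ^+ 2 + eta * `|a| ^+ 2 - 2 * `|a| * `|a - b|.
      by field; rewrite gt_eqF.
    by rewrite subr_ge0.
  have -> : a ^+ 2 - b ^+ 2 = (a - b) * (2 * a - (a - b)) by ring.
  rewrite normrM (@le_trans _ _ (`|a - b| * (2 * `|a| + `|a - b|)))//.
    by rewrite ler_wpM2l// (le_trans (ler_normB _ _))// normrM ger0_norm.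
  have := @real_normK _ (a - b) (num_real _); move: key; lra.
rewrite expectationDR; [|exact: integrableZR|exact: integrableZR].
rewrite !expectationZR//; have := residual_second_moment s bc c0.
have e1 : 0 <= 1 + eta^-1 by rewrite addr_ge0// invr_ge0 ltW.
move=> /(ler_wpM2l (ltW eta0)) r1; move: rhoe => /(ler_wpM2l e1) r2.
by rewrite (le_trans (lerD r2 r1))//; lra.
Qed.

End OneRow.

(** * Convergence in probability *)

Section SmallInProbability.
Context {d} {T : measurableType d} {R : realType} (P : probability T R).
Local Notation "''E' f" := (Rintegral P setT f) (at level 10, f at level 9).
Local Notation L1 f := (P.-integrable setT (EFin \o f)).
Implicit Types f g : nat -> T -> R.

(* Exceptional sets are explicit measurable events, so that no measurability
   is required of the random variables being compared. *)
Definition outside_event (e : R) (Q : T -> Prop) : Prop :=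
  exists A, [/\ measurable A, (P A <= e%:E)%E & forall x, ~ A x -> Q x].

Definition whp (Q : nat -> T -> Prop) : Prop :=
  forall e : R, 0 < e -> \forall n \near \oo, outside_event e (Q n).

Definition op f : Prop := forall e : R, 0 < e -> whp (fun n x => `|f n x| < e).

Definition Op f : Prop := forall e : R, 0 < e ->
  exists B : R, \forall n \near \oo, outside_event e (fun x => `|f n x| <= B).

Lemma outside_event_and e1 e2 (Q1 Q2 : T -> Prop) :
  outside_event e1 Q1 -> outside_event e2 Q2 ->
  outside_event (e1 + e2) (fun x => Q1 x /\ Q2 x).
Proof.
move=> [A [mA PA AQ]] [B [mB PB BQ]]; exists (A `|` B); split.
- exact: measurableU.
- by rewrite (le_trans (measureU2 P mA mB))// EFinD leeD.
- by move=> x AB; split; [apply: AQ|apply: BQ] => ?; apply: AB; [left|right].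
Qed.

Lemma outside_event_imply e (Q1 Q2 : T -> Prop) : (forall x, Q1 x -> Q2 x) ->
  outside_event e Q1 -> outside_event e Q2.
Proof.
by move=> Q12 [A [mA PA AQ]]; exists A; split=> // x /AQ; exact: Q12.
Qed.

Lemma outside_event_markov (f0 : T -> R) (e B : R) : L1 f0 -> 0 < B ->
  'E (fun x => `|f0 x|) <= e * B -> outside_event e (fun x => `|f0 x| < B).
Proof.
move=> lf B0 fB; exists [set x | B <= `|f0 x|]; split.
- apply: measurable_set_le; first exact: measurable_cst.
  by apply: measurableT_comp => //; exact: integrable_measurable lf.
- rewrite (le_trans (markovR B0 (integrable_normR lf) _))// lee_fin.
  by rewrite ler_pdivrMr.
- by move=> x /negP; rewrite -ltNge.
Qed.

Lemma whp_and (Q1 Q2 : nat -> T -> Prop) :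
  whp Q1 -> whp Q2 -> whp (fun n x => Q1 n x /\ Q2 n x).
Proof.
move=> Q1P Q2P e e0; have e2 : 0 < e / 2 by rewrite divr_gt0.
near=> n; rewrite [e]splitr; apply: outside_event_and.
  by near: n; exact: Q1P.
by near: n; exact: Q2P.
Unshelve. all: by end_near. Qed.

Lemma whp_imply (Q1 Q2 : nat -> T -> Prop) :
  (forall n x, Q1 n x -> Q2 n x) -> whp Q1 -> whp Q2.
Proof.
move=> Q12 Q1P e e0; have := Q1P e e0.
by apply: filterS => n; exact: outside_event_imply (Q12 n).
Qed.

Lemma whp_ae (Q : nat -> T -> Prop) : (forall n, {ae P, forall x, Q n x}) -> whp Q.
Proof.
move=> QP e e0; near=> n; have [A [mA A0 AQ]] := QP n; exists A; split => //.
  by rewrite A0 lee_fin ltW.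
by move=> x Ax; apply: contrapT => /AQ.
Unshelve. all: by end_near. Qed.

Lemma op_le f g : op g -> whp (fun n x => `|f n x| <= `|g n x|) -> op f.
Proof.
move=> og fg e e0; apply: whp_imply (whp_and (og _ e0) fg) => n x [+ /le_lt_trans].
by move=> /[swap]; exact.
Qed.

Lemma op_whp_eq f g : op g -> whp (fun n x => f n x = g n x) -> op f.
Proof. by move=> og fg; apply: op_le og _; apply: whp_imply fg => n x ->. Qed.

Lemma op_eq f g : op g -> (forall n x, f n x = g n x) -> op f.
Proof. by move=> og fg; rewrite (_ : f = g)//; apply/funext => n; apply/funext. Qed.

Lemma op0 : op (fun _ _ => 0).
Proof.
move=> e e0; apply: whp_ae => n; apply: aeW => x; by rewrite normr0.
Qed.

Lemma opD f g : op f -> op g -> op (fun n x => f n x + g n x).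
Proof.
move=> of_ og e e0; have e2 : 0 < e / 2 by rewrite divr_gt0.
apply: whp_imply (whp_and (of_ _ e2) (og _ e2)) => n x [fx gx].
by rewrite (le_lt_trans (ler_normD _ _))// [e]splitr ltrD.
Qed.

Lemma Op_cst (c : R) : Op (fun _ _ => c).
Proof.
move=> e e0; exists `|c|; near=> n; exists set0; split => //.
by rewrite measure0 lee_fin ltW.
Unshelve. all: by end_near. Qed.

Lemma Op_op f : op f -> Op f.
Proof.
move=> of_ e e0; exists 1; have := of_ 1 ltr01 e e0; apply: filterS => n.
by apply: outside_event_imply => x /ltW.
Qed.

Lemma OpD f g : Op f -> Op g -> Op (fun n x => f n x + g n x).
Proof.
move=> of_ og e e0; have e2 : 0 < e / 2 by rewrite divr_gt0.
have [B fB] := of_ _ e2; have [D gD] := og _ e2; exists (B + D); near=> n.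
rewrite [e]splitr; apply: (@outside_event_imply _ (fun x => `|f n x| <= B /\ `|g n x| <= D)).
  by move=> x [? ?]; rewrite (le_trans (ler_normD _ _))// lerD.
by apply: outside_event_and; near: n.
Unshelve. all: by end_near. Qed.

Lemma OpM f g : Op f -> Op g -> Op (fun n x => f n x * g n x).
Proof.
move=> of_ og e e0; have e2 : 0 < e / 2 by rewrite divr_gt0.
have [B fB] := of_ _ e2; have [D gD] := og _ e2; exists (B * D); near=> n.
rewrite [e]splitr; apply: (@outside_event_imply _ (fun x => `|f n x| <= B /\ `|g n x| <= D)).
  by move=> x [? ?]; rewrite normrM ler_pM.
by apply: outside_event_and; near: n.
Unshelve. all: by end_near. Qed.

Lemma opM f g : op f -> Op g -> op (fun n x => f n x * g n x).
Proof.
move=> of_ og e e0 b b0; have b2 : 0 < b / 2 by rewrite divr_gt0.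
have [B gB] := og _ b2.
(* The bound [B] may be 0, or negative when the event it describes is empty, and it is about to be a
   divisor. *)
have B0 : 0 < `|B| + 1 by rewrite ltr_pwDr.
near=> n; rewrite [b]splitr.
apply: (@outside_event_imply _ (fun x => `|f n x| < e / (`|B| + 1) /\ `|g n x| <= B)).
  move=> x [fx gx]; rewrite normrM.
  have gB' : `|g n x| <= `|B| + 1.
    by rewrite (le_trans gx)// (le_trans (ler_norm _))// lerDl.
  rewrite (le_lt_trans (ler_wpM2l _ gB'))//.
  by rewrite -ltr_pdivlMr.
apply: outside_event_and; near: n => //.
by apply: (of_ (e / (`|B| + 1))) => //; rewrite divr_gt0.
Unshelve. all: by end_near. Qed.

Lemma opMr f g : Op f -> op g -> op (fun n x => f n x * g n x).
Proof. by move=> of_ og; apply: op_eq (opM og of_) _ => n x; rewrite mulrC. Qed.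

Lemma opZ (c : R) f : op f -> op (fun n x => c * f n x).
Proof. exact/opMr/Op_cst. Qed.

Lemma opN f : op f -> op (fun n x => - f n x).
Proof. by move=> /(opZ (-1)) of_; apply: op_eq of_ _ => n x; rewrite mulN1r. Qed.

Lemma opB f g : op f -> op g -> op (fun n x => f n x - g n x).
Proof. by move=> of_ og; apply: opD => //; exact: opN. Qed.

Lemma op_sum I (r : seq I) (p : pred I) (F : I -> nat -> T -> R) :
  (forall i, p i -> op (F i)) -> op (fun n x => \sum_(i <- r | p i) F i n x).
Proof.
move=> oF; elim: r => [|i r IH].
  by apply: op_eq op0 _ => n x; rewrite big_nil.
case pi : (p i).
  by apply: op_eq (opD (oF _ pi) IH) _ => n x; rewrite big_cons pi.
by apply: op_eq IH _ => n x; rewrite big_cons pi.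
Qed.

(** Telescoping, one factor at a time; the product of the remaining factors is [Op] because it
    differs from a constant by an [op] term. *)
Lemma op_prod I (r : seq I) (F : I -> nat -> T -> R) (a : I -> R) :
  (forall i, op (fun n x => F i n x - a i)) ->
  op (fun n x => \prod_(i <- r) F i n x - \prod_(i <- r) a i).
Proof.
move=> oF; elim: r => [|i r IH].
  by apply: op_eq op0 _ => n x; rewrite !big_nil subrr.
have : op (fun n x => (F i n x - a i) * \prod_(j <- r) F j n x +
            a i * (\prod_(j <- r) F j n x - \prod_(j <- r) a j)).
  apply: opD; last exact: opZ.
  apply: opM => //.
  have := OpD (Op_op IH) (Op_cst (\prod_(j <- r) a j)).
  by under eq_fun do under eq_fun do rewrite subrK.
by move=> /op_eq; apply => n x; rewrite !big_cons; ring.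
Qed.

(** Once [f] is within [|a| / 2] of [a], it is at least [|a| / 2] in absolute value, and the inverse
    moves by at most [2 / |a| ^+ 2] times the displacement. *)
Lemma op_inv f (a : R) : a != 0 -> op (fun n x => f n x - a) ->
  op (fun n x => (f n x)^-1 - a^-1).
Proof.
move=> a0 of_; have a1 : 0 < `|a| by rewrite normr_gt0.
have a2 : 0 < `|a| / 2 by rewrite divr_gt0.
apply: op_le (opZ (2 / `|a| ^+ 2) of_) _.
apply: whp_imply (of_ _ a2) => n x fx.
have fa : `|a| / 2 <= `|f n x|.
  have := lerB_dist a (a - f n x); rewrite subKr distrC => h.
  by rewrite (le_trans _ h)//; lra.
have f0 : f n x != 0 by rewrite -normr_gt0 (lt_le_trans a2).
have -> : (f n x)^-1 - a^-1 = - ((f n x - a) / (f n x * a)).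
  by field; rewrite a0.
rewrite normrN !normrM mulrC [leRHS]mulrC [X in _ <= X]mulrC ler_wpM2r// normfV normrM.
have -> : `|2| * `| `|a| ^- 2| = (`|a| / 2 * `|a|)^-1.
  rewrite [`|2|]ger0_norm// [X in _ * X]ger0_norm ?invr_ge0 ?sqr_ge0//.
  by field; rewrite gt_eqF.
by rewrite lef_pV2 ?posrE ?mulr_gt0 ?normr_gt0// ler_wpM2r.
Qed.

Lemma Op_inv f (a : R) : a != 0 -> op (fun n x => f n x - a) ->
  Op (fun n x => (f n x)^-1).
Proof.
move=> a0 /(op_inv a0)/Op_op of_.
have := OpD of_ (Op_cst a^-1).
by under eq_fun do under eq_fun do rewrite subrK.
Qed.

Lemma op_L1 f : (forall e : R, 0 < e -> \forall n \near \oo,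
    L1 (f n) /\ 'E (fun x => `|f n x|) <= e) -> op f.
Proof.
move=> fP e e0 b b0; have := fP (b * e) (mulr_gt0 b0 e0).
by apply: filterS => n [lf fe]; exact: outside_event_markov.
Qed.

Lemma Op_L1 f (B : R) : (\forall n \near \oo,
    L1 (f n) /\ 'E (fun x => `|f n x|) <= B) -> Op f.
Proof.
move=> fP e e0; exists ((`|B| + 1) / e).
apply: filterS fP => n [lf fe].
apply: (@outside_event_imply _ (fun x => `|f n x| < (`|B| + 1) / e)) => [x /ltW//|].
apply: outside_event_markov => //; first by rewrite divr_gt0// ltr_pwDr.
by rewrite mulrC divfK ?gt_eqF// (le_trans fe)// (le_trans (ler_norm _))// lerDl.
Qed.

(** The form in which a truncation is removed: the decomposition may depend on [e], and [g] may
    vanish at a rate that depends on [e], as long as [h] is small in mean for all large [n]. *)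
Lemma op_approx f : (forall e : R, 0 < e -> exists g h,
    [/\ op g, forall n x, f n x = g n x + h n x &
     \forall n \near \oo, L1 (h n) /\ 'E (fun x => `|h n x|) <= e]) -> op f.
Proof.
move=> fP e e0 b b0; have e2 : 0 < e / 2 by rewrite divr_gt0.
have b2 : 0 < b / 2 by rewrite divr_gt0.
have [g [h [og fgh hP]]] := fP _ (mulr_gt0 b2 e2).
near=> n; rewrite [b]splitr.
apply: (@outside_event_imply _ (fun x => `|g n x| < e / 2 /\ `|h n x| < e / 2)).
  by move=> x [gx hx]; rewrite fgh (le_lt_trans (ler_normD _ _))// [e]splitr ltrD.
apply: outside_event_and; first by near: n; exact: og.
have [lh hb] : L1 (h n) /\ 'E (fun x => `|h n x|) <= b / 2 * (e / 2) by near: n.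
exact: outside_event_markov.
Unshelve. all: by end_near. Qed.

Lemma op_cvg_in_probability (f : nat -> T -> R^o) :
  (forall n, measurable_fun setT (f n : T -> R)) -> op f ->
  cvg_in_probability P f 0.
Proof.
move=> mf of_ e e0.
have mB n : measurable [set x | e <= `|f n x - 0|].
  apply: (@measurable_set_le _ _ _ (fun=> e) (fun x => `|f n x - 0|)) => //.
  by apply: measurableT_comp => //; apply: measurable_funB => //; exact: mf.
apply/fine_cvgP; split; first by near=> n; rewrite fin_num_measure.
apply/cvgrPdist_le => b b0; near=> n.
have [A [mA PA Ae]] : outside_event b (fun x => `|f n x| < e) by near: n; exact: of_.
rewrite sub0r normrN ger0_norm ?fine_ge0//.
rewrite -lee_fin fineK ?fin_num_measure//; apply: le_trans PA.
rewrite le_measure ?inE// => x /=; rewrite subr0 => ex.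
by apply: contrapT => /Ae; rewrite ltNge ex.
Unshelve. all: by end_near. Qed.

Lemma cvg_in_probability_op {V : normedModType R} (f : nat -> T -> V) (l : V) :
  (forall n, measurable_fun setT (fun x => `|f n x - l|)) ->
  cvg_in_probability P f l -> op (fun n x => `|f n x - l|).
Proof.
move=> mf fl e e0 b b0; have /fine_cvgP[_ /cvgrPdist_le/(_ b b0)] := fl e e0.
apply: filterS => n; rewrite sub0r normrN => fb.
have mB : measurable [set x | e <= `|f n x - l|].
  by apply: (@measurable_set_le _ _ _ (fun=> e) (fun x => `|f n x - l|)).
exists [set x | e <= `|f n x - l|]; split => //.
  by rewrite -[leLHS]fineK ?fin_num_measure// lee_fin (le_trans (ler_norm _)).
by move=> x /negP; rewrite -ltNge normr_id.
Qed.

(** Egorov's theorem: almost sure convergence is uniform off an event of probability below [b],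
    which becomes the exceptional set. *)
Lemma ae_cvg_op (f : nat -> T -> R) : (forall n, measurable_fun setT (f n)) ->
  {ae P, forall x, f n x @[n --> \oo] --> (0 : R)} -> op f.
Proof.
move=> mf f0 e e0 b b0.
have [||//|A [mA PA Af]] :=
  @ae_pointwise_almost_uniform _ R _ P f (fun=> 0) setT b mf _ measurableT _ _ b0.
- exact: measurable_cst.
- by rewrite (le_lt_trans (probability_le1 _ _))// ltry.
- by apply: filterS f0 => x fx _.
have : \forall n \near \oo, forall y, (setT `\` A) y -> `|f n y| < e.
  suff : nbhs (f x @[x --> \oo]) [set h | forall y, (setT `\` A) y -> `|h y| < e] by [].
  apply: Af; apply/(@uniform_nbhs _ _ (R : uniformType)).
  exists [set xy : R * R | ball xy.1 e xy.2]; split.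
    exact: (entourage_ball _ (PosNum e0)).
  move=> h hy y Ay; have := hy y Ay.
  by rewrite /= -ball_normE /= sub0r normrN.
apply: filterS => n fe; exists A; split => //; first exact: ltW.
by move=> x Ax; apply: fe.
Qed.

End SmallInProbability.

(** * Share-weighted averages *)

Section Weights.
Context {R : realFieldType}.

(** Twice the gap is the double sum of [w i * w j * (h i - h j) ^+ 2]; this argument divides by
    nothing, so a zero total weight is covered. *)
Lemma weighted_cauchy_schwarz (I : finType) (w h : I -> R) :
  (forall i, 0 <= w i) ->
  (\sum_i w i * h i) ^+ 2 <= (\sum_i w i) * \sum_i w i * h i ^+ 2.
Proof.
move=> w0; set W := \sum_i w i; set H := \sum_i w i * h i.
set Q := \sum_i w i * h i ^+ 2.
have : 0 <= \sum_i \sum_j w i * w j * (h i - h j) ^+ 2.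
  apply: sumr_ge0 => i _; apply: sumr_ge0 => j _.
  by rewrite mulr_ge0 ?sqr_ge0// mulr_ge0.
have -> : \sum_i \sum_j w i * w j * (h i - h j) ^+ 2 = 2 * (W * Q - H ^+ 2).
  transitivity (\sum_i (w i * h i ^+ 2 * W - 2 * (w i * h i) * H + w i * Q)).
    apply: eq_bigr => i _; rewrite /W /H /Q !mulr_sumr -sumrB -big_split/=.
    by apply: eq_bigr => j _; ring.
  rewrite big_split/= sumrB -!mulr_suml -mulr_sumr -/W -/H -/Q; ring.
by rewrite pmulr_rge0// subr_ge0.
Qed.

Lemma weighted_jensen (I : finType) (w h : I -> R) :
  (forall i, 0 <= w i) -> \sum_i w i <= 1 ->
  (\sum_i w i * h i) ^+ 2 <= \sum_i w i * h i ^+ 2.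
Proof.
move=> w0 w1; rewrite (le_trans (weighted_cauchy_schwarz h w0))//.
by rewrite ler_piMl// sumr_ge0// => i _; rewrite mulr_ge0 ?sqr_ge0.
Qed.

Lemma mean_le (N : nat) (f : 'I_N -> R) (B : R) : 0 <= B ->
  (forall i, f i <= B) -> N%:R^-1 * \sum_i f i <= B.
Proof.
move=> B0 fB; apply: (@le_trans _ _ (N%:R^-1 * \sum_(i < N) B)).
  by rewrite ler_wpM2l ?invr_ge0// ler_sum.
rewrite sumr_const card_ord -[B *+ N]mulr_natl mulrA.
(* With no region the inverse of 0 is 0 and so is the average, which is where [0 <= B] is called
   for. *)
by have [->|N0] := eqVneq N 0%N; rewrite ?mulr0 ?mul0r// mulVf ?pnatr_eq0// mul1r.
Qed.

Variables (N S : nat) (w : 'I_N -> 'I_S -> R) (dl : R).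
Hypothesis w0 : forall i s, 0 <= w i s.
Hypothesis w1 : forall i, \sum_s w i s <= 1.

Lemma weight_le1 i s : w i s <= 1.
Proof.
rewrite (le_trans _ (w1 i))// (bigD1 s)//= lerDl.
by apply: sumr_ge0 => t _.
Qed.

Hypothesis dl0 : 0 <= dl.
Hypothesis size_small : forall s, \sum_i w i s <= dl * N%:R.

Let N0 : 0 <= N%:R^-1 :> R. Proof. by rewrite invr_ge0. Qed.

Let size_small' s : N%:R^-1 * \sum_i w i s <= dl.
Proof.
have [N00|N1] := eqVneq (N%:R : R) 0; first by rewrite N00 invr0 mul0r.
by rewrite mulrC ler_pdivrMr// lt0r N1 ler0n.
Qed.

(** Cauchy-Schwarz takes out of each square the normalized sector size, at most [dl]; summing the
    other factor over [s] costs nothing because the shares of a region sum to at most 1. *)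
Lemma linear_coefficients_bound (h : 'I_N -> R) :
  \sum_s (N%:R^-1 * \sum_i w i s * h i) ^+ 2 <= dl * (N%:R^-1 * \sum_i h i ^+ 2).
Proof.
apply: (@le_trans _ _ (\sum_s dl * (N%:R^-1 * \sum_i w i s * h i ^+ 2))).
  apply: ler_sum => s _; rewrite exprMn.
  have := weighted_cauchy_schwarz h (w0 ^~ s).
  move=> /(ler_wpM2l (sqr_ge0 (N%:R^-1 : R))) /le_trans; apply.
  rewrite expr2 mulrACA ler_wpM2r// mulr_ge0// sumr_ge0// => i _.
  by rewrite mulr_ge0 ?sqr_ge0.
rewrite -mulr_sumr -mulr_sumr exchange_big/=.
rewrite ler_wpM2l// ler_wpM2l//; apply: ler_sum => i _.
by rewrite -mulr_suml ler_piMl ?sqr_ge0.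
Qed.

(** The coefficients are dominated by [B * g s t], with [g s t] the average over regions of
    [w i s * w i t]. Each [g s t] is at most [dl], and all of them together sum to at most 1, so
    their squares sum to at most [dl]. *)
Lemma quadratic_coefficients_bound (b : 'I_N -> 'I_S -> R) (B : R) :
  (forall i s, `|b i s| <= B) ->
  \sum_s \sum_t (N%:R^-1 * \sum_i w i s * w i t * b i t) ^+ 2 <= B ^+ 2 * dl.
Proof.
move=> bB; pose g s t := N%:R^-1 * \sum_i w i s * w i t.
have g0 s t : 0 <= g s t.
  by rewrite mulr_ge0// sumr_ge0// => i _; rewrite mulr_ge0.
have gdl s t : g s t <= dl.
  rewrite (le_trans _ (size_small' s))// ler_wpM2l// ler_sum// => i _.
  by rewrite ler_piMr// weight_le1.
have gsum : \sum_s \sum_t g s t <= 1.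
  have -> : \sum_s \sum_t g s t = N%:R^-1 * \sum_i (\sum_s w i s) * \sum_t w i t.
    rewrite /g; under eq_bigr do rewrite -mulr_sumr.
    rewrite -mulr_sumr; congr (_ * _); under eq_bigr do rewrite exchange_big/=.
    rewrite exchange_big/=; apply: eq_bigr => i _; rewrite mulr_suml.
    by apply: eq_bigr => s _; rewrite mulr_sumr.
  apply: mean_le => // i; rewrite mulr_ile1// ?sumr_ge0//.
rewrite -[leRHS]mulr1; apply: le_trans (ler_wpM2l _ gsum); last first.
  by rewrite mulr_ge0 ?sqr_ge0.
rewrite mulr_sumr; apply: ler_sum => s _; rewrite mulr_sumr; apply: ler_sum => t _.
have kg : `|N%:R^-1 * \sum_i w i s * w i t * b i t| <= B * g s t.
  rewrite normrM ger0_norm// /g mulrCA ler_wpM2l// mulr_sumr.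
  rewrite (le_trans (ler_norm_sum _ _ _))// ler_sum// => i _.
  by rewrite normrM ger0_norm ?mulr_ge0// mulrC ler_wpM2r ?mulr_ge0.
rewrite -real_normK ?num_real// (@le_trans _ _ ((B * g s t) ^+ 2))//.
  by rewrite lerXn2r ?nnegrE// (le_trans _ kg).
rewrite exprMn -[leRHS]mulrA; apply: ler_wpM2l; first exact: sqr_ge0.
by rewrite expr2; exact: ler_wpM2r.
Qed.

End Weights.

(** * Second-moment inequalities and surrogates for the shocks *)

Section TruncatedShocks.
Context {d} {T : measurableType d} {R : realType} (P : probability T R).
Local Notation "''E' f" := (Rintegral P setT f) (at level 10, f at level 9).
Local Notation L1 f := (P.-integrable setT (EFin \o f)).

Lemma integrable_product (f g : T -> R) :
  measurable_fun setT f -> measurable_fun setT g ->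
  L1 (fun x => f x ^+ 2) -> L1 (fun x => g x ^+ 2) -> L1 (fun x => f x * g x).
Proof.
move=> mf mg lf lg; apply: (le_integrableR _ _ (integrableDR lf lg)).
  exact: measurable_funM.
move=> x; rewrite normrM -[f x ^+ 2]real_normK ?num_real//.
rewrite -[g x ^+ 2]real_normK ?num_real//.
have := sqr_ge0 (`|f x| - `|g x|); have := normr_ge0 (f x).
by have := normr_ge0 (g x); nra.
Qed.

(** Young's inequality with a weight, in place of Cauchy-Schwarz, so that no square root appears;
    [eta] lets a small second moment of [f] compensate for a merely bounded one of [g]. *)
Lemma expectation_product_le (f g : T -> R) (eta : R) : 0 < eta ->
  measurable_fun setT f -> measurable_fun setT g ->
  L1 (fun x => f x ^+ 2) -> L1 (fun x => g x ^+ 2) ->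
  'E (fun x => `|f x * g x|) <=
  eta^-1 * 'E (fun x => f x ^+ 2) + eta * 'E (fun x => g x ^+ 2).
Proof.
move=> eta0 mf mg lf lg.
rewrite -!expectationZR// -expectationDR; [|exact: integrableZR|exact: integrableZR].
apply: le_expectationR.
- exact/integrable_normR/integrable_product.
- by apply: integrableDR; exact: integrableZR.
move=> x; rewrite normrM -[f x ^+ 2]real_normK ?num_real//.
rewrite -[g x ^+ 2]real_normK ?num_real//.
have : 0 <= eta^-1 * (`|f x| - eta * `|g x|) ^+ 2.
  by rewrite mulr_ge0 ?sqr_ge0// invr_ge0 ltW.
have -> : eta^-1 * (`|f x| - eta * `|g x|) ^+ 2 =
  eta^-1 * `|f x| ^+ 2 + eta * `|g x| ^+ 2 - 2 * (`|f x| * `|g x|).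
  by field; rewrite gt_eqF.
have : 0 <= `|f x| * `|g x| by rewrite mulr_ge0.
lra.
Qed.

Lemma second_momentD (f g : T -> R) (Bf Bg : R) :
  measurable_fun setT f -> measurable_fun setT g ->
  L1 (fun x => f x ^+ 2) /\ 'E (fun x => f x ^+ 2) <= Bf ->
  L1 (fun x => g x ^+ 2) /\ 'E (fun x => g x ^+ 2) <= Bg ->
  L1 (fun x => (f x + g x) ^+ 2) /\
  'E (fun x => (f x + g x) ^+ 2) <= 2 * Bf + 2 * Bg.
Proof.
move=> mf mg [lf Ef] [lg Eg].
have ld : L1 (fun x => 2 * f x ^+ 2 + 2 * g x ^+ 2).
  by apply: integrableDR; exact: integrableZR.
have le2 x : (f x + g x) ^+ 2 <= 2 * f x ^+ 2 + 2 * g x ^+ 2.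
  rewrite -subr_ge0 (_ : _ - _ = (f x - g x) ^+ 2) ?sqr_ge0//; ring.
have ls : L1 (fun x => (f x + g x) ^+ 2).
  apply: le_integrableR _ _ ld => [|x]; last by rewrite ger0_norm ?sqr_ge0.
  exact/measurable_funX/measurable_funD.
split => //; apply: le_trans (le_expectationR ls ld le2) _.
rewrite expectationDR; [|exact: integrableZR|exact: integrableZR].
by rewrite !expectationZR// lerD// ler_wpM2l.
Qed.

Lemma mean_integrable (N : nat) (f : 'I_N -> T -> R) (B : R) : 0 <= B ->
  (forall i, L1 (f i) /\ 'E (fun x => `|f i x|) <= B) ->
  L1 (fun x => N%:R^-1 * \sum_i f i x) /\
  'E (fun x => `|N%:R^-1 * \sum_i f i x|) <= B.
Proof.
move=> B0 fB; have lf i : L1 (f i) := (fB i).1.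
have ls : L1 (fun x => \sum_i f i x) by exact: integrable_sumR.
have ln : L1 (fun x => \sum_i `|f i x|).
  by apply: integrable_sumR => i _; exact: integrable_normR.
split; first exact: integrableZR.
apply: (@le_trans _ _ ('E (fun x => N%:R^-1 * \sum_i `|f i x|))).
  apply: le_expectationR; [exact/integrable_normR/integrableZR|exact: integrableZR|].
  move=> x; rewrite normrM ger0_norm ?invr_ge0// ler_wpM2l ?invr_ge0//.
  exact: ler_norm_sum.
rewrite expectationZR// expectation_sumR; last by move=> i _; exact: integrable_normR.
by apply: mean_le => // i; have [] := fB i.
Qed.

(* [eT s] is a bounded surrogate for the residual [X s - m s], with conditional
   variance [u s], at conditional mean square distance [e]. *)
Record truncated (C : set (set T)) (S : nat) (X m : 'I_S -> T -> R) (M e : R)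
    (eT u : 'I_S -> T -> R) : Prop := Truncated {
  truncated_cyl : forall s, cyl_fun C X (pred1 s) (eT s) ;
  truncated_bound : forall s x, `|eT s x| <= M ;
  truncated_centered : forall s h, cyl_fun C X (predC1 s) h ->
    'E (fun x => eT s x * h x) = 0 ;
  truncated_var_bounded : forall s, @bounded_mfun _ (g_sigma_algebraType C) _ (u s) ;
  truncated_var_bound : forall s x, `|u s x| <= M ^+ 2 ;
  truncated_var : forall s h, cyl_fun C X (predC1 s) h ->
    'E (fun x => eT s x ^+ 2 * h x) = 'E (fun x => u s x * h x) ;
  truncated_integrable : forall s, L1 (fun x => (X s x - m s x - eT s x) ^+ 2) ;
  truncated_near : forall s c, @bounded_mfun _ (g_sigma_algebraType C) _ c ->
    (forall x, 0 <= c x) ->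
    'E (fun x => (X s x - m s x - eT s x) ^+ 2 * c x) <= e * 'E c }.

(* The bound [M] depends on the moment condition only, not on the row. *)
Lemma exists_truncated (nu K e : R) : 0 < nu -> 0 <= K -> 0 < e ->
  exists2 M, 0 <= M & forall (C : set (set T)) S (X m : 'I_S -> T -> R),
    C `<=` measurable ->
    (forall s, L1 (X s)) ->
    cond_independent P <<s C >> X ->
    (forall s, @bounded_mfun _ (g_sigma_algebraType C) _ (m s)) ->
    (forall s, is_cond_expectation P <<s C >> (X s) (m s)) ->
    (forall s, cond_expectation_le P <<s C >> (fun x => `|X s x| `^ (2 + nu)) K) ->
    exists eT u, truncated C X m M e eT u.
Proof.
move=> nu0 K0 e0; have K1 : 0 < 1 + K by rewrite ltr_pwDl.
have e1 : 0 < e / (1 + K) by rewrite divr_gt0.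
have [n n0 ne] := clip_floor_approx nu0 e1.
exists (2 * n%:R) => [|C S X m Cm lX indep bm mm mom]; first by rewrite mulr_ge0.
have [mu [u /= [bmu cyl bd ct [bu ub uv li nr]]]] :=
  truncation Cm lX indep bm mm mom n0 e1 ne.
exists (fun s x => clip_floor n (X s x) - mu s x), u; split => // s c bc c0.
by have := nr s c bc c0; rewrite divfK// gt_eqF.
Qed.

End TruncatedShocks.

(** * Least squares *)

Section MatrixFacts.
Context {R : realType}.

Lemma ols_residual_shift n K (Z : 'M[R]_(n, K)) (a : 'cV[R]_n) (g : 'cV[R]_K) :
  Z^T *m Z \in unitmx -> ols_residual Z (a + Z *m g) = ols_residual Z a.
Proof.
move=> ZZ; rewrite /ols_residual !mulmxDr [Z^T *m (Z *m g)]mulmxA.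
by rewrite [invmx _ *m (_ *m g)]mulmxA mulVmx// mul1mx opprD addrACA subrr addr0.
Qed.

Lemma ols_residual_orthogonal n K (Z : 'M[R]_(n, K)) (a : 'cV[R]_n) :
  Z^T *m Z \in unitmx -> (ols_residual Z a)^T *m Z = 0.
Proof.
move=> ZZ; apply: trmx_inj; rewrite trmx_mul trmxK trmx0 /ols_residual.
by rewrite mulmxBr !mulmxA mulmxV// mul1mx subrr.
Qed.

(** Gives the denominator of the coefficient the shape of its numerator, with the regressor in the
    place of the outcome, so that one limit covers both. *)
Lemma ols_residual_sqr n K (Z : 'M[R]_(n, K)) (a : 'cV[R]_n) :
  Z^T *m Z \in unitmx ->
  (ols_residual Z a)^T *m ols_residual Z a = (ols_residual Z a)^T *m a.
Proof.
move=> ZZ; rewrite {2}/ols_residual mulmxBr [X in _ - X]mulmxA.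
by rewrite ols_residual_orthogonal// mul0mx subr0.
Qed.

(** The powers of [n] are distributed so that every factor of the projection term has a limiting
    behaviour of its own: two averages over regions and the inverse of the normalized Gram
    matrix. *)
Lemma ols_residual_formE n K (Z : 'M[R]_(n, K)) (a y : 'cV[R]_n) :
  n%:R != 0 :> R -> Z^T *m Z \in unitmx ->
  n%:R^-1 * ((ols_residual Z a)^T *m y) ord0 ord0 =
  n%:R^-1 * \sum_(i < n) a i ord0 * y i ord0 -
  \sum_(k < K) \sum_(l < K) (n%:R^-1 * \sum_(i < n) a i ord0 * Z i k) *
    (invmx (n%:R^-1 *: (Z^T *m Z)) l k * (n%:R^-1 * \sum_(i < n) Z i l * y i ord0)).
Proof.
move=> n0 ZZ; rewrite invmxZ; last by rewrite unitmxZ ?unitfE ?invr_eq0.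
rewrite invrK.
set q := invmx _.
have -> : (ols_residual Z a)^T *m y = a^T *m y - (a^T *m Z) *m q^T *m (Z^T *m y).
  by rewrite /ols_residual linearB/= mulmxBl !trmx_mul trmxK !mulmxA.
have subE (A B : 'M[R]_1) : (A - B) ord0 ord0 = A ord0 ord0 - B ord0 ord0.
  by rewrite !mxE.
rewrite subE mulrBr; congr (_ - _).
  by congr (_ * _); rewrite mxE; apply: eq_bigr => i _; rewrite mxE.
rewrite mxE mulr_sumr.
under eq_bigr do rewrite mxE mulr_suml mulr_sumr.
rewrite exchange_big/=; apply: eq_bigr => k _; apply: eq_bigr => l _.
rewrite !mxE.
have -> : \sum_i a^T ord0 i * Z i k = \sum_i a i ord0 * Z i k.
  by apply: eq_bigr => i _; rewrite mxE.
have -> : \sum_i Z^T l i * y i ord0 = \sum_i Z i l * y i ord0.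
  by apply: eq_bigr => i _; rewrite mxE.
by field.
Qed.

Lemma positive_definite_det K (Q : 'M[R]_K) : positive_definite Q -> \det Q != 0.
Proof.
move=> [Qsym Qpos]; apply/negP => /eqP Q0.
have /negP : ~ (Q^T \in unitmx) by rewrite unitmxE det_tr Q0 unitr0.
rewrite -row_free_unit -kermx_eq0 => /rowV0Pn[u /sub_kermxP uQ u0].
have := Qpos u^T; rewrite trmxK => /(_ _).
rewrite -Qsym uQ mul0mx mxE ltxx => H.
have : u^T != 0 by apply: contra u0 => /eqP uT; rewrite -[u]trmxK uT trmx0.
by move=> /H.
Qed.

End MatrixFacts.

(** * Limits of determinants and inverses *)

Section MatrixLimits.
Context {d} {T : measurableType d} {R : realType} (P : probability T R).

Lemma op_det K (A : nat -> T -> 'M[R]_K) (Q : 'M[R]_K) :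
  (forall i j, op P (fun n x => A n x i j - Q i j)) ->
  op P (fun n x => \det (A n x) - \det Q).
Proof.
move=> AQ; rewrite /determinant.
have : op P (fun n x => \sum_(s : 'S_K) (-1) ^+ s *
    (\prod_i A n x i (s i) - \prod_i Q i (s i))).
  by apply: op_sum => s _; apply: opZ; exact: op_prod.
move=> /op_eq; apply => n x; rewrite -sumrB; apply: eq_bigr => s _.
by rewrite mulrBr.
Qed.

Lemma op_adj K (A : nat -> T -> 'M[R]_K) (Q : 'M[R]_K) i j :
  (forall i j, op P (fun n x => A n x i j - Q i j)) ->
  op P (fun n x => (\adj (A n x)) i j - (\adj Q) i j).
Proof.
move=> AQ; have : op P (fun n x => (-1) ^+ (j + i) *
    (\det (row' j (col' i (A n x))) - \det (row' j (col' i Q)))).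
  apply/opZ/op_det => k l; apply: op_eq (AQ (lift j k) (lift i l)) _ => n x.
  by rewrite !mxE.
by move=> /op_eq; apply => n x; rewrite !mxE /cofactor mulrBr.
Qed.

Lemma whp_neq0 (f : nat -> T -> R) (a : R) : a != 0 ->
  op P (fun n x => f n x - a) -> whp P (fun n x => f n x != 0).
Proof.
move=> a0 fa; have a1 : 0 < `|a| by rewrite normr_gt0.
apply: whp_imply (fa _ a1) => n x; apply: contraTneq => ->.
by rewrite sub0r normrN ltxx.
Qed.

(** Determinant and cofactors are polynomials in the entries, so entrywise limits pass to them; the
    inverse is their quotient wherever the determinant is nonzero, that is, with high
    probability. *)
Lemma Op_invmx K (A : nat -> T -> 'M[R]_K) (Q : 'M[R]_K) i j : \det Q != 0 ->
  (forall i j, op P (fun n x => A n x i j - Q i j)) ->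
  Op P (fun n x => invmx (A n x) i j).
Proof.
move=> Q0 AQ; have dA := op_det AQ; have aA := op_adj i j AQ.
have O1 : Op P (fun n x => (\det (A n x))^-1 * (\adj (A n x)) i j).
  apply: OpM; first exact: Op_inv dA.
  have := OpD (Op_op aA) (Op_cst P ((\adj Q) i j)).
  by under eq_fun do under eq_fun do rewrite subrK.
have : op P (fun n x => invmx (A n x) i j - (\det (A n x))^-1 * (\adj (A n x)) i j).
  apply: op_whp_eq (op0 P) _; apply: whp_imply (whp_neq0 Q0 dA) => n x dx.
  by rewrite /invmx unitmxE unitfE dx mxE subrr.
move=> /Op_op O2; have := OpD O2 O1.
by under eq_fun do under eq_fun do rewrite subrK.
Qed.

End MatrixLimits.

(** * Measurability of the least squares statistics *)

Section MatrixMeasurability.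
Context {d} {T : measurableType d} {R : realType}.

Definition measurable_mx {m n} (A : T -> 'M[R]_(m, n)) : Prop :=
  forall i j, measurable_fun setT (fun x => A x i j).

(** Positive and negative parts are inverted separately, where inversion is the power [- 1] of a
    nonnegative number; as [0^-1 = 0], the part that is absent contributes nothing. *)
Lemma measurable_invr (f : T -> R) : measurable_fun setT f ->
  measurable_fun setT (fun x => (f x)^-1).
Proof.
move=> mf.
have minv (g : T -> R) : measurable_fun setT g ->
    measurable_fun setT (fun x => (Num.max (g x) 0)^-1).
  move=> mg; under eq_fun do rewrite -powR_inv1 ?le_max ?lexx ?orbT//.
  apply: (measurableT_comp (measurable_powR (- 1))).
  by apply: measurable_maxr => //; exact: measurable_cst.
have -> : (fun x => (f x)^-1) =
    (fun x => (Num.max (f x) 0)^-1 - (Num.max (- f x) 0)^-1).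
  apply/funext => x; have [fx|fx|<-] := ltgtP 0 (f x).
  - by rewrite (max_r (y := 0)) ?invr0 ?subr0// oppr_le0 ltW.
  - by rewrite invr0 sub0r max_l ?oppr_ge0 ?ltW// invrN opprK.
  - by rewrite oppr0 maxxx invr0 subrr.
apply: measurable_funB; first exact: minv.
by apply: minv; exact: measurable_funN.
Qed.

Lemma measurable_bigmax I (r : seq I) (F : I -> T -> R) :
  (forall i, measurable_fun setT (F i)) ->
  measurable_fun setT (fun x => \big[Num.max/0]_(i <- r) F i x).
Proof.
move=> mF; elim: r => [|i r IH].
  by under eq_fun do rewrite big_nil; exact: measurable_cst.
by under eq_fun do rewrite big_cons; exact: measurable_maxr.
Qed.

Lemma measurable_mulmx m n p (A : T -> 'M[R]_(m, n)) (B : T -> 'M[R]_(n, p)) :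
  measurable_mx A -> measurable_mx B -> measurable_mx (fun x => A x *m B x).
Proof.
move=> mA mB i j; under eq_fun do rewrite mxE.
by apply: measurable_sum => k; exact: measurable_funM.
Qed.

Lemma measurable_trmx m n (A : T -> 'M[R]_(m, n)) :
  measurable_mx A -> measurable_mx (fun x => (A x)^T).
Proof. by move=> mA i j; under eq_fun do rewrite mxE; exact: mA. Qed.

Lemma measurable_det n (A : T -> 'M[R]_n) :
  measurable_mx A -> measurable_fun setT (fun x => \det (A x)).
Proof.
move=> mA; rewrite /determinant; apply: measurable_sum => s.
apply: measurable_funM; first exact: measurable_cst.
exact: measurable_prod.
Qed.

Lemma measurable_invmx n (A : T -> 'M[R]_n) :
  measurable_mx A -> measurable_mx (fun x => invmx (A x)).
Proof.
move=> mA i j.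
(* On a singular matrix [invmx] returns its argument, hence the first branch. *)
have -> : (fun x => invmx (A x) i j) =
    (fun x => if \det (A x) == 0 then A x i j
              else (\det (A x))^-1 * (\adj (A x)) i j).
  apply/funext => x; rewrite /invmx unitmxE unitfE.
  by case: eqP => //= _; rewrite mxE.
apply: measurable_fun_ifT => //.
  by apply: measurable_fun_eqr; [exact: measurable_det|exact: measurable_cst].
apply: measurable_funM; first exact/measurable_invr/measurable_det.
under eq_fun do rewrite mxE /cofactor.
apply: measurable_funM; first exact: measurable_cst.
apply: measurable_det => k l; under eq_fun do rewrite !mxE; exact: mA.
Qed.

Lemma measurable_ols_residual n K (Z : T -> 'M[R]_(n, K)) (X : T -> 'cV[R]_n) :
  measurable_mx Z -> measurable_mx X ->
  measurable_mx (fun x => ols_residual (Z x) (X x)).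
Proof.
move=> mZ mX i j; under eq_fun do rewrite !mxE.
apply: measurable_funB => //; apply: measurable_sum => k; apply: measurable_funM => //.
apply: measurable_mulmx.
  by apply/measurable_invmx/measurable_mulmx => //; exact: measurable_trmx.
by apply: measurable_mulmx => //; exact: measurable_trmx.
Qed.

Lemma measurable_ols_coefficient n K (Z : T -> 'M[R]_(n, K)) (X Y : T -> 'cV[R]_n) :
  measurable_mx Z -> measurable_mx X -> measurable_mx Y ->
  measurable_fun setT (fun x => ols_coefficient (Z x) (X x) (Y x)).
Proof.
move=> mZ mX mY; have mr := measurable_ols_residual mZ mX.
apply: measurable_funM.
  by apply: measurable_mulmx => //; exact: measurable_trmx.
apply: measurable_invr; apply: measurable_mulmx => //; exact: measurable_trmx.
Qed.

Lemma measurable_mx_norm m n (A : T -> 'M[R]_(m, n)) : measurable_mx A ->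
  measurable_fun setT (fun x => `|A x|).
Proof.
move=> mA; rewrite /Num.norm/=; under eq_fun do rewrite mx_normrE.
by apply: measurable_bigmax => ij; exact: measurableT_comp.
Qed.

Lemma le_mx_norm m n (A : 'M[R]_(m, n)) i j : `|A i j| <= `|A|.
Proof.
rewrite [leRHS]/Num.norm/= mx_normrE.
exact: (le_bigmax 0 (fun ij : 'I_m * 'I_n => `|A ij.1 ij.2|) (i, j)).
Qed.

End MatrixMeasurability.

(** * Laws of large numbers for the triangular array *)

Section Asymptotics.
Context {d} {T : measurableType d} {R : realType} (P : probability T R).
Local Notation "''E' f" := (Rintegral P setT f) (at level 10, f at level 9).
Local Notation L1 f := (P.-integrable setT (EFin \o f)).
Variables (N : nat -> nat) (C : nat -> set (set T)).
Hypothesis Cmeasurable : forall S, C S `<=` measurable.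
Local Notation smeasurable S f :=
  (measurable_fun (T:=g_sigma_algebraType (C S)) setT f).
Local Notation sbounded S f :=
  (@bounded_mfun _ (g_sigma_algebraType (C S)) _ f).
Local Notation is_cexp S f g := (is_cond_expectation P <<s C S >> f g).
Variable w : forall S, 'I_(N S) -> 'I_S -> T -> R.
Hypothesis w_smeasurable : forall S i s, smeasurable S (@w S i s).
Hypothesis w_ge0 : forall S i s x, 0 <= @w S i s x.
Hypothesis w_sum_le1 : forall S i x, \sum_(s < S) @w S i s x <= 1.
Hypothesis sizes_small : forall dl, 0 < dl ->
  whp P (fun S x => forall s, \sum_(i < N S) @w S i s x <= dl * (N S)%:R).

Let w_sbounded S i s : sbounded S (@w S i s).
Proof.
split => //; exists 1 => x; rewrite ger0_norm//.
exact: (weight_le1 (fun i s => w_ge0 i s x) (fun i => w_sum_le1 i x)).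
Qed.

Let w_bounded S i s : bounded_mfun (@w S i s).
Proof. exact: (sbounded_bounded (@Cmeasurable S) (w_sbounded i s)). Qed.

Let w_le1 S i s x : @w S i s x <= 1.
Proof. exact: (weight_le1 (fun i s => w_ge0 i s x) (fun i => w_sum_le1 i x)). Qed.

(** Bounds proportional to the mean share of each sector add up without a factor [S], because the
    shares of region [i] sum to at most 1. *)
Let sum_expectation_le (S : nat) (i : 'I_(N S)) (B : R) (F : 'I_S -> R) : 0 <= B ->
  (forall s, F s <= B * 'E (@w S i s)) -> \sum_s F s <= B.
Proof.
move=> B0 FB; apply: (@le_trans _ _ (B * \sum_s 'E (@w S i s))).
  by rewrite mulr_sumr ler_sum.
rewrite ler_piMr// -expectation_sumR; last by move=> s _; exact/bounded_integrable.
rewrite -[leRHS](expectation_cstR P); apply: le_expectationR => //.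
- by apply/bounded_integrable/bounded_mfun_sum.
- exact/bounded_integrable/bounded_mfun_cst.
Qed.

(** Jensen in the weights [w i s] reduces to second moments weighted by a share; a conditional bound
    supplies these because a share is itself a test function of the conditioning sigma-algebra. *)
Lemma weighted_second_moment S (i : 'I_(N S)) (f : 'I_S -> T -> R) (B : R) :
  0 <= B -> (forall s, measurable_fun setT (f s)) ->
  (forall s, L1 (fun x => f s x ^+ 2)) ->
  (forall s, 'E (fun x => f s x ^+ 2 * w i s x) <= B * 'E (w i s)) ->
  L1 (fun x => (\sum_s w i s x * f s x) ^+ 2) /\
  'E (fun x => (\sum_s w i s x * f s x) ^+ 2) <= B.
Proof.
move=> B0 mf lf fB.
have lfw s : L1 (fun x => f s x ^+ 2 * w i s x) by exact: integrableMR.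
have lS : L1 (fun x => \sum_s f s x ^+ 2 * w i s x) by exact: integrable_sumR.
have le1 x : (\sum_s w i s x * f s x) ^+ 2 <= \sum_s f s x ^+ 2 * w i s x.
  under [leRHS]eq_bigr do rewrite mulrC.
  by apply: weighted_jensen.
have l2 : L1 (fun x => (\sum_s w i s x * f s x) ^+ 2).
  apply: le_integrableR _ _ lS => [|x]; last by rewrite ger0_norm ?sqr_ge0.
  apply: measurable_funX; apply: measurable_sum => s.
  by apply: measurable_funM => //; exact: (w_bounded i s).1.
split => //; apply: le_trans (le_expectationR l2 lS le1) _.
by rewrite expectation_sumR//; exact: sum_expectation_le.
Qed.

(** Carries the size bound on an event of the conditioning sigma-algebra: its indicator can multiply
    the coefficients of a form without spoiling their measurability. *)
Let size_event S dl := [set x | forall s, \sum_(i < N S) @w S i s x <= dl * (N S)%:R].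

Let size_event_sub S dl : <<s C S >> (size_event S dl).
Proof.
have -> : size_event S dl = \bigcap_(s in [set: 'I_S])
    [set x | \sum_(i < N S) @w S i s x <= dl * (N S)%:R].
  by apply/seteqP; split => x /= h s; [move=> _|]; exact: h.
apply: (@fin_bigcap_measurable _ (g_sigma_algebraType (C S))) => [|s _].
  exact: finite_finset.
apply: (@measurable_set_le _ (g_sigma_algebraType (C S)) R _ (fun=> _)) => //.
exact: measurable_sum.
Qed.

(** * Forms in truncated shocks, at a level that does not depend on [S] *)

Section TruncatedForms.
Variables (X m eT u : forall S, 'I_S -> T -> R) (M e' : R).
Hypothesis M0 : 0 <= M.
Hypothesis lX : forall S (s : 'I_S), L1 (X s).
Hypothesis tr : forall S, truncated P (C S) (@X S) (@m S) M e' (@eT S) (@u S).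

Let mX S (s : 'I_S) : measurable_fun setT (X s) := integrable_measurable (lX s).

Let eT_bounded S (s : 'I_S) : bounded_mfun (eT s).
Proof. exact: (cyl_fun_bounded (@Cmeasurable S) (@mX S) (truncated_cyl (tr S) s)). Qed.

(** On the event [D] the expression is a linear form in the [eT s] whose coefficients [c s] are
    bounded everywhere, and [linear_form_variance] bounds its second moment by
    [M ^+ 2 * dl * B']. *)
Lemma truncated_linear_op (h : forall S, 'I_(N S) -> T -> R) (B : R) : 0 <= B ->
  (forall S i, smeasurable S (h S i)) ->
  (forall S i, L1 (fun x => h S i x ^+ 2) /\ 'E (fun x => h S i x ^+ 2) <= B) ->
  op P (fun S x => (N S)%:R^-1 *
    \sum_(i < N S) (\sum_(s < S) w i s x * eT s x) * h S i x).
Proof.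
move=> B0 mh hB e e0 b b0.
have b3 : 0 < b / 3 by rewrite divr_gt0.
(* A third of [b] each for failure of the size bound, for an average of [h ^+ 2] above [B'], and for
   a large linear form. Markov's inequality dictates [B']; then [dl] makes [M ^+ 2 * dl * B'] at
   most [b / 3 * e ^+ 2]. *)
pose B' := (B + 1) / (b / 3); have B'0 : 0 < B' by rewrite divr_gt0// ltr_pwDr.
pose dl := b / 3 * e ^+ 2 / ((M ^+ 2 + 1) * B').
have M1 : 0 < M ^+ 2 + 1 by rewrite ltr_pwDr// sqr_ge0.
have dl0 : 0 < dl by rewrite divr_gt0// mulr_gt0// exprn_gt0.
near=> S.
pose mh2 x := (N S)%:R^-1 * \sum_(i < N S) h S i x ^+ 2.
pose D := size_event S dl `&` [set x | mh2 x <= B'].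
have mmh2 : smeasurable S mh2.
  apply: measurable_funM; first exact: measurable_cst.
  by apply: measurable_sum => i; exact: measurable_funX.
have sD : <<s C S >> D.
  apply: (@measurableI _ (g_sigma_algebraType (C S))); first exact: size_event_sub.
  by apply: (@measurable_set_le _ (g_sigma_algebraType (C S)) R _ (fun=> _)).
pose c (s : 'I_S) x := \1_D x * ((N S)%:R^-1 * \sum_(i < N S) w i s x * h S i x).
have c2 x : \sum_s c s x ^+ 2 <= dl * B'.
  rewrite /c indicE; case: (boolP (x \in D)) => [|_]; last first.
    rewrite big1; first exact: mulr_ge0 (ltW dl0) (ltW B'0).
    by move=> s _; rewrite mul0r expr0n.
  rewrite inE => -[xD hD]; under eq_bigr do rewrite mul1r.
  apply: le_trans (linear_coefficients_bound (fun i s => w_ge0 i s x)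
    (fun i => w_sum_le1 i x) (ltW dl0) xD (fun i => h S i x)) _.
  by rewrite ler_wpM2l// ltW.
have bc s : sbounded S (c s).
  split.
    apply: measurable_funM.
      exact: (bounded_mfun_indic (T := g_sigma_algebraType (C S)) sD).1.
    apply: measurable_funM; first exact: measurable_cst.
    by apply: measurable_sum => i; exact: measurable_funM.
  exists (dl * B' + 1) => x; have : c s x ^+ 2 <= dl * B'.
    rewrite (le_trans _ (c2 x))// (bigD1 s)//= lerDl.
    by apply: sumr_ge0 => *; exact: sqr_ge0.
  rewrite -real_normK ?num_real//; have := normr_ge0 (c s x); nra.
have bc' s := sbounded_bounded (@Cmeasurable S) (bc s).
have bce : bounded_mfun (fun x => \sum_s c s x * eT s x).
  by apply: bounded_mfun_sum => s; exact: bounded_mfunM.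
have Ece : 'E (fun x => (\sum_s c s x * eT s x) ^+ 2) <= b / 3 * e ^+ 2.
  apply: le_trans (linear_form_variance (@Cmeasurable S) (@mX S)
    (truncated_cyl (tr S)) (truncated_bound (tr S))
    (truncated_centered (tr S)) xpredT bc) _.
  apply: (@le_trans _ _ (M ^+ 2 * (dl * B'))).
    rewrite ler_wpM2l ?sqr_ge0// -[leRHS](expectation_cstR P).
    apply: le_expectationR => //.
      by apply/bounded_integrable/bounded_mfun_sum => s; exact: bounded_mfunX.
    exact/bounded_integrable/bounded_mfun_cst.
  have -> : dl * B' = b / 3 * e ^+ 2 / (M ^+ 2 + 1).
    by rewrite /dl; field; rewrite !gt_eqF.
  rewrite mulrA ler_pdivrMr// mulrC ler_wpM2l ?mulr_ge0 ?sqr_ge0 ?ltW//.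
  by rewrite ltrDl.
have b_split : b = b / 3 + (b / 3 + b / 3) by field.
rewrite [b]b_split; apply: (@outside_event_imply _ _ _ _ _ (fun x => size_event S dl x /\
   (`|mh2 x| < B' /\ `|(\sum_s c s x * eT s x) ^+ 2| < e ^+ 2))).
  move=> x [xD [/ltW hx cx]].
  have Dx : x \in D by rewrite inE; split => //=; exact: le_trans (ler_norm _) hx.
  have -> : (N S)%:R^-1 * \sum_(i < N S) (\sum_(s < S) w i s x * eT s x) * h S i x =
            \sum_s c s x * eT s x.
    rewrite /c indicE Dx; under eq_bigr do rewrite mulr_suml.
    rewrite exchange_big/= mulr_sumr; apply: eq_bigr => s _.
    by rewrite mul1r -mulrA mulr_suml; congr (_ * _); apply: eq_bigr => i _; ring.
  move: cx; rewrite ger0_norm ?sqr_ge0// -real_normK ?num_real// ltr_pXn2r//.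
  by rewrite nnegrE ltW.
apply: outside_event_and; first by near: S; exact: sizes_small.
apply: outside_event_and; apply: outside_event_markov => //.
- apply: (mean_integrable (f := fun i x => h S i x ^+ 2) B0 _).1 => i.
  have [l2 E2] := hB S i; split => //; rewrite (_ : 'E _ = 'E (fun x => h S i x ^+ 2))//.
  by congr Rintegral; apply/funext => x; rewrite ger0_norm ?sqr_ge0.
- rewrite /B' mulrC divfK ?gt_eqF//; apply: (@le_trans _ _ B); last by rewrite lerDl.
  apply: (mean_integrable (f := fun i x => h S i x ^+ 2) B0 _).2 => i.
  have [l2 E2] := hB S i; split => //; rewrite (_ : 'E _ = 'E (fun x => h S i x ^+ 2))//.
  by congr Rintegral; apply/funext => x; rewrite ger0_norm ?sqr_ge0.
- exact/bounded_integrable/bounded_mfunX.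
- exact: exprn_gt0.
- rewrite (_ : 'E _ = 'E (fun x => (\sum_s c s x * eT s x) ^+ 2))//.
  by congr Rintegral; apply/funext => x; rewrite ger0_norm ?sqr_ge0.
Unshelve. all: by end_near. Qed.

(** After exchange of sums the coefficient of [eT s * eT t] is the average over regions of
    [w i s * w i t * b i t]; on the size event the squares of these sum to at most [B ^+ 2 * dl]. *)
Lemma truncated_quadratic_op (b : forall S, 'I_(N S) -> 'I_S -> T -> R) (B : R) :
  (forall S i s, smeasurable S (b S i s)) -> (forall S i s x, `|b S i s x| <= B) ->
  op P (fun S x =>
    (N S)%:R^-1 * \sum_(i < N S)
      (\sum_(s < S) w i s x * eT s x) * (\sum_(s < S) w i s x * (b S i s x * eT s x)) -
    (N S)%:R^-1 * \sum_(i < N S) \sum_(s < S) w i s x ^+ 2 * u s x * b S i s x).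
Proof.
move=> mb bB e e0 a a0.
have a2 : 0 < a / 2 by rewrite divr_gt0.
(* The constants of [quadratic_form_variance] and [quadratic_coefficients_bound], with 1 added so
   that [L] is a positive divisor. *)
pose L := 18 * M ^+ 4 * (B ^+ 2) + 1.
have M4 : 0 <= M ^+ 4 by rewrite exprn_ge0.
have L0 : 0 < L by rewrite ltr_pwDr// mulr_ge0 ?sqr_ge0// mulr_ge0.
pose dl := a / 2 * e ^+ 2 / L.
have dl0 : 0 < dl by rewrite divr_gt0// mulr_gt0// exprn_gt0.
near=> S.
have sD := @size_event_sub S dl.
pose k (s t : 'I_S) x := \1_(size_event S dl) x *
  ((N S)%:R^-1 * \sum_(i < N S) w i s x * w i t x * b S i t x).
have k2 x : \sum_s \sum_t k s t x ^+ 2 <= B ^+ 2 * dl.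
  rewrite /k indicE; case: (boolP (x \in size_event S dl)) => [|_]; last first.
    rewrite big1; first exact: mulr_ge0 (sqr_ge0 B) (ltW dl0).
    move=> s _; by rewrite big1// => t _; rewrite mul0r expr0n.
  rewrite inE => xD; under eq_bigr do under eq_bigr do rewrite mul1r.
  exact: (quadratic_coefficients_bound (fun i s => w_ge0 i s x)
    (fun i => w_sum_le1 i x) (ltW dl0) xD (fun i s => bB S i s x)).
have bk s t : sbounded S (k s t).
  split.
    apply: measurable_funM.
      exact: (bounded_mfun_indic (T := g_sigma_algebraType (C S)) sD).1.
    apply: measurable_funM; first exact: measurable_cst.
    apply: measurable_sum => i; apply: measurable_funM => //.
    exact: measurable_funM.
  exists (B ^+ 2 * dl + 1) => x; have : k s t x ^+ 2 <= B ^+ 2 * dl.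
    rewrite (le_trans _ (k2 x))// (bigD1 s)//= (bigD1 t)//= -addrA lerDl.
    rewrite addr_ge0//; apply: sumr_ge0 => *; first exact: sqr_ge0.
    by apply: sumr_ge0 => *; exact: sqr_ge0.
  rewrite -real_normK ?num_real//; have := normr_ge0 (k s t x); nra.
have bk' s t := sbounded_bounded (@Cmeasurable S) (bk s t).
have bu' s := sbounded_bounded (@Cmeasurable S) (truncated_var_bounded (tr S) s).
pose q x := \sum_s \sum_t k s t x * (eT s x * eT t x) - \sum_s k s s x * u s x.
have bq : bounded_mfun q.
  apply: bounded_mfunB; apply: bounded_mfun_sum => s; last exact: bounded_mfunM.
  by apply: bounded_mfun_sum => t; apply: bounded_mfunM => //; exact: bounded_mfunM.
have Eq : 'E (fun x => q x ^+ 2) <= a / 2 * e ^+ 2.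
  apply: le_trans (quadratic_form_variance (@Cmeasurable S) (@mX S)
    (truncated_cyl (tr S)) (truncated_bound (tr S)) (truncated_centered (tr S))
    (truncated_var_bounded (tr S)) (truncated_var_bound (tr S))
    (truncated_var (tr S)) bk) _.
  apply: (@le_trans _ _ (18 * M ^+ 4 * (B ^+ 2 * dl))).
    rewrite ler_wpM2l ?mulr_ge0// -[leRHS](expectation_cstR P).
    apply: le_expectationR => //; last exact/bounded_integrable/bounded_mfun_cst.
    apply/bounded_integrable/bounded_mfun_sum => s; apply/bounded_mfun_sum => t.
    exact: bounded_mfunX.
  rewrite mulrA /dl mulrA ler_pdivrMr// mulrC ler_wpM2l ?mulr_ge0 ?sqr_ge0 ?ltW//.
  by rewrite ltrDl.
rewrite [a]splitr; apply: (@outside_event_imply _ _ _ _ _ (fun x => size_event S dl x /\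
    `|q x ^+ 2| < e ^+ 2)).
  move=> x [xD qx].
  have Dx : x \in size_event S dl by rewrite inE.
  rewrite [X in `|X|](_ : _ = q x); last first.
    rewrite /q /k indicE Dx; congr (_ - _).
      under eq_bigr do rewrite mulr_suml; rewrite exchange_big/= mulr_sumr.
      apply: eq_bigr => s _; under eq_bigr do rewrite mulr_sumr.
      rewrite exchange_big/= mulr_sumr; apply: eq_bigr => t _.
      rewrite mul1r -mulrA mulr_suml; congr (_ * _); apply: eq_bigr => i _; ring.
    rewrite exchange_big/= mulr_sumr; apply: eq_bigr => s _.
    rewrite mul1r -mulrA mulr_suml; congr (_ * _); apply: eq_bigr => i _; ring.
  move: qx; rewrite ger0_norm ?sqr_ge0// -real_normK ?num_real// ltr_pXn2r//.
  by rewrite nnegrE ltW.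
apply: outside_event_and; first by near: S; exact: sizes_small.
apply: outside_event_markov.
- exact/bounded_integrable/bounded_mfunX.
- exact: exprn_gt0.
- rewrite (_ : 'E _ = 'E (fun x => q x ^+ 2))//.
  by congr Rintegral; apply/funext => x; rewrite ger0_norm ?sqr_ge0.
Unshelve. all: by end_near. Qed.

End TruncatedForms.

(** * Removal of the truncation *)

Section FullForms.
Variables (X m v : forall S, 'I_S -> T -> R) (nu K : R).
Hypothesis nu0 : 0 < nu.
Hypothesis K0 : 0 <= K.
Hypothesis lX : forall S (s : 'I_S), L1 (X s).
Hypothesis indep : forall S, cond_independent P <<s C S >> (@X S).
Hypothesis m_sbounded : forall S (s : 'I_S), sbounded S (m s).
Hypothesis m_mean : forall S (s : 'I_S), is_cexp S (X s) (m s).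
Hypothesis v_variance : forall S (s : 'I_S),
  is_cexp S (fun x => (X s x - m s x) ^+ 2) (v s).
Hypothesis X_moment : forall S (s : 'I_S),
  cond_expectation_le P <<s C S >> (fun x => `|X s x| `^ (2 + nu)) K.

Let mX S (s : 'I_S) : measurable_fun setT (X s) := integrable_measurable (lX s).

Lemma truncation_family (e : R) : 0 < e ->
  exists M (eT u : forall S, 'I_S -> T -> R), 0 <= M /\
    forall S, truncated P (C S) (@X S) (@m S) M e (eT S) (u S).
Proof.
move=> e0; have [M M0 tr] := exists_truncated P nu0 K0 e0.
have trS S : {p : ('I_S -> T -> R) * ('I_S -> T -> R) |
    truncated P (C S) (@X S) (@m S) M e p.1 p.2}.
  apply: cid; have [//|//|//|//|//|//|eT [u tr']] := tr (C S) S (@X S) (@m S).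
  by exists (eT, u).
exists M, (fun S => (sval (trS S)).1), (fun S => (sval (trS S)).2).
by split => // S; exact: (svalP (trS S)).
Qed.

Let measurable_residual S (s : 'I_S) : measurable_fun setT (fun x => X s x - m s x).
Proof.
apply: measurable_funB => //.
exact: (sbounded_bounded (@Cmeasurable S) (m_sbounded s)).1.
Qed.

Let integrable_residual2 S (s : 'I_S) : L1 (fun x => (X s x - m s x) ^+ 2).
Proof.
exact: (residual_integrable_sqr (@Cmeasurable S) (@lX S) nu0 (@m_sbounded S) (@X_moment S)).
Qed.

Let residual2 S (s : 'I_S) c : sbounded S c -> (forall x, 0 <= c x) ->
  'E (fun x => (X s x - m s x) ^+ 2 * c x) <= (1 + K) * 'E c.
Proof.
exact: (residual_second_moment (@Cmeasurable S) (@lX S) nu0 (@m_sbounded S)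
  (@m_mean S) (@X_moment S)).
Qed.

Let measurable_wsum S (i : 'I_(N S)) (f : 'I_S -> T -> R) :
  (forall s, measurable_fun setT (f s)) ->
  measurable_fun setT (fun x => \sum_(s < S) w i s x * f s x).
Proof.
move=> mf; apply: measurable_sum => s; apply: measurable_funM => //.
exact: (w_bounded i s).1.
Qed.

Lemma linear_form_op (h : forall S, 'I_(N S) -> T -> R) (B : R) : 0 <= B ->
  (forall S i, smeasurable S (h S i)) ->
  (forall S i, L1 (fun x => h S i x ^+ 2) /\ 'E (fun x => h S i x ^+ 2) <= B) ->
  op P (fun S x => (N S)%:R^-1 *
    \sum_(i < N S) (\sum_(s < S) w i s x * (X s x - m s x)) * h S i x).
Proof.
move=> B0 mh hB; apply: op_approx => t t0.
have B1 : 0 < 2 * (B + 1) by rewrite mulr_gt0// ltr_pwDr.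
(* With these choices the two terms of [expectation_product_le] are at most [eta^-1 * e = t / 2] and
   [eta * B <= t / 2]. *)
pose eta := t / (2 * (B + 1)); have eta0 : 0 < eta by rewrite divr_gt0.
pose e := eta * (t / 2); have e0 : 0 < e by rewrite mulr_gt0// divr_gt0.
have [M [eT [u [M0 tr]]]] := truncation_family e0.
exists (fun S x => (N S)%:R^-1 *
    \sum_(i < N S) (\sum_(s < S) w i s x * eT S s x) * h S i x).
exists (fun S x => (N S)%:R^-1 *
    \sum_(i < N S) (\sum_(s < S) w i s x * (X s x - m s x - eT S s x)) * h S i x).
split; first exact: (truncated_linear_op lX tr B0 mh hB).
- move=> S x; rewrite -mulrDr -big_split/=; congr (_ * _); apply: eq_bigr => i _.
  by rewrite -mulrDl -big_split/=; congr (_ * _); apply: eq_bigr => s _ /=; ring.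
near=> S; apply: mean_integrable => [|i]; first exact: ltW.
have mrho (s : 'I_S) : measurable_fun setT (fun x => X s x - m s x - eT S s x).
  apply: measurable_funB => //.
  exact: (cyl_fun_bounded (@Cmeasurable S) (@mX S) (truncated_cyl (tr S) s)).1.
have [lR ER] := weighted_second_moment (i := i) (ltW e0) mrho (truncated_integrable (tr S))
  (fun s => truncated_near (tr S) s (w_sbounded i s) (w_ge0 i s)).
have [lh Eh] := hB S i.
have mR := measurable_wsum i mrho.
have mh' := smeasurable_measurable (@Cmeasurable S) (mh S i).
split; first exact: integrable_product.
apply: le_trans (expectation_product_le eta0 mR mh' lR lh) _.
apply: (@le_trans _ _ (eta^-1 * e + eta * B)).
  by apply: lerD; rewrite ler_wpM2l ?invr_ge0// ltW.
rewrite /e mulKf ?gt_eqF// /eta -lerBrDl [leRHS](_ : _ = t / 2); last by field.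
by rewrite mulrAC ler_pdivrMr//; nra.
Unshelve. all: by end_near. Qed.

(** [b ^+ 2 * w] is again an admissible test function, so the conditional bound [D] is applied first
    and [b] is estimated by [B] afterwards. *)
Lemma weighted_scaled_second_moment S (i : 'I_(N S)) (b f : 'I_S -> T -> R) (B D : R) :
  0 <= D -> (forall s, smeasurable S (b s)) -> (forall s x, `|b s x| <= B) ->
  (forall s, measurable_fun setT (f s)) ->
  (forall s, L1 (fun x => f s x ^+ 2)) ->
  (forall s c, sbounded S c -> (forall x, 0 <= c x) ->
    'E (fun x => f s x ^+ 2 * c x) <= D * 'E c) ->
  L1 (fun x => (\sum_s w i s x * (b s x * f s x)) ^+ 2) /\
  'E (fun x => (\sum_s w i s x * (b s x * f s x)) ^+ 2) <= B ^+ 2 * D.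
Proof.
move=> D0 mb bB mf lf fD.
have bb s : sbounded S (b s) by split => //; exists B.
have bb' s := sbounded_bounded (@Cmeasurable S) (bb s).
have b2 s x : b s x ^+ 2 <= B ^+ 2.
  by rewrite -real_normK ?num_real// lerXn2r ?nnegrE// (le_trans _ (bB s x)).
apply: weighted_second_moment.
- by rewrite mulr_ge0 ?sqr_ge0.
- by move=> s; apply: measurable_funM => //; exact: (bb' s).1.
- move=> s; under eq_fun do rewrite exprMn mulrC.
  by apply: integrableMR => //; exact: bounded_mfunX.
move=> s; apply: (@le_trans _ _ (D * 'E (fun x => b s x ^+ 2 * w i s x))).
  under [X in 'E X]eq_fun do rewrite exprMn mulrAC mulrC.
  apply: fD; first by apply: bounded_mfunM => //; exact: bounded_mfunX.
  by move=> x; rewrite mulr_ge0 ?sqr_ge0.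
rewrite -mulrA mulrCA ler_wpM2l// -expectationZR; last exact: bounded_integrable.
apply: le_expectationR.
- by apply/bounded_integrable/bounded_mfunM => //; exact: bounded_mfunX.
- exact/integrableZR/bounded_integrable.
- by move=> x; rewrite ler_wpM2r.
Qed.

Let norm_expectationD (f g : T -> R) : L1 f -> L1 g ->
  'E (fun x => `|f x + g x|) <= 'E (fun x => `|f x|) + 'E (fun x => `|g x|).
Proof.
move=> lf lg; rewrite -expectationDR; [|exact: integrable_normR|exact: integrable_normR].
apply: le_expectationR.
- exact/integrable_normR/integrableDR.
- by apply: integrableDR; exact: integrable_normR.
- by move=> x; exact: ler_normD.
Qed.

Let norm_expectationN (f : T -> R) : 'E (fun x => `|- f x|) = 'E (fun x => `|f x|).
Proof. by congr Rintegral; apply/funext => x; rewrite normrN. Qed.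

Lemma variance_gap_expectation S (i : 'I_(N S)) (u b : 'I_S -> T -> R) (B D : R) :
  0 <= B -> 0 <= D ->
  (forall s, L1 (u s)) -> (forall s, smeasurable S (b s)) ->
  (forall s x, `|b s x| <= B) ->
  (forall s, 'E (fun x => `|u s x| * w i s x) <= D * 'E (w i s)) ->
  L1 (fun x => \sum_s w i s x ^+ 2 * u s x * b s x) /\
  'E (fun x => `|\sum_s w i s x ^+ 2 * u s x * b s x|) <= B * D.
Proof.
move=> B0 D0 lu mb bB uD.
have bb s : bounded_mfun (b s).
  by apply: (sbounded_bounded (@Cmeasurable S)); split => //; exists B.
have lt s : L1 (fun x => w i s x ^+ 2 * u s x * b s x).
  apply: integrableMR => //; under eq_fun do rewrite mulrC.
  by apply: integrableMR => //; exact: bounded_mfunX.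
have lS : L1 (fun x => \sum_s w i s x ^+ 2 * u s x * b s x) by exact: integrable_sumR.
have luw s : L1 (fun x => `|u s x| * w i s x).
  by apply: integrableMR => //; exact: integrable_normR.
split => //; apply: (@le_trans _ _ ('E (fun x => \sum_s B * (`|u s x| * w i s x)))).
  apply: le_expectationR; first exact: integrable_normR.
    by apply: integrable_sumR => s _; exact: integrableZR.
  move=> x; rewrite (le_trans (ler_norm_sum _ _ _))// ler_sum// => s _.
  rewrite normrM [X in X * _]normrM normrX (ger0_norm (w_ge0 i s x)) mulrC.
  rewrite ler_pM// ?mulr_ge0 ?sqr_ge0// mulrC ler_wpM2l// expr2.
  by rewrite ler_piMr.
rewrite expectation_sumR; last by move=> s _; exact: integrableZR.
under eq_bigr do rewrite expectationZR//.
by rewrite -mulr_sumr ler_wpM2l//; exact: sum_expectation_le.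
Qed.

Lemma quadratic_form_op (b : forall S, 'I_(N S) -> 'I_S -> T -> R) (B : R) : 0 <= B ->
  (forall S i s, smeasurable S (b S i s)) -> (forall S i s x, `|b S i s x| <= B) ->
  op P (fun S x =>
    (N S)%:R^-1 * \sum_(i < N S) (\sum_(s < S) w i s x * (X s x - m s x)) *
      (\sum_(s < S) w i s x * (b S i s x * (X s x - m s x))) -
    (N S)%:R^-1 * \sum_(i < N S) \sum_(s < S) w i s x ^+ 2 * v s x * b S i s x).
Proof.
move=> B0 mb bB; apply: op_approx => t t0.
have K1 : 0 <= 1 + K by rewrite addr_ge0.
(* With [e = eta ^+ 2] and [eta <= 1], every error is at most [eta] times a constant; [L] adds up
   these constants over the four terms of the remainder. *)
pose L := 2 + B ^+ 2 * (1 + K) + 2 * B ^+ 2 + (1 + K) + B * (2 + (1 + K)).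
have L0 : 0 < L.
  by rewrite /L !ltr_wpDr ?mulr_ge0 ?sqr_ge0// addr_ge0.
pose eta := Num.min 1 (t / L).
have eta0 : 0 < eta by rewrite lt_min ltr01 divr_gt0.
have eta1 : eta <= 1 by rewrite ge_min lexx.
have etaL : eta * L <= t by rewrite -ler_pdivlMr// ge_min lexx orbT.
pose e := eta ^+ 2; have e0 : 0 < e by rewrite exprn_gt0.
have [M [eT [u [M0 tr]]]] := truncation_family e0.
exists (fun S x => (N S)%:R^-1 * \sum_(i < N S)
      (\sum_(s < S) w i s x * eT S s x) * (\sum_(s < S) w i s x * (b S i s x * eT S s x)) -
    (N S)%:R^-1 * \sum_(i < N S) \sum_(s < S) w i s x ^+ 2 * u S s x * b S i s x).
pose rho S (s : 'I_S) x := X s x - m s x - eT S s x.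
pose A S (i : 'I_(N S)) x := \sum_(s < S) w i s x * (X s x - m s x).
pose F S (i : 'I_(N S)) x := \sum_(s < S) w i s x * (b S i s x * (X s x - m s x)).
pose Q S (i : 'I_(N S)) x := \sum_(s < S) w i s x * rho S s x.
pose G S (i : 'I_(N S)) x := \sum_(s < S) w i s x * (b S i s x * rho S s x).
pose V S (i : 'I_(N S)) x := \sum_(s < S) w i s x ^+ 2 * (v s x - u S s x) * b S i s x.
(* The truncated factors are [A - Q] and [F - G], and [A * F - (A - Q) * (F - G) = Q * F + G * A - Q
   * G]; the term [V] changes the centring from [u] to [v]. *)
exists (fun S x => (N S)%:R^-1 * \sum_(i < N S)
   (Q S i x * F S i x + G S i x * A S i x + - (Q S i x * G S i x) + - V S i x)).
split; first exact: (truncated_quadratic_op M0 lX tr mb bB).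
- move=> S x; rewrite -!mulrBr -mulrDr -!sumrB -big_split; congr (_ * _).
  apply: eq_bigr => i _ /=.
  have -> : \sum_(s < S) w i s x * eT S s x = A S i x - Q S i x.
    by rewrite -sumrB; apply: eq_bigr => s _; rewrite /rho; ring.
  have -> : \sum_(s < S) w i s x * (b S i s x * eT S s x) = F S i x - G S i x.
    by rewrite -sumrB; apply: eq_bigr => s _; rewrite /rho; ring.
  have -> : \sum_(s < S) w i s x ^+ 2 * u S s x * b S i s x =
      \sum_(s < S) w i s x ^+ 2 * v s x * b S i s x - V S i x.
    by rewrite -sumrB; apply: eq_bigr => s _; ring.
  rewrite -/(A S i x) -/(F S i x); ring.
near=> S; apply: mean_integrable => [|i]; first exact: ltW.
have beT (s : 'I_S) := cyl_fun_bounded (@Cmeasurable S) (@mX S) (truncated_cyl (tr S) s).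
have bu (s : 'I_S) := sbounded_bounded (@Cmeasurable S) (truncated_var_bounded (tr S) s).
have mrho (s : 'I_S) : measurable_fun setT (rho S s).
  by apply: measurable_funB => //; exact: (beT s).1.
have bb' s := smeasurable_measurable (@Cmeasurable S) (mb S i s).
have [lQ EQ] := weighted_second_moment (i := i) (ltW e0) mrho (truncated_integrable (tr S))
  (fun s => truncated_near (tr S) s (w_sbounded i s) (w_ge0 i s)).
have [lG EG] := weighted_scaled_second_moment i (ltW e0) (mb S i) (bB S i) mrho
  (truncated_integrable (tr S)) (truncated_near (tr S)).
have [lA EA] := weighted_second_moment (i := i) K1 (@measurable_residual S)
  (@integrable_residual2 S) (fun s => residual2 s (w_sbounded i s) (w_ge0 i s)).
have [lF EF] := weighted_scaled_second_moment i K1 (mb S i) (bB S i)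
  (@measurable_residual S) (@integrable_residual2 S) (@residual2 S).
have lvu (s : 'I_S) : L1 (fun x => v s x - u S s x).
  have [_ _ lv _] := v_variance s.
  by apply: integrableBR => //; exact: bounded_integrable.
pose D := e + e / eta + eta * (1 + K).
have D0 : 0 <= D.
  rewrite addr_ge0 ?(mulr_ge0 (ltW eta0) K1)// addr_ge0 ?(ltW e0)//.
  by rewrite divr_ge0 ?(ltW e0)// ltW.
have [lV EV] := variance_gap_expectation (i := i) B0 D0 lvu (mb S i) (bB S i)
  (fun s => truncated_variance_gap (@Cmeasurable S) (@lX S) nu0 (@m_sbounded S)
    (@m_mean S) (@v_variance S) (@X_moment S) eta0 (beT s)
    (truncated_var_bounded (tr S) s)
    (fun h bh => truncated_var (tr S) (cyl_fun_sbounded _ _ bh))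
    (truncated_integrable (tr S) s) (w_sbounded i s) (w_ge0 i s)
    (truncated_near (tr S) s (w_sbounded i s) (w_ge0 i s))).
have mA : measurable_fun setT (A S i).
  by apply: measurable_wsum => s; exact: measurable_residual.
have mF : measurable_fun setT (F S i).
  by apply: measurable_wsum => s; apply: measurable_funM => //; exact: measurable_residual.
have mQ : measurable_fun setT (Q S i) by apply: measurable_wsum.
have mG : measurable_fun setT (G S i).
  by apply: measurable_wsum => s; apply: measurable_funM.
have lQF := integrable_product mQ mF lQ lF.
have lGA := integrable_product mG mA lG lA.
have lQG := integrable_product mQ mG lQ lG.
have E1 := expectation_product_le eta0 mQ mF lQ lF.
have E2 := expectation_product_le eta0 mG mA lG lA.
have E3 := expectation_product_le eta0 mQ mG lQ lG.
have l12 := integrableDR lQF lGA.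
have l123 := integrableDR l12 (integrableNR lQG).
split; first exact: integrableDR l123 (integrableNR lV).
apply: le_trans (norm_expectationD l123 (integrableNR lV)) _.
have N3 := norm_expectationD l12 (integrableNR lQG).
have N2 := norm_expectationD lQF lGA.
rewrite norm_expectationN; rewrite norm_expectationN in N3.
have ei : eta^-1 * e = eta by rewrite /e expr2 mulKf// gt_eqF.
have ei' : e / eta = eta by rewrite mulrC.
have ee : e <= eta by rewrite /e expr2 ler_piMr// ltW.
have ieta : 0 <= eta^-1 by rewrite invr_ge0 ltW.
have {}E1 : 'E (fun x => `|Q S i x * F S i x|) <= eta + eta * (B ^+ 2 * (1 + K)).
  by apply: le_trans E1 _; rewrite -[X in _ <= X + _]ei; apply: lerD; rewrite ler_wpM2l// ltW.
have {}E2 : 'E (fun x => `|G S i x * A S i x|) <= B ^+ 2 * eta + eta * (1 + K).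
  by apply: le_trans E2 _; rewrite -[X in _ <= _ * X + _]ei mulrCA; apply: lerD;
     rewrite ler_wpM2l// ltW.
have {}E3 : 'E (fun x => `|Q S i x * G S i x|) <= eta + eta * B ^+ 2.
  apply: le_trans E3 _; rewrite -[X in _ <= X + _]ei; apply: lerD; first by rewrite ler_wpM2l.
  rewrite ler_wpM2l ?(ltW eta0)//.
  by rewrite (le_trans EG)// ler_piMr ?sqr_ge0// (le_trans ee).
have {}EV : 'E (fun x => `|V S i x|) <= B * (eta * (2 + (1 + K))).
  apply: le_trans EV _; rewrite ler_wpM2l// /D ei'.
  by rewrite [leRHS](_ : _ = eta + eta + eta * (1 + K)); [rewrite !lerD|ring].
apply: le_trans etaL; rewrite /L; apply: le_trans (lerD N3 EV) _.
move: N2 E1 E2 E3; lra.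
Unshelve. all: by end_near. Qed.

(** * Projection on the controls and the effect of [r] *)

Section RegressionForms.
Variables (L : nat) (Z : forall S, T -> 'M[R]_(N S, L)) (Q : 'M[R]_L).
Variables (r : forall S, 'I_(N S) -> T -> R) (BZ Bm : R).
Hypothesis N_neq0 : whp P (fun S _ => (N S)%:R != 0 :> R).
Hypothesis Z_smeasurable : forall S i k, smeasurable S (fun x => Z S x i k).
Hypothesis BZ0 : 0 <= BZ.
Hypothesis Z_moment : forall S i k, L1 (fun x => Z S x i k ^+ 2) /\
  'E (fun x => Z S x i k ^+ 2) <= BZ.
Hypothesis Q_det : \det Q != 0.
Hypothesis Z_limit : forall k l,
  op P (fun S x => ((N S)%:R^-1 *: ((Z S x)^T *m Z S x)) k l - Q k l).
Hypothesis r_measurable : forall S i, measurable_fun setT (@r S i).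
Hypothesis r_integrable : forall S i, L1 (fun x => @r S i x ^+ 2).
Hypothesis r_small : forall e : R, 0 < e -> \forall S \near \oo,
  (N S)%:R^-1 * \sum_(i < N S) 'E (fun x => @r S i x ^+ 2) <= e.
Hypothesis Bm0 : 0 <= Bm.
Hypothesis m_bound : forall S (s : 'I_S) x, `|m s x| <= Bm.

(** The mean square of [r], averaged over regions, vanishes, so a product with anything bounded in
    mean square vanishes in mean. As [h] ranges over all measurable functions, outcomes that contain
    the shocks are covered. *)
Lemma small_product_op (h : forall S, 'I_(N S) -> T -> R) (B : R) : 0 <= B ->
  (forall S i, measurable_fun setT (h S i)) ->
  (forall S i, L1 (fun x => h S i x ^+ 2) /\ 'E (fun x => h S i x ^+ 2) <= B) ->
  op P (fun S x => (N S)%:R^-1 * \sum_(i < N S) r i x * h S i x).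
Proof.
move=> B0 mh hB; apply: op_L1 => e e0.
have B1 : 0 < B + 1 by rewrite ltr_pwDr.
pose eta := e / (2 * (B + 1)).
have eta0 : 0 < eta by rewrite divr_gt0// mulr_gt0.
have e1 : 0 < eta * (e / 2) by rewrite mulr_gt0// divr_gt0.
near=> S.
have rS : (N S)%:R^-1 * \sum_(i < N S) 'E (fun x => @r S i x ^+ 2) <= eta * (e / 2).
  by near: S; exact: r_small.
have lrh i : L1 (fun x => r i x * h S i x).
  by apply: integrable_product => //; have [] := hB S i.
have ls : L1 (fun x => \sum_(i < N S) r i x * h S i x) by exact: integrable_sumR.
split; first exact: integrableZR.
apply: (@le_trans _ _ ((N S)%:R^-1 * \sum_(i < N S) 'E (fun x => `|r i x * h S i x|))).
  rewrite -expectation_sumR; last by move=> i _; exact: integrable_normR.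
  have lsn : L1 (fun x => \sum_(i < N S) `|r i x * h S i x|).
    by apply: integrable_sumR => i _; exact: integrable_normR.
  rewrite -expectationZR//; apply: le_expectationR.
  - exact/integrable_normR/integrableZR.
  - exact: integrableZR.
  move=> x; rewrite normrM ger0_norm ?invr_ge0// ler_wpM2l ?invr_ge0//.
  exact: ler_norm_sum.
apply: (@le_trans _ _ ((N S)%:R^-1 * \sum_(i < N S)
    (eta^-1 * 'E (fun x => r i x ^+ 2) + eta * B))).
  rewrite ler_wpM2l ?invr_ge0// ler_sum// => i _.
  have [lh Eh] := hB S i.
  apply: le_trans (expectation_product_le eta0 (r_measurable i) (mh S i)
    (r_integrable i) lh) _.
  by rewrite lerD2l ler_wpM2l// ltW.
rewrite big_split/= -mulr_sumr mulrDr mulrCA [e]splitr; apply: lerD.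
  apply: (@le_trans _ _ (eta^-1 * (eta * (e / 2)))); last by rewrite mulKf// gt_eqF.
  by rewrite ler_wpM2l// invr_ge0 ltW.
apply: (@le_trans _ _ (eta * B)).
  by apply: mean_le => //; rewrite mulr_ge0// ltW.
have -> : e / 2 = eta * (B + 1) by rewrite /eta; field; rewrite gt_eqF.
by rewrite ler_pM2l// lerDl.
Unshelve. all: by end_near. Qed.

Variables (y : forall S, 'I_(N S) -> T -> R) (b : forall S, 'I_(N S) -> 'I_S -> T -> R).
Variables (By B : R).
Hypothesis By0 : 0 <= By.
Hypothesis B0 : 0 <= B.
Hypothesis y_smeasurable : forall S i, smeasurable S (@y S i).
Hypothesis y_moment : forall S i, L1 (fun x => @y S i x ^+ 2) /\
  'E (fun x => @y S i x ^+ 2) <= By.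
Hypothesis b_smeasurable : forall S i s, smeasurable S (@b S i s).
Hypothesis b_bound : forall S i s x, `|@b S i s x| <= B.

(** [A] is the weighted residual shock and [O] the outcome, split as [H + F] with [H] measurable for
    the conditioning sigma-algebra: [A * H] falls under the linear law and [A * F] under the
    quadratic one. *)
Let A S (i : 'I_(N S)) x := \sum_(s < S) w i s x * (X s x - m s x).
Let H S (i : 'I_(N S)) x := y i x + \sum_(s < S) w i s x * (b i s x * m s x).
Let F S (i : 'I_(N S)) x := \sum_(s < S) w i s x * (b i s x * (X s x - m s x)).
Let O S (i : 'I_(N S)) x := y i x + \sum_(s < S) w i s x * (b i s x * X s x).

Let H_smeasurable S i : smeasurable S (@H S i).
Proof.
apply: measurable_funD; first exact: y_smeasurable.
apply: measurable_sum => s; apply: measurable_funM; first exact: w_smeasurable.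
apply: measurable_funM; first exact: b_smeasurable.
exact: (m_sbounded s).1.
Qed.

Let H_moment S i : L1 (fun x => @H S i x ^+ 2) /\
  'E (fun x => @H S i x ^+ 2) <= 2 * By + 2 * (B * Bm) ^+ 2.
Proof.
pose f x := \sum_(s < S) w i s x * (b i s x * m s x).
have mf : smeasurable S f.
  apply: measurable_sum => s; apply: measurable_funM; first exact: w_smeasurable.
  by apply: measurable_funM; [exact: b_smeasurable|exact: (m_sbounded s).1].
have fB x : `|f x| <= B * Bm.
  rewrite (le_trans (ler_norm_sum _ _ _))//.
  apply: (@le_trans _ _ (\sum_(s < S) w i s x * (B * Bm))).
    apply: ler_sum => s _; rewrite normrM ger0_norm// ler_wpM2l//.
    by rewrite normrM ler_pM.
  by rewrite -mulr_suml ler_piMl ?mulr_ge0.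
have bf : bounded_mfun f.
  by apply: (sbounded_bounded (@Cmeasurable S)); split => //; exists (B * Bm).
have lf : L1 (fun x => f x ^+ 2) by exact/bounded_integrable/bounded_mfunX.
have Ef : 'E (fun x => f x ^+ 2) <= (B * Bm) ^+ 2.
  rewrite -[leRHS](expectation_cstR P); apply: le_expectationR => //.
    exact/bounded_integrable/bounded_mfun_cst.
  move=> x; rewrite -real_normK ?num_real// lerXn2r ?nnegrE//.
  by rewrite mulr_ge0.
exact: (second_momentD (smeasurable_measurable (@Cmeasurable S) (@y_smeasurable S i))
  bf.1 (y_moment i) (conj lf Ef)).
Qed.

Let OE S i x : @O S i x = @H S i x + @F S i x.
Proof.
rewrite /O /H /F -addrA -big_split/=; congr (_ + _).
by apply: eq_bigr => s _; ring.
Qed.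

Let F_measurable S i : measurable_fun setT (@F S i).
Proof.
apply: measurable_wsum => s; apply: measurable_funM => //.
exact: (smeasurable_measurable (@Cmeasurable S)).
Qed.

Let O_measurable S i : measurable_fun setT (@O S i).
Proof.
rewrite (_ : @O S i = (fun x => H i x + F i x)); last exact/funext/OE.
apply: measurable_funD => //.
exact: (smeasurable_measurable (@Cmeasurable S)).
Qed.

Let BO := 2 * (2 * By + 2 * (B * Bm) ^+ 2) + 2 * (B ^+ 2 * (1 + K)).

Let K1 : 0 <= 1 + K. Proof. by rewrite addr_ge0. Qed.

Let BO0 : 0 <= BO.
Proof. by rewrite addr_ge0 ?mulr_ge0 ?addr_ge0 ?mulr_ge0 ?sqr_ge0. Qed.

Let O_moment S i : L1 (fun x => @O S i x ^+ 2) /\ 'E (fun x => @O S i x ^+ 2) <= BO.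
Proof.
have := second_momentD (smeasurable_measurable (@Cmeasurable S) (@H_smeasurable S i))
  (@F_measurable S i) (H_moment i) (weighted_scaled_second_moment i K1
    (@b_smeasurable S i) (@b_bound S i)
    (@measurable_residual S) (@integrable_residual2 S) (@residual2 S)).
by under eq_fun do rewrite -/(F i _) -OE.
Qed.

Let AO_op : op P (fun S x => (N S)%:R^-1 * \sum_(i < N S) A i x * O i x -
  (N S)%:R^-1 * \sum_(i < N S) \sum_(s < S) w i s x ^+ 2 * v s x * b i s x).
Proof.
have BH0 : 0 <= 2 * By + 2 * (B * Bm) ^+ 2 by rewrite addr_ge0 ?mulr_ge0 ?sqr_ge0.
apply: op_eq (opD (linear_form_op BH0 H_smeasurable H_moment)
  (quadratic_form_op B0 b_smeasurable b_bound)) _ => S x.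
rewrite addrA -mulrDr -big_split/=; congr (_ * _ - _).
by apply: eq_bigr => i _; rewrite -mulrDr -OE.
Qed.

Let rO_op : op P (fun S x => (N S)%:R^-1 * \sum_(i < N S) r i x * O i x).
Proof. exact: small_product_op BO0 O_measurable O_moment. Qed.

Let Z_measurable S i k : measurable_fun setT (fun x => Z S x i k).
Proof. exact: (smeasurable_measurable (@Cmeasurable S)). Qed.

(** The projection term is a sum over the fixed number [L * L] of index pairs. Each summand contains
    an average of [(A - r) * Z], which vanishes, times an entry of the inverse Gram matrix and an
    average of [Z * O], both bounded in probability. *)
Lemma residual_form_op : op P (fun S x =>
  (N S)%:R^-1 * ((ols_residual (Z S x)
     (\col_i (\sum_(s < S) w i s x * (X s x - m s x) - r i x)))^T *m
     \col_i (y i x + \sum_(s < S) w i s x * (b i s x * X s x))) ord0 ord0 -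
  (N S)%:R^-1 * \sum_(i < N S) \sum_(s < S) w i s x ^+ 2 * v s x * b i s x).
Proof.
have aZ k : op P (fun S x => (N S)%:R^-1 * \sum_(i < N S) (A i x - r i x) * Z S x i k).
  have o1 := linear_form_op BZ0 (fun S i => @Z_smeasurable S i k)
    (fun S i => Z_moment i k).
  have o2 := small_product_op BZ0 (fun S i => @Z_measurable S i k)
    (fun S i => Z_moment i k).
  apply: op_eq (opB o1 o2) _ => S x.
  rewrite -mulrBr -sumrB; congr (_ * _); apply: eq_bigr => i _; by rewrite mulrBl.
have ZO l : Op P (fun S x => (N S)%:R^-1 * \sum_(i < N S) Z S x i l * O i x).
  apply: (@Op_L1 _ _ _ _ _ (BZ + BO)); near=> S.
  apply: mean_integrable => [|i]; first exact: addr_ge0.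
  have [lZ EZ] := Z_moment i l; have [lO EO] := O_moment i.
  split.
    exact: (integrable_product (@Z_measurable S i l) (@O_measurable S i) lZ lO).
  apply: le_trans (expectation_product_le ltr01 (@Z_measurable S i l)
    (@O_measurable S i) lZ lO) _.
  by rewrite invr1 !mul1r lerD.
have o3 : op P (fun S x => \sum_(k < L) \sum_(l < L)
   ((N S)%:R^-1 * \sum_(i < N S) (A i x - r i x) * Z S x i k) *
   (invmx ((N S)%:R^-1 *: ((Z S x)^T *m Z S x)) l k *
   ((N S)%:R^-1 * \sum_(i < N S) Z S x i l * O i x))).
  apply: op_sum => k _; apply: op_sum => l _; apply: opM => //.
  by apply: OpM => //; exact: Op_invmx Q_det Z_limit.
apply: op_whp_eq (opB (opB AO_op rO_op) o3) _.
apply: whp_imply (whp_and N_neq0 (whp_neq0 Q_det (op_det Z_limit))) => S x [N0 dZ].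
have ZZ : (Z S x)^T *m Z S x \in unitmx.
  by rewrite -(@unitmxZ _ _ (N S)%:R^-1) ?unitfE ?invr_eq0// unitmxE unitfE.
rewrite ols_residual_formE//.
rewrite [X in X - _ - _](_ : _ = (N S)%:R^-1 * \sum_(i < N S) A i x * O i x -
    (N S)%:R^-1 * \sum_(i < N S) r i x * O i x); last first.
  rewrite -mulrBr -sumrB; congr (_ * _); apply: eq_bigr => i _.
  by rewrite !mxE mulrBl.
rewrite [X in _ - X - _ = _](_ : _ = \sum_(k < L) \sum_(l < L)
   ((N S)%:R^-1 * \sum_(i < N S) (A i x - r i x) * Z S x i k) *
   (invmx ((N S)%:R^-1 *: ((Z S x)^T *m Z S x)) l k *
   ((N S)%:R^-1 * \sum_(i < N S) Z S x i l * O i x))); last first.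
  apply: eq_bigr => k _; apply: eq_bigr => l _.
  congr (_ * _ * (_ * (_ * _))); apply: eq_bigr => i _; by rewrite !mxE.
by rewrite [LHS]addrAC [X in X - _]addrAC.
Unshelve. all: by end_near. Qed.

End RegressionForms.

Lemma weighted_variance_Op (b : forall S, 'I_(N S) -> 'I_S -> T -> R) (B : R) : 0 <= B ->
  (forall S i s, smeasurable S (b S i s)) -> (forall S i s x, `|b S i s x| <= B) ->
  Op P (fun S x => (N S)%:R^-1 * \sum_(i < N S) \sum_(s < S) w i s x ^+ 2 * v s x * b S i s x).
Proof.
move=> B0 mb bB; have K1 : 0 <= 1 + K by rewrite addr_ge0.
apply: (@Op_L1 _ _ _ _ _ (B * (1 + K))); near=> S.
apply: mean_integrable => [|i]; first exact: mulr_ge0.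
apply: variance_gap_expectation => // s; first by have [] := v_variance s.
exact: (variance_first_moment (@Cmeasurable S) (@lX S) nu0 (@m_sbounded S)
  (@m_mean S) (@v_variance S) (@X_moment S)).
Unshelve. all: by end_near. Qed.

End FullForms.

End Asymptotics.

(** * Sigma-algebras generated by families of functions *)

Section GeneratedSigma.
Context {d} {T : measurableType d} {R : realType}.
Variable H : set (T -> R).

Definition generators : set (set T) :=
  \bigcup_(f in H) preimage_set_system setT f measurable.

Lemma generators_measurable : (forall f, H f -> measurable_fun setT f) ->
  generators `<=` measurable.
Proof. by move=> mH _ [f Hf [B mB <-]]; exact: mH. Qed.

Lemma generators_smeasurable f : H f ->
  measurable_fun (T := g_sigma_algebraType generators) setT f.
Proof.
move=> Hf _ B mB; apply: sub_sigma_algebra; exists f => //.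
by exists B.
Qed.

End GeneratedSigma.

(** * Ratios, changes of version, consequences of moment bounds *)

Section Auxiliary.
Context {d} {T : measurableType d} {R : realType} (P : probability T R).
Local Notation "''E' f" := (Rintegral P setT f) (at level 10, f at level 9).
Local Notation L1 f := (P.-integrable setT (EFin \o f)).

(** [Db] may oscillate: its boundedness in probability controls its product with the difference of
    the inverse denominators, which share the nonzero limit [c]. *)
Lemma ratio_op (D Db V Vb : nat -> T -> R) (c : R) : c != 0 ->
  op P (fun n x => D n x - Db n x) -> op P (fun n x => V n x - Vb n x) ->
  op P (fun n x => Vb n x - c) -> Op P Db ->
  op P (fun n x => D n x / V n x - Db n x / Vb n x).
Proof.
move=> c0 oD oV oc ODb.
have oVc : op P (fun n x => V n x - c).
  by apply: op_eq (opD oV oc) _ => n x; rewrite addrA subrK.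
have o1 := opM oD (Op_inv c0 oVc).
have o2 := opMr ODb (opB (op_inv c0 oVc) (op_inv c0 oc)).
by apply: op_eq (opD o1 o2) _ => n x; ring.
Qed.

Variable C : set (set T).
Hypothesis Cmeasurable : C `<=` measurable.
Local Notation sbounded f := (@bounded_mfun _ (g_sigma_algebraType C) _ f).
Local Notation is_cexp f g := (is_cond_expectation P <<s C >> f g).

Lemma cond_expectation_ae_left (f f' g : T -> R) : is_cexp f g ->
  measurable_fun setT f' -> {ae P, forall x, f x = f' x} -> is_cexp f' g.
Proof.
move=> [lf mg lg fg] mf' ff'.
have lf' : L1 f' by exact: (ae_integrableR lf mf' ff').
split => // A sA; rewrite -fg//; have mA := sub_sigma_measurable Cmeasurable sA.
apply: ae_eq_integral => //.
- apply: measurable_funTS; apply/measurable_EFinP.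
  exact: integrable_measurable lf'.
- apply: measurable_funTS; apply/measurable_EFinP.
  exact: integrable_measurable lf.
- by apply: filterS ff' => x fx _; rewrite /= fx.
Qed.

Lemma cond_expectation_le_mean (f : T -> R) (M : R) :
  cond_expectation_le P <<s C >> f M -> L1 f /\ 'E f <= M.
Proof.
move=> fM; split; first by have [? [? _ _ _] _] := fM.
have := cond_expectation_le_pull Cmeasurable fM
  (bounded_mfun_cst (T := g_sigma_algebraType C) 1) (fun=> ler01).
by rewrite expectation_cstR mulr1; under eq_fun do rewrite mulr1.
Qed.

Lemma cond_expectation_le_weaken (f : T -> R) (M M' : R) : M <= M' ->
  cond_expectation_le P <<s C >> f M -> cond_expectation_le P <<s C >> f M'.
Proof.
move=> MM [m fm mM]; exists m => //; apply: filterS mM => x /le_trans; exact.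
Qed.

(** The conditional mean inherits an almost sure bound from the moment of the shock. Applied to
    [Z_s'gamma], this bounds a combination of variables whose second moments alone are
    controlled. *)
Lemma conditional_mean_bound (X m : T -> R) (nu K : R) : 0 < nu ->
  is_cexp X m ->
  cond_expectation_le P <<s C >> (fun x => `|X x| `^ (2 + nu)) K ->
  {ae P, forall x, `|m x| <= 2 + K}.
Proof.
move=> nu0 Xm XK; apply: (cond_expectation_ae_bound Cmeasurable Xm) => c bc c0.
have [lX _ _ _] := Xm; have [? [lXp _ _ _] _] := XK.
have bc' := sbounded_bounded Cmeasurable bc.
have lXc : L1 (fun x => `|X x| `^ (2 + nu) * c x) by exact: integrableMR.
have lc : L1 c by exact: bounded_integrable.
apply: (@le_trans _ _ ('E (fun x => 2 * c x + `|X x| `^ (2 + nu) * c x))).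
  apply: le_expectationR.
  - by apply: integrableMR => //; exact: integrable_normR.
  - by apply: integrableDR => //; exact: integrableZR.
  move=> x; rewrite -mulrDl ler_wpM2r//.
  have := sqr_le_powR (X x) nu0; rewrite -real_normK ?num_real//.
  by have := sqr_ge0 (`|X x| - 1); nra.
rewrite expectationDR//; last exact: integrableZR.
rewrite (expectationZR 2 lc) [leRHS]mulrDl lerD2l.
exact: (cond_expectation_le_pull Cmeasurable XK).
Qed.

End Auxiliary.

(** * Consistency of the regression coefficient *)

Theorem proposition3
  (R : realType) (d : measure_display) (Omega : measurableType d)
  (P : probability Omega R)
  (K : nat) (gamma : 'I_K -> R) (N : nat -> nat)
  (Y0 : forall S : nat, 'I_(N S) -> {RV P >-> R})
  (beta : forall S : nat, 'I_(N S) -> 'I_S -> {RV P >-> R})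
  (w : forall S : nat, 'I_(N S) -> 'I_S -> {RV P >-> R})
  (U : forall S : nat, 'I_(N S) -> 'I_K -> {RV P >-> R})
  (Xs : forall S : nat, 'I_S -> {RV P >-> R})
  (Zs : forall S : nat, 'I_S -> 'I_K -> {RV P >-> R})
  (* observed regional variables: outcome, shifter and controls *)
  (Y X : forall S : nat, Omega -> 'cV[R]_(N S))
  (Z : forall S : nat, Omega -> 'M[R]_(N S, K))
  (* versions of var(X_s | F_0) *)
  (v : forall S : nat, 'I_S -> Omega -> R)
  (w_ge0 : forall S i s x, 0 <= w S i s x)
  (w_le1 : forall S i x, \sum_(s < S) w S i s x <= 1)
  (X_def : forall S i x,
     X S x i ord0 = \sum_(s < S) w S i s x * Xs S s x)
  (v_def : forall S s,
     is_cond_variance P (sigmaF0 (Zs S) (U S) (Y0 S) (beta S) (w S))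
       (Xs S s) (v S s))
  (* (1) *)
  (Y_def : forall S i x,
     Y S x i ord0 = Y0 S i x + \sum_(s < S) w S i s x * Xs S s x * beta S i s x)
  (Z_def : forall S i k x,
     Z S x i k = \sum_(s < S) w S i s x * Zs S s k x + U S i k x)
  (* (2) *)
  (mean_F0 : forall S s,
     is_cond_expectation P (sigmaF0 (Zs S) (U S) (Y0 S) (beta S) (w S))
       (Xs S s) (fun x => \sum_(k < K) Zs S s k x * gamma k))
  (mean_Zs : forall S s,
     is_cond_expectation P (sigmaZ (Zs S) s)
       (Xs S s) (fun x => \sum_(k < K) Zs S s k x * gamma k))
  (* (3) *)
  (U_small : forall k : 'I_K, gamma k != 0 ->
     (((N S)%:R^-1)%:E *
        \sum_(i < N S) 'E_P[fun x => (U S i k x ^+ 2)%R])%E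
       @[S --> \oo] --> 0%E)
  (* (4) *)
  (Xs_indep : forall S,
     cond_independent P (sigmaF0 (Zs S) (U S) (Y0 S) (beta S) (w S))
       (fun s => Xs S s))
  (* (5) *)
  (sector_small : {ae P, forall x,
     (\big[Num.max/0]_(s < S) sector_size (w S) s x /
        \sum_(t < S) sector_size (w S) t x)
       @[S --> \oo] --> 0})
  (* (6) *)
  (beta_bounded : exists C : R, forall S i s,
     {ae P, forall x, `|beta S i s x| <= C})
  (* (7) *)
  (variance_limit : exists2 c : R, 0 < c &
     cvg_in_probability P
       (fun S x => (N S)%:R^-1 *
          \sum_(i < N S) \sum_(s < S) v S s x * w S i s x ^+ 2 : R^o) c)
  (* (8) *)
  (Xs_moment : exists2 nu : R, 0 < nu &
     exists C : R, forall S s,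
       cond_expectation_le P (sigmaF0 (Zs S) (U S) (Y0 S) (beta S) (w S))
         (fun x => `|Xs S s x| `^ (2 + nu)) C)
  (second_moments : exists C : R, forall S,
     [/\ forall i, cond_expectation_le P (sigmaW (w S))
           (fun x => Y0 S i x ^+ 2) C,
         forall i k, cond_expectation_le P (sigmaW (w S))
           (fun x => U S i k x ^+ 2) C &
         forall s k, cond_expectation_le P (sigmaW (w S))
           (fun x => Zs S s k x ^+ 2) C])
  (* (9) *)
  (Z_limit : exists2 Q : 'M[R]_K, positive_definite Q &
     cvg_in_probability P
       (fun S x => (N S)%:R^-1 *: ((Z S x)^T *m Z S x)) Q) :
  cvg_in_probability P
    (fun S x => ols_coefficient (Z S x) (X S x) (Y S x)
                - estimand (w S) (beta S) (v S) x : R^o) 0.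
Proof.
have [nu nu0 [KX XK]] := Xs_moment; pose KM := `|KX|.
have KM0 : 0 <= KM by exact: normr_ge0.
pose H S : set (Omega -> R) :=
  [set f : Omega -> R | exists s k, f = Zs S s k] `|`
  [set f : Omega -> R | exists i k, f = U S i k] `|`
  [set f : Omega -> R | exists i, f = Y0 S i] `|`
  [set f : Omega -> R | exists i s, f = beta S i s] `|`
  [set f : Omega -> R | exists i s, f = w S i s].
pose C S := generators (H S).
have Cm S : C S `<=` measurable.
  apply: generators_measurable => f.
  by move=> [[[[[s [k ->]]|[i [k ->]]]|[i ->]]|[i [s ->]]]|[i [s ->]]];
     exact: measurable_funPT.
have Zs_sm S s k : measurable_fun (T := g_sigma_algebraType (C S)) setT (Zs S s k).
  by apply: generators_smeasurable; do 4!left; exists s, k.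
have U_sm S i k : measurable_fun (T := g_sigma_algebraType (C S)) setT (U S i k).
  by apply: generators_smeasurable; do 3!left; right; exists i, k.
have Y0_sm S i : measurable_fun (T := g_sigma_algebraType (C S)) setT (Y0 S i).
  by apply: generators_smeasurable; do 2!left; right; exists i.
have beta_sm S i s : measurable_fun (T := g_sigma_algebraType (C S)) setT (beta S i s).
  by apply: generators_smeasurable; left; right; exists i, s.
have w_sm S i s : measurable_fun (T := g_sigma_algebraType (C S)) setT (w S i s).
  by apply: generators_smeasurable; right; exists i, s.
have moment S (s : 'I_S) : cond_expectation_le P <<s C S >>
    (fun x => `|Xs S s x| `^ (2 + nu)) KM.
  exact: cond_expectation_le_weaken (ler_norm _) (XK S s).
have lX S (s : 'I_S) : P.-integrable setT (EFin \o Xs S s).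
  by have [] := mean_F0 S s.
pose mraw S (s : 'I_S) x := \sum_(k < K) Zs S s k x * gamma k.
pose m S (s : 'I_S) x := clip (2 + KM) (mraw S s x).
have Bm0 : 0 <= 2 + KM by rewrite addr_ge0.
have mclip S (s : 'I_S) : is_cond_expectation P <<s C S >> (Xs S s) (m S s) /\
    {ae P, forall x, m S s x = mraw S s x}.
  apply: (cond_expectation_clip (Cm S) Bm0 (mean_F0 S s)).
  exact: (conditional_mean_bound (Cm S) nu0 (mean_F0 S s) (moment S s)).
have m_bound S (s : 'I_S) x : `|m S s x| <= 2 + KM by exact: clip_bound.
have m_sb S (s : 'I_S) : @bounded_mfun _ (g_sigma_algebraType (C S)) R (m S s).
  split; last by exists (2 + KM).
  exact: cond_expectation_smeasurable (mclip S s).1.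
(* [v] comes with some version of the conditional mean; uniqueness transfers it to the clipped
   version [m]. *)
have v_var S (s : 'I_S) : is_cond_expectation P <<s C S >>
    (fun x => (Xs S s x - m S s x) ^+ 2) (v S s).
  have [m' Xm' vm'] := v_def S s; apply: (cond_expectation_ae_left (Cm S) vm').
    apply/measurable_funX/measurable_funB => //.
    exact: (sbounded_bounded (Cm S) (m_sb S s)).1.
  have := cond_expectation_ae_eq (Cm S) Xm' (mclip S s).1.
  by apply: filterS => x ->.
have small dl : 0 < dl -> whp P (fun S x => forall s,
    \sum_(i < N S) w S i s x <= dl * (N S)%:R).
  move=> dl0.
  have msize S s : measurable_fun setT (sector_size (w S) s).
    by apply: measurable_sum => i; exact: measurable_funPT.
  have := ae_cvg_op (f := fun S x => \big[Num.max/0]_(s < S) sector_size (w S) s x /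
       \sum_(t < S) sector_size (w S) t x) _ sector_small.
  have mratio S : measurable_fun setT (fun x => \big[Num.max/0]_(s < S) sector_size (w S) s x /
       \sum_(t < S) sector_size (w S) t x).
    apply: measurable_funM; first exact: measurable_bigmax.
    by apply: measurable_invr; exact: measurable_sum.
  move=> /(_ mratio dl dl0); apply: whp_imply => S x ratio s.
  have n0 t : 0 <= sector_size (w S) t x by exact: sumr_ge0.
  (* The shares of a region sum to at most 1, so the total size is at most [N S], and a bound
     relative to the total size implies one relative to [N S]. *)
  have tN : \sum_(t < S) sector_size (w S) t x <= (N S)%:R.
    rewrite /sector_size exchange_big/=.
    apply: (@le_trans _ _ (\sum_(i < N S) 1)).
      by apply: ler_sum => i _; exact: w_le1.
    by rewrite sumr_const card_ord.
  have st : sector_size (w S) s x <= \sum_(t < S) sector_size (w S) t x.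
    by rewrite (bigD1 s)//= lerDl sumr_ge0.
  rewrite -/(sector_size (w S) s x).
  (* When the total size is 0 the division returns 0 and the ratio is uninformative, but then every
     sector has size 0. *)
  have [t0|t0] := eqVneq (\sum_(t < S) sector_size (w S) t x) 0.
    by rewrite (le_trans st)// t0 mulr_ge0// ltW.
  have tp : 0 < \sum_(t < S) sector_size (w S) t x by rewrite lt0r t0 sumr_ge0.
  rewrite (@le_trans _ _ (dl * \sum_(t < S) sector_size (w S) t x))//; last first.
    by rewrite ler_wpM2l// ltW.
  rewrite -ler_pdivrMr// (le_trans _ (ltW ratio))// (le_trans _ (ler_norm _))//.
  rewrite ler_wpM2r ?invr_ge0 ?(ltW tp)//.
  exact: (le_bigmax 0 (fun s : 'I_S => sector_size (w S) s x) s).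
have [Cb beta_le] := beta_bounded; pose B := `|Cb|.
have B0 : 0 <= B by exact: normr_ge0.
pose b S i s x := clip B (beta S i s x).
have b_bound S i s x : `|b S i s x| <= B by exact: clip_bound.
have b_sm S i s : measurable_fun (T := g_sigma_algebraType (C S)) setT (b S i s).
  exact: (@measurable_clip _ _ (g_sigma_algebraType (C S))).
have b_ae S i s : {ae P, forall x, b S i s x = beta S i s x}.
  apply: filterS (beta_le S i s) => x bx; apply: clip_id.
  by rewrite (le_trans bx)// ler_norm.
have [C2 sm2] := second_moments; pose M2 := `|C2|.
have M20 : 0 <= M2 by exact: normr_ge0.
(* The moment bounds in (8) are conditional on [W], so they can be tested against the shares
   themselves; this bounds the second moment of [Z] without a factor [S]. *)
pose CW S := generators [set f : Omega -> R | exists i s, f = w S i s].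
have CWm S : CW S `<=` measurable.
  by apply: generators_measurable => f [i [s ->]]; exact: measurable_funPT.
have w_sw S i s : @bounded_mfun _ (g_sigma_algebraType (CW S)) R (w S i s).
  split; first by apply: generators_smeasurable; exists i, s.
  exists 1 => x; rewrite ger0_norm//.
  exact: (weight_le1 (fun i s => w_ge0 S i s x) (fun i => w_le1 S i x)).
have leW S f : cond_expectation_le P (sigmaW (w S)) f C2 ->
    P.-integrable setT (EFin \o f) /\ Rintegral P setT f <= M2.
  move=> fC; apply: (cond_expectation_le_mean (CWm S)).
  exact: cond_expectation_le_weaken (ler_norm _) fC.
have Y0_moment S i := leW S _ (let: And3 h _ _ := sm2 S in h i).
have U_moment S i k := leW S _ (let: And3 _ h _ := sm2 S in h i k).
have Zs_moment S s k := leW S _ (let: And3 _ _ h := sm2 S in h s k).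
pose wf S (i : 'I_(N S)) (s : 'I_S) : Omega -> R := w S i s.
have Z_E S i k : (fun x => Z S x i k) =
    (fun x => \sum_(s < S) wf S i s x * Zs S s k x + U S i k x).
  by apply/funext => x; rewrite Z_def.
have Z_sm S i k : measurable_fun (T := g_sigma_algebraType (C S)) setT (fun x => Z S x i k).
  rewrite Z_E; apply: measurable_funD => //; apply: measurable_sum => s.
  by apply: measurable_funM; [exact: w_sm|exact: Zs_sm].
have Z_moment S i k : P.-integrable setT (EFin \o (fun x => Z S x i k ^+ 2)) /\
    Rintegral P setT (fun x => Z S x i k ^+ 2) <= 2 * M2 + 2 * M2.
  pose f x := \sum_(s < S) wf S i s x * Zs S s k x.
  have mf : measurable_fun setT f.
    by apply: measurable_sum => s; apply: measurable_funM; exact: measurable_funPT.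
  have -> : (fun x => Z S x i k ^+ 2) = (fun x => (f x + U S i k x) ^+ 2).
    by apply/funext => x; rewrite Z_def.
  apply: second_momentD => //.
  apply: (weighted_second_moment CWm (fun S i s => (w_sw S i s).1) w_ge0 w_le1) => // s.
    by have [] := Zs_moment S s k.
  apply: (cond_expectation_le_pull (CWm S)) => //.
  apply: cond_expectation_le_weaken (ler_norm _) _.
  by have [_ _] := sm2 S; exact.
pose r S (i : 'I_(N S)) x := \sum_(k < K) U S i k x * gamma k.
have r_meas S i : measurable_fun setT (r S i).
  by apply: measurable_sum => k; apply: measurable_funM.
have r_le S i x : r S i x ^+ 2 <= K%:R * \sum_(k < K) gamma k ^+ 2 * U S i k x ^+ 2.
  have := weighted_cauchy_schwarz (fun k => U S i k x * gamma k) (fun=> ler01).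
  rewrite sumr_const card_ord; under eq_bigr do rewrite mul1r.
  move=> /le_trans; apply; rewrite ler_wpM2l//; apply: ler_sum => k _.
  by rewrite mul1r exprMn mulrC.
have lU S i k : P.-integrable setT (EFin \o (fun x => gamma k ^+ 2 * U S i k x ^+ 2)).
  by apply: integrableZR; have [] := U_moment S i k.
have lrb S i : P.-integrable setT
    (EFin \o (fun x => K%:R * \sum_(k < K) gamma k ^+ 2 * U S i k x ^+ 2)).
  by apply/integrableZR/integrable_sumR => k _; exact: lU.
have r_int S i : P.-integrable setT (EFin \o (fun x => r S i x ^+ 2)).
  apply: le_integrableR _ _ (lrb S i) => [|x]; first exact: measurable_funX.
  by rewrite ger0_norm ?sqr_ge0.
pose a k S := (N S)%:R^-1 * \sum_(i < N S) Rintegral P setT (fun x => U S i k x ^+ 2).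
have a_small k (e : R) : 0 < e -> \forall S \near \oo, gamma k ^+ 2 * a k S <= e.
  (* Condition (3) is silent about [k] with [gamma k = 0]; there the weight [gamma k ^+ 2] removes
     the term. *)
  move=> e0; have [->|gk] := eqVneq (gamma k) 0.
    by near=> S; rewrite expr0n mul0r ltW.
  have := U_small k gk.
  rewrite (_ : (fun S => _) = EFin \o a k); last first.
    apply/funext => S; rewrite /a/= EFinM -sumEFin; congr (_ * _)%E.
    apply: eq_bigr => i _; rewrite unlock -EFin_expectationR//.
    by have [] := U_moment S i k.
  move=> /fine_cvgP[_ /cvgrPdist_le].
  have g2 : 0 < gamma k ^+ 2 by rewrite lt0r sqrf_eq0 gk sqr_ge0.
  move=> /(_ (e / gamma k ^+ 2) (divr_gt0 e0 g2)); apply: filterS => S.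
  rewrite /= sub0r normrN => /(le_trans (ler_norm _)).
  by rewrite ler_pdivlMr// mulrC.
have r_small (e : R) : 0 < e -> \forall S \near \oo,
    (N S)%:R^-1 * \sum_(i < N S) Rintegral P setT (fun x => r S i x ^+ 2) <= e.
  (* One factor [K] comes from Cauchy-Schwarz over the controls and one from the number of summands;
     the added 1 keeps the divisor positive. *)
  move=> e0; have K1 : 0 < K%:R * K%:R + 1 :> R by rewrite ltr_pwDr// mulr_ge0.
  have e1 : 0 < e / (K%:R * K%:R + 1) by rewrite divr_gt0.
  have : \forall S \near \oo, forall k, gamma k ^+ 2 * a k S <= e / (K%:R * K%:R + 1).
    by apply: filter_forall => k; exact: a_small.
  apply: filterS => S aS.
  apply: (@le_trans _ _ (K%:R * \sum_(k < K) gamma k ^+ 2 * a k S)).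
    have -> : \sum_(k < K) gamma k ^+ 2 * a k S = (N S)%:R^-1 *
       \sum_(i < N S) \sum_(k < K) gamma k ^+ 2 * Rintegral P setT (fun x => U S i k x ^+ 2).
      rewrite exchange_big/= mulr_sumr; apply: eq_bigr => k _.
      by rewrite /a mulrCA -mulr_sumr.
    rewrite mulrCA ler_wpM2l ?invr_ge0// mulr_sumr; apply: ler_sum => i _.
    apply: le_trans (le_expectationR (r_int S i) (lrb S i) (r_le S i)) _.
    rewrite expectationZR; last by apply: integrable_sumR => k _; exact: lU.
    rewrite ler_wpM2l// expectation_sumR; last by move=> k _; exact: lU.
    apply: ler_sum => k _; rewrite expectationZR//.
    by have [] := U_moment S i k.
  apply: (@le_trans _ _ (K%:R * \sum_(k < K) e / (K%:R * K%:R + 1))).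
    by rewrite ler_wpM2l// ler_sum.
  rewrite sumr_const card_ord -[X in K%:R * X]mulr_natl.
  rewrite (_ : _ * _ = e * (K%:R * K%:R) / (K%:R * K%:R + 1)); last by ring.
  by rewrite ler_pdivrMr// ler_wpM2l ?(ltW e0)// lerDl.
have [Q Qpos Qlim] := Z_limit; have Q_det := positive_definite_det Qpos.
have Z_mx S : measurable_mx (Z S).
  by move=> i k; exact: (smeasurable_measurable (Cm S)).
have Qn_op k l : op P (fun S x => ((N S)%:R^-1 *: ((Z S x)^T *m Z S x)) k l - Q k l).
  have mQ S : measurable_fun setT (fun x => `|(N S)%:R^-1 *: ((Z S x)^T *m Z S x) - Q|).
    apply: measurable_mx_norm => k' l'.
    rewrite (_ : (fun x => _) =
        (fun x => (N S)%:R^-1 * ((Z S x)^T *m Z S x) k' l' - Q k' l')); last first.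
      by apply/funext => x; rewrite !mxE.
    apply: measurable_funB => //; apply: measurable_funM => //.
    exact: (measurable_mulmx (measurable_trmx (Z_mx S)) (Z_mx S)).
  apply: op_le (cvg_in_probability_op mQ Qlim) _; apply: whp_ae => S; apply: aeW => x.
  rewrite normr_id; apply: le_trans (le_mx_norm _ k l).
  by rewrite !mxE.
have [c c0 Vlim] := variance_limit.
(* The trailing factor 1 makes this the instance [b = 1] of the weighted average of variances in the
   general limit. *)
pose V1 S x := (N S)%:R^-1 * \sum_(i < N S) \sum_(s < S) wf S i s x ^+ 2 * v S s x * 1.
have mv S s : measurable_fun setT (v S s).
  have [_ _ lv _] := v_var S s; exact: integrable_measurable lv.
have mwf S i s : measurable_fun setT (wf S i s) by exact: measurable_funPT.
have V1_op : op P (fun S x => V1 S x - c).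
  have V1E S x : V1 S x = (N S)%:R^-1 *
      \sum_(i < N S) \sum_(s < S) v S s x * w S i s x ^+ 2.
    by congr (_ * _); apply: eq_bigr => i _; apply: eq_bigr => s _; rewrite mulr1 mulrC.
  have mV S : measurable_fun setT (V1 S).
    apply: measurable_funM => //; apply: measurable_sum => i; apply: measurable_sum => s.
    by apply: measurable_funM => //; apply: measurable_funM => //; exact: measurable_funX.
  have mV' S : measurable_fun setT (fun x => `|(N S)%:R^-1 *
      (\sum_(i < N S) \sum_(s < S) v S s x * w S i s x ^+ 2) - c|).
    apply: measurableT_comp => //; apply: measurable_funB => //.
    by rewrite (_ : (fun x => _) = V1 S)//; apply/funext => x; rewrite V1E.
  apply: op_le (cvg_in_probability_op (V := R^o) mV' Vlim) _.
  by apply: whp_ae => S; apply: aeW => x; rewrite V1E normr_id.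
(* With [N S = 0] the average in (7) would be 0, whereas it is nonzero with high probability since
   [c > 0]. *)
have N_neq0 : whp P (fun S _ => (N S)%:R != 0 :> R).
  apply: whp_imply (whp_neq0 (lt0r_neq0 c0) V1_op) => S x; apply: contraNN => /eqP N0.
  by rewrite /V1 N0 invr0 mul0r.
have whp_unit : whp P (fun S x => (N S)%:R != 0 :> R /\ (Z S x)^T *m Z S x \in unitmx).
  apply: whp_imply (whp_and N_neq0 (whp_neq0 Q_det (op_det Qn_op))) => S x [N0 dZ].
  by split => //; rewrite -(@unitmxZ _ _ (N S)%:R^-1) ?unitfE ?invr_eq0// unitmxE unitfE.
pose shock S x := \col_i (\sum_(s < S) wf S i s x * (Xs S s x - m S s x) - r S i x).
have X_E : whp P (fun S x => X S x = shock S x + Z S x *m \col_k gamma k).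
  apply: whp_imply (whp_ae (Q := fun S x => forall s, m S s x = mraw S s x) _); last first.
    by move=> S; apply: filter_forall => s; have [] := mclip S s.
  move=> S x mE; apply/colP => i; rewrite X_def !mxE.
  under [X in _ = _ + X]eq_bigr do rewrite mxE Z_def mulrDl.
  rewrite (_ : \sum_(k < K) _ = \sum_(s < S) w S i s x * mraw S s x + r S i x); last first.
    rewrite big_split/=; congr (_ + _); rewrite /mraw.
    under [RHS]eq_bigr do rewrite mulr_sumr.
    rewrite [RHS]exchange_big/=; apply: eq_bigr => k _.
    by rewrite mulr_suml; apply: eq_bigr => s _; rewrite mulrA.
  rewrite (_ : \sum_(s < S) wf S i s x * _ =
      \sum_(s < S) w S i s x * Xs S s x - \sum_(s < S) w S i s x * mraw S s x); last first.
    by rewrite -sumrB; apply: eq_bigr => s _; rewrite mE mulrBr.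
  by ring.
have Y_E : whp P (fun S x => Y S x =
    \col_i (Y0 S i x + \sum_(s < S) wf S i s x * (b S i s x * Xs S s x))).
  apply: whp_imply
    (whp_ae (Q := fun S x => forall i s, b S i s x = beta S i s x) _); last first.
    by move=> S; apply: filter_forall => i; apply: filter_forall => s; exact: b_ae.
  move=> S x bE; apply/colP => i; rewrite Y_def !mxE; congr (_ + _).
  by apply: eq_bigr => s _; rewrite bE mulrAC mulrA.
have core y b' By B' := @residual_form_op _ _ _ P N C Cm wf w_sm w_ge0 w_le1 small
  (fun S s => Xs S s) m v nu KM nu0 KM0 lX Xs_indep m_sb (fun S s => (mclip S s).1)
  v_var moment K Z Q r _ _ N_neq0 Z_sm (addr_ge0 (mulr_ge0 (ler0n _ 2) M20)
  (mulr_ge0 (ler0n _ 2) M20)) Z_moment Q_det Qn_op r_meas r_int r_small Bm0 m_bound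
  y b' By B'.
have core1 := core (fun S i => Y0 S i) b M2 B M20 B0 Y0_sm Y0_moment b_sm b_bound.
have y0_moment S (i : 'I_(N S)) : P.-integrable setT (EFin \o (fun=> 0 ^+ 2 : R)) /\
    Rintegral P setT (fun=> 0 ^+ 2 : R) <= 0.
  by split; [exact/bounded_integrable/bounded_mfun_cst|rewrite expectation_cstR expr0n].
have one_bound S (i : 'I_(N S)) (s : 'I_S) (x : Omega) : `|1 : R| <= 1.
  by rewrite normr1.
have cst_sm S (a0 : R) :
    measurable_fun (T := g_sigma_algebraType (C S)) setT (fun _ : Omega => a0).
  exact: (@measurable_cst _ _ (g_sigma_algebraType (C S))).
have core2 := core (fun _ _ _ => 0) (fun _ _ _ _ => 1) 0 1 (lexx 0) ler01
  (fun S _ => cst_sm S 0) y0_moment (fun S _ _ => cst_sm S 1) one_bound.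
pose Db S x := (N S)%:R^-1 * \sum_(i < N S) \sum_(s < S) wf S i s x ^+ 2 * v S s x * b S i s x.
have Db_Op : Op P Db.
  exact: (@weighted_variance_Op _ _ _ P N C Cm wf w_sm w_ge0 w_le1
    (fun S s => Xs S s) m v nu KM nu0 KM0 lX m_sb (fun S s => (mclip S s).1)
    v_var moment b B B0 b_sm b_bound).
pose D S x := (N S)%:R^-1 * ((ols_residual (Z S x) (X S x))^T *m Y S x) ord0 ord0.
pose V S x := (N S)%:R^-1 * ((ols_residual (Z S x) (X S x))^T *m X S x) ord0 ord0.
have residual_E : whp P (fun S x =>
    ols_residual (Z S x) (X S x) = ols_residual (Z S x) (shock S x)).
  by apply: whp_imply (whp_and whp_unit X_E) => S x [[_ ZZ] ->];
     rewrite ols_residual_shift.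
have D_op : op P (fun S x => D S x - Db S x).
  apply: op_whp_eq core1 _; apply: whp_imply (whp_and residual_E Y_E) => S x [rE yE].
  by rewrite /D rE yE.
have V_op : op P (fun S x => V S x - V1 S x).
  apply: op_whp_eq core2 _; apply: whp_imply residual_E => S x rE.
  rewrite /V rE; congr (_ * (_ *m _) _ _ - _); apply/colP => i.
  rewrite X_def !mxE add0r; apply: eq_bigr => s _; by rewrite mul1r.
have ratio := ratio_op (lt0r_neq0 c0) D_op V_op V1_op Db_Op.
have mX S : measurable_mx (X S).
  move=> i j; rewrite ord1 (_ : (fun x => _) = (fun x => \sum_(s < S) wf S i s x * Xs S s x)).
    by apply: measurable_sum => s; apply: measurable_funM => //; exact: measurable_funPT.
  by apply/funext => x; rewrite X_def.
have mY S : measurable_mx (Y S).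
  move=> i j; rewrite ord1 (_ : (fun x => _) =
      (fun x => Y0 S i x + \sum_(s < S) wf S i s x * Xs S s x * beta S i s x)).
    apply: measurable_funD; first exact: measurable_funPT.
    apply: measurable_sum => s; apply: measurable_funM; last exact: measurable_funPT.
    by apply: measurable_funM => //; exact: measurable_funPT.
  by apply/funext => x; rewrite Y_def.
apply: op_cvg_in_probability => [S|].
  apply: measurable_funB; first exact: measurable_ols_coefficient.
  apply: measurable_funM; last apply: measurable_invr;
    apply: measurable_sum => i; apply: measurable_sum => s.
    apply: measurable_funM; last exact: measurable_funPT.
    by apply: measurable_funM => //; exact: measurable_funX.
  by apply: measurable_funM => //; exact: measurable_funX.
(* The limit just obtained concerns normalized quantities and the clipped [b]. With high probability
   the Gram matrix is invertible, the factors [N^-1] cancel and [b] equals [beta], so the difference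
   is the one claimed. *)
apply: op_whp_eq ratio _.
have b_E : whp P (fun S x => forall i s, b S i s x = beta S i s x).
  by apply: whp_ae => S; apply: filter_forall => i; apply: filter_forall => s; exact: b_ae.
apply: whp_imply (whp_and whp_unit b_E) => S x [[N0 ZZ] bE].
have cancelN (p q : R) : (N S)%:R^-1 * p / ((N S)%:R^-1 * q) = p / q.
  by rewrite invfM mulrACA divff ?mul1r// invr_eq0.
congr (_ - _).
  by rewrite /D /V cancelN /ols_coefficient ols_residual_sqr.
rewrite /Db /V1 cancelN /estimand; congr (_ / _).
  by apply: eq_bigr => i _; apply: eq_bigr => s _; rewrite bE.
by apply: eq_bigr => i _; apply: eq_bigr => s _; rewrite mulr1.
Unshelve. all: by end_near. Qed.
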